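(* For every knot type $[K]$, $s_{sh}[K] < s_L[K]$, where $s_L[K]$ and $s_{sh}[K]$ are the stick numbers of $[K]$ in the cubic lattice and in the simple hexagonal lattice, respectively.
   Context: The cubic lattice $\mathbb{L}^3$ is the point lattice $\mathbb{Z}^3\subset\mathbb{R}^3$ with basis $x=\langle 1,0,0\rangle$, $y=\langle 0,1,0\rangle$, $z=\langle 0,0,1\rangle$. The simple hexagonal lattice (sh-lattice) is the set of integer combinations of $x=\langle 1,0,0\rangle$, $y=\langle \tfrac12,\tfrac{\sqrt3}{2},0\rangle$, $w=\langle 0,0,1\rangle$; in the sh-lattice one also sets $z=y-x=\langle -\tfrac12,\tfrac{\sqrt3}{2},0\rangle$. An edge is a segment joining two lattice points that differ by $\pm x,\pm y,\pm z$ in the cubic lattice, or by $\pm x,\pm y,\pm z,\pm w$ in the sh-lattice. A polygon (lattice knot) in one of these lattices is a non-self-intersecting closed polygonal path made of edges of that lattice. A stick of a polygon $\mathcal P$ is a maximal line segment of $\mathcal P$ parallel to one of these directions. $|\mathcal P|$ is the total number of sticks of $\mathcal P$. The stick number of a knot type $[K]$ in a lattice is the minimum of $|\mathcal P|$ over all polygons $\mathcal P$ in that lattice representing $[K]$. It is denoted $s_L[K]$ for the cubic lattice and $s_{sh}[K]$ for the sh-lattice. Knot types include the unknot. *)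

(* Defs.v *)
From HB Require Import structures.
From mathcomp Require Import all_boot all_order all_algebra.
From mathcomp Require Import all_classical all_reals all_analysis.

Set Implicit Arguments.
Unset Strict Implicit.
Unset Printing Implicit Defensive.

Import Order.TTheory GRing.Theory Num.Theory.
Import numFieldNormedType.Exports.

Local Open Scope classical_set_scope.
Local Open Scope ring_scope.

Definition vec3 (R : realType) (a b c : R) : 'rV[R]_3 :=
  \row_(i < 3) [:: a; b; c]`_i.

Definition segpt (R : realType) (a b : 'rV[R]_3) (t : R) : 'rV[R]_3 :=
  (1 - t) *: a + t *: b.

Definition segment (R : realType) (a b : 'rV[R]_3) : set 'rV[R]_3 :=
  [set segpt a b t | t in [set t : R | 0 <= t <= 1]].

(* Closed polygonal paths are given by their cyclic sequence of vertices
   v : 'I_n -> 'rV[R]_3, where ordS is the cyclic successor on 'I_n.  Successive edges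
   may be collinear, as happens for lattice paths made of unit edges. *)
Definition path_carrier (R : realType) (n : nat) (v : 'I_n -> 'rV[R]_3) :
    set 'rV[R]_3 :=
  \bigcup_(i in [set: 'I_n]) segment (v i) (v (ordS i)).

(* The parametrisation of the closed path by 'I_n * [0, 1[ is injective. *)
Definition non_self_intersecting (R : realType) (n : nat) (v : 'I_n -> 'rV[R]_3) :
    Prop :=
  forall (i j : 'I_n) (s t : R), 0 <= s < 1 -> 0 <= t < 1 ->
    segpt (v i) (v (ordS i)) s = segpt (v j) (v (ordS j)) t -> i = j /\ s = t.

Definition polygon (R : realType) (P : set 'rV[R]_3) : Prop :=
  exists (n : nat) (v : 'I_n -> 'rV[R]_3),
    [/\ (2 < n)%N, non_self_intersecting v & P = path_carrier v].

Definition homeomorphism (T U : topologicalType) (f : T -> U) : Prop :=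
  continuous f /\
  exists g : U -> T, [/\ continuous g, cancel f g & cancel g f].

Definition ambient_isotopic (R : realType) (K K' : set 'rV[R]_3) : Prop :=
  exists H : R -> 'rV[R]_3 -> 'rV[R]_3,
    [/\ {within [set p : R * 'rV[R]_3 | 0 <= p.1 <= 1],
          continuous (fun p : R * 'rV[R]_3 => H p.1 p.2)},
        (forall t, 0 <= t <= 1 -> homeomorphism (H t)),
        H 0 = id
      & H 1 @` K = K'].

Definition tame_knot (R : realType) (K : set 'rV[R]_3) : Prop :=
  exists2 P : set 'rV[R]_3, polygon P & ambient_isotopic K P.

Definition knot_type (R : realType) (K : set 'rV[R]_3) : set (set 'rV[R]_3) :=
  [set K' | ambient_isotopic K K'].

Record lattice (R : realType) := Lattice {
  lattice_point : set 'rV[R]_3;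
  lattice_directions : seq 'rV[R]_3
}.

Definition int_span3 (R : realType) (u v w : 'rV[R]_3) : set 'rV[R]_3 :=
  [set p | exists a b c : int, p = u *~ a + v *~ b + w *~ c].

Definition cubic_lattice (R : realType) : lattice R :=
  let x := vec3 1 0 0 in
  let y := vec3 0 1 0 in
  let z := vec3 0 0 1 in
  Lattice (int_span3 x y z) [:: x; y; z].

Definition sh_lattice (R : realType) : lattice R :=
  let x := vec3 1 0 0 in
  let y := vec3 (1 / 2) (Num.sqrt 3 / 2) 0 in
  let w := vec3 0 0 1 in
  let z := y - x in
  Lattice (int_span3 x y w) [:: x; y; z; w].

Definition lattice_edge (R : realType) (L : lattice R) (a b : 'rV[R]_3) : Prop :=
  [/\ lattice_point L a, lattice_point L b
    & exists2 d, d \in lattice_directions L & b - a = d \/ b - a = - d].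

Definition lattice_polygon (R : realType) (L : lattice R) (P : set 'rV[R]_3) :
    Prop :=
  exists (n : nat) (v : 'I_n -> 'rV[R]_3),
    [/\ (2 < n)%N,
        (forall i, lattice_edge L (v i) (v (ordS i))),
        non_self_intersecting v
      & P = path_carrier v].

Definition directed_segment (R : realType) (L : lattice R) (S : set 'rV[R]_3) :
    Prop :=
  exists (a d : 'rV[R]_3) (r : R),
    [/\ d \in lattice_directions L, 0 < r & S = segment a (a + r *: d)].

Definition sticks (R : realType) (L : lattice R) (P : set 'rV[R]_3) :
    set (set 'rV[R]_3) :=
  [set S | [/\ directed_segment L S, S `<=` P
             & forall S', directed_segment L S' -> S' `<=` P ->
                 S `<=` S' -> S' = S]].

Definition has_sticks (R : realType) (L : lattice R) (P : set 'rV[R]_3)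
    (k : nat) : Prop :=
  (sticks L P #= `I_k)%card.

Definition stick_counts (R : realType) (L : lattice R)
    (C : set (set 'rV[R]_3)) : set nat :=
  [set k | exists P, [/\ lattice_polygon L P, C P & has_sticks L P k]].

(* s is the minimum of the number of sticks over the polygons of L whose knot
   type is C.  This is a relation, so that asserting it includes the existence
   of such a polygon. *)
Definition is_stick_number (R : realType) (L : lattice R)
    (C : set (set 'rV[R]_3)) (s : nat) : Prop :=
  stick_counts L C s /\ forall k, stick_counts L C k -> (s <= k)%N.

(* Main.v *)
From HB Require Import structures.
Require Import Defs.
From mathcomp Require Import all_boot all_order all_algebra.
From mathcomp Require Import all_classical all_reals all_analysis.
From mathcomp Require Import ring lra zify.

Set Implicit Arguments.
Unset Strict Implicit.
Unset Printing Implicit Defensive.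

Import Order.TTheory GRing.Theory Num.Theory.
Import numFieldNormedType.Exports.

Local Open Scope classical_set_scope.
Local Open Scope ring_scope.

(** Cutting a single corner of a cubic polygon turns it into a polygon of the
    sh-lattice that has one stick less; the rest of the work is to make sense of
    the two stick numbers and to follow the knot type.

    Isotopies.  A displacement of a set whose Lipschitz constant is less than one
    extends to space (McShane's formula, at no cost in the sup norm), and
    id + t u is then an ambient isotopy by Banach's fixed point theorem
    [isotopic_of_small_displacement].  For an embedded polygon, distances in space
    are bounded below by distances along the polygon, uniformly over a compact
    family of polygons [gauge_lower].  Hence a linear motion of the vertices that
    keeps the polygon embedded extends to an ambient isotopy
    [isotopic_of_deformation], and small motions always do.  In particular a
    corner can be cut when the triangle that it spans is free [cut_corner].

    A cubic representative exists.  Corners are cut, close to the vertex, in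
    directions in which one coordinate is constant, until any two consecutive
    edges lie in a common closed octant [isotopic_agreeing].  Rounding the vertices to a fine grid
    preserves this property, and then each edge can be pushed onto a fine
    staircase: next to an edge, the sum of the coordinates with the signs of the
    octant increases along everything in sight, so that nothing collides
    [refine_edge].  A homothety makes the vertices integral.

    Sticks.  When a polygon turns at each of its vertices, a segment contained in
    it lies in one edge, hence its sticks are its edges [has_sticks_turning];
    collinear consecutive edges can be merged beforehand.

    The saving.  Take a cubic polygon with the least number of sticks, a corner of
    it, and permute the axes so that the corner lies in a horizontal plane.  The
    unit strips along its two legs contain no lattice point in their interior, so
    a stretching of the coordinates makes the legs equally long and the strips so
    wide that they cover the triangle of the corner [stretch1_leg].  No edge meets
    the interior of such a strip without hitting the leg, therefore the corner can
    be cut [cut_right_angle].  The linear map from the cubic basis to x, y or z,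
    and w takes the new edge to the third horizontal direction of the sh-lattice
    [sh_polygon_of_cut]: two sticks have become one. *)

(** * Ambient isotopies from small Lipschitz displacements *)

Lemma vnorm_le (R : realType) (x : 'rV[R]_3) (c : R) :
  (`|x| <= c) = (0 <= c) && [forall i, `|x 0 i| <= c].
Proof.
apply/idP/andP => [h|[c0 /forallP h]].
  split; first by rewrite (le_trans _ h).
  apply/forallP => i; apply: le_trans h.
  rewrite [leRHS]/Num.Def.normr/= mx_normrE.
  by apply: (le_trans _ (le_bigmax _ _ (ord0, i))).
rewrite [leLHS]/Num.Def.normr/= mx_normrE; apply/bigmax_leP; split=> // -[i j] _ /=.
by rewrite (ord1 i).
Qed.

Lemma coord_le_norm (R : realType) (x : 'rV[R]_3) i : `|x 0 i| <= `|x|.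
Proof.
by have := lexx `|x|; rewrite {1}vnorm_le => /andP[_ /forallP].
Qed.

Lemma norm_le_coord (R : realType) (x : 'rV[R]_3) (c : R) :
  0 <= c -> (forall i, `|x 0 i| <= c) -> `|x| <= c.
Proof. by move=> c0 h; rewrite vnorm_le c0; apply/forallP. Qed.

Lemma homeomorphism_comp (T U W : topologicalType) (f : T -> U) (g : U -> W) :
  homeomorphism f -> homeomorphism g -> homeomorphism (g \o f).
Proof.
move=> [cf [f' [cf' ff' f'f]]] [cg [g' [cg' gg' g'g]]].
split; first by move=> x; apply: continuous_comp; [exact: cf|exact: cg].
exists (f' \o g'); split.
- by move=> x; apply: continuous_comp; [exact: cg'|exact: cf'].
- by move=> x /=; rewrite gg' ff'.
- by move=> x /=; rewrite f'f g'g.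
Qed.

(** The isotopies are composed at each time; since the second one starts at the
    identity, there is nothing to concatenate. *)
Lemma ambient_isotopic_trans (R : realType) (A B C : set 'rV[R]_3) :
  ambient_isotopic A B -> ambient_isotopic B C -> ambient_isotopic A C.
Proof.
move=> [F [cF hF F0 F1]] [G [cG hG G0 G1]].
exists (fun t => G t \o F t); split.
- apply/subspace_continuousP => -[t x] /= t01 U nU.
  move/subspace_continuousP : cF => /(_ (t, x) t01) cF.
  move/subspace_continuousP : cG => /(_ (t, F t x) t01) cG.
  have [[/= V1 V2] [nV1 nV2] V12] := cG _ nU.
  have nV1x : nbhs (t, x) [set p : R * 'rV[R]_3 | V1 p.1] by exact: cvg_fst nV1.
  have nV2x : nbhs (t, x)
      [set p : R * 'rV[R]_3 | 0 <= p.1 <= 1 -> V2 (F p.1 p.2)] by exact: cF nV2.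
  apply: filterS (filterI nV1x nV2x) => -[s y] /= [V1s V2y] s01.
  exact: (V12 (s, F s y)) (conj V1s (V2y s01)) s01.
- by move=> t t01; exact: homeomorphism_comp (hF _ t01) (hG _ t01).
- by rewrite F0 G0.
- by rewrite -G1 -F1 image_comp.
Qed.

(** McShane's formula inf_p (u p + c |x - g p|) extends u, and keeps its
    Lipschitz constant. *)
Lemma mcshane (R : realType) (T : Type) (D : set T) (g : T -> 'rV[R]_3)
    (u : T -> R) (c : R) :
  D !=set0 -> 0 <= c ->
  (forall p q, D p -> D q -> `|u p - u q| <= c * `|g p - g q|) ->
  exists U : 'rV[R]_3 -> R,
    (forall x y, `|U x - U y| <= c * `|x - y|) /\
    (forall p, D p -> U (g p) = u p).
Proof.
move=> [p0 Dp0] c0 lipu.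
pose S x := [set u p + c * `|x - g p| | p in D].
have lb x q : D q -> lbound (S x) (u q - c * `|x - g q|).
  move=> Dq _ [p Dp <-].
  have h1 := lipu p q Dp Dq.
  have h2 : `|g p - g q| <= `|x - g q| + `|x - g p|.
    by have := ler_distD x (g p) (g q); rewrite (distrC (g p) x); lra.
  have h3 : c * `|g p - g q| <= c * (`|x - g q| + `|x - g p|).
    by rewrite ler_wpM2l.
  move: h1; rewrite ler_norml => /andP[h1 _]; lra.
have hinf x : has_inf (S x).
  split; first by exists (u p0 + c * `|x - g p0|); exists p0.
  by exists (u p0 - c * `|x - g p0|); exact: lb.
have half x y : inf (S x) <= inf (S y) + c * `|x - y|.
  rewrite -lerBlDr; apply: lb_le_inf; first by have [] := hinf y.
  move=> _ [p Dp <-]; rewrite lerBlDr.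
  have h1 : inf (S x) <= u p + c * `|x - g p|.
    by apply: ge_inf; [have [] := hinf x|exists p].
  have h2 : `|x - g p| <= `|x - y| + `|y - g p| by exact: ler_distD.
  have h3 : c * `|x - g p| <= c * (`|x - y| + `|y - g p|) by rewrite ler_wpM2l.
  lra.
exists (fun x => inf (S x)); split.
  move=> x y; rewrite ler_norml; apply/andP; split.
    have := half y x; rewrite distrC; lra.
  have := half x y; lra.
move=> p Dp; apply/eqP; rewrite eq_le; apply/andP; split.
  apply: ge_inf; first by have [] := hinf (g p).
  by exists p => //; rewrite subrr normr0 mulr0 addr0.
have h := @lb_le_inf _ (S (g p)) (u p); apply: h; first by have [] := hinf (g p).
by have := @lb (g p) p Dp; rewrite subrr normr0 mulr0 subr0.
Qed.

Lemma push_expand (R : realType) (u : 'rV[R]_3 -> 'rV[R]_3) (c : R)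
    (lipu : forall x y, `|u x - u y| <= c * `|x - y|) x y :
  (1 - c) * `|x - y| <= `|(x + u x) - (y + u y)|.
Proof.
have h := lipu x y.
have -> : (x + u x) - (y + u y) = (x - y) - - (u x - u y).
  by rewrite opprK opprD addrACA.
by have := lerB_dist (x - y) (- (u x - u y)); rewrite normrN; lra.
Qed.

HB.instance Definition _ (R : realType) := Complete.on 'rV[R]_3.

(** A solution of x + u x = y is a fixed point of the contraction y - u. *)
Lemma push_surj (R : realType) (u : 'rV[R]_3 -> 'rV[R]_3) (c : R)
    (c0 : 0 <= c) (c1 : c < 1)
    (lipu : forall x y, `|u x - u y| <= c * `|x - y|) y :
  exists x, x + u x = y.
Proof.
have fT : {homo (fun x => y - u x) : x / [set: 'rV[R]_3] x >-> [set: 'rV[R]_3] x}.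
  by [].
pose f : {fun [set: 'rV[R]_3] >-> [set: 'rV[R]_3]} := mkfun_fun fT.
have ctr : is_contraction f.
  exists (NngNum c0); split => //= -[a b] _ /=.
  have -> : y - u a - (y - u b) = - (u a - u b).
    by rewrite !opprB addrC addrA subrK.
  by rewrite normrN lipu.
have [|| p _ fp] := banach_fixed_point ctr.
- exact: closedT.
- by exists 0.
- by exists p; rewrite {1}fp/= subrK.
Qed.

Lemma lipschitz_continuous (R : realType) (V W : normedModType R)
    (f : V -> W) (c : R) (lipf : forall x y, `|f x - f y| <= c * `|x - y|) :
  continuous f.
Proof.
move=> x; apply/cvgrPdist_lt => e e0.
have k0 : 0 < `|c| + 1 by rewrite ltr_wpDl.
near=> y.
apply: (le_lt_trans (lipf x y)).
have h : `|x - y| < e / (`|c| + 1).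
  near: y; apply: cvgr_dist_lt; first exact: cvg_id.
  by rewrite divr_gt0.
move: h; rewrite ltr_pdivlMr // => h.
apply: le_lt_trans h; rewrite mulrC ler_wpM2l //.
by rewrite (le_trans (ler_norm c)) // lerDl.
Unshelve. all: by end_near.
Qed.

Lemma push_homeomorphism (R : realType) (u : 'rV[R]_3 -> 'rV[R]_3) (c : R)
    (c0 : 0 <= c) (c1 : c < 1)
    (lipu : forall x y, `|u x - u y| <= c * `|x - y|) :
  homeomorphism (fun x => x + u x).
Proof.
split.
  apply: (@lipschitz_continuous _ _ _ _ (1 + c)) => x y.
  have -> : (x + u x) - (y + u y) = (x - y) + (u x - u y).
    by rewrite opprD addrACA.
  by rewrite mulrDl mul1r (le_trans (ler_normD _ _)) // lerD.
have [g gP] := choice (push_surj c0 c1 lipu).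
exists g; split => [|x|//].
  apply: (@lipschitz_continuous _ _ _ _ (1 - c)^-1) => x y.
  rewrite mulrC ler_pdivlMr ?subr_gt0 // mulrC.
  by have := push_expand lipu (g x) (g y); rewrite !gP.
have := push_expand lipu (g (x + u x)) x; rewrite gP subrr normr0.
rewrite pmulr_rle0 ?subr_gt0 // normr_le0 subr_eq0 => /eqP //.
Qed.

(** A displacement of Lipschitz constant less than one is realised by the
    isotopy t |-> id + t u: each id + t u is invertible by Banach's fixed point
    theorem.  In the sup norm, extending the displacement from the set to space
    costs nothing. *)
Lemma isotopic_of_small_displacement (R : realType) (T : Type) (D : set T)
    (g g' : T -> 'rV[R]_3) (c : R) :
  D !=set0 -> 0 <= c < 1 ->
  (forall p q, D p -> D q ->
     `|(g' p - g p) - (g' q - g q)| <= c * `|g p - g q|) ->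
  ambient_isotopic (g @` D) (g' @` D).
Proof.
move=> D0 /andP[c0 c1] lip.
have ext i : exists U : 'rV[R]_3 -> R,
    (forall x y, `|U x - U y| <= c * `|x - y|) /\
    (forall p, D p -> U (g p) = (g' p - g p) 0 i).
  apply: mcshane => // p q Dp Dq.
  apply: le_trans (lip p q Dp Dq).
  by have := coord_le_norm (g' p - g p - (g' q - g q)) i; rewrite !mxE.
have [U UP] := choice ext.
pose u x : 'rV[R]_3 := \row_i U i x.
have lipu x y : `|u x - u y| <= c * `|x - y|.
  apply: norm_le_coord => [|i]; first by rewrite mulr_ge0.
  by rewrite !mxE; have [h _] := UP i.
have ug p : D p -> u (g p) = g' p - g p.
  by move=> Dp; apply/rowP => i; rewrite mxE; have [_ ->] := UP i.
have lipt t : 0 <= t <= 1 ->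
    forall x y, `|t *: u x - t *: u y| <= c * `|x - y|.
  move=> /andP[t0 t1] x y; rewrite -scalerBr normrZ ger0_norm //.
  by apply: le_trans (lipu x y); rewrite ler_piMl.
exists (fun t x => x + t *: u x); split.
- apply: continuous_subspaceT => -[t x].
  apply: (@cvgD _ _ _ (nbhs (t, x))); first exact: cvg_snd.
  apply: (@cvgZ _ _ _ (nbhs (t, x))); first exact: cvg_fst.
  apply: (cvg_comp _ _ cvg_snd).
  exact: (lipschitz_continuous lipu).
- by move=> t t01; exact: (push_homeomorphism c0 c1 (lipt t t01)).
- by apply/funext => x /=; rewrite scale0r addr0.
- rewrite image_comp; apply/seteqP; split => [_ [p Dp <-]|_ [p Dp <-]].
    by exists p => //=; rewrite scale1r ug // addrC subrK.
  by exists p => //=; rewrite scale1r ug // addrC subrK.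
Qed.

(** The gauge d measures parameters rather than points, so that all the maps of
    the family can be compared with it.  Cutting [0, 1] into N > M / m steps makes
    each of them a small displacement. *)
Lemma isotopic_of_expanding_family (R : realType) (T : Type) (D : set T)
    (g h : T -> 'rV[R]_3) (d : T -> T -> R) (m M : R) :
  D !=set0 -> 0 < m -> 0 <= M ->
  (forall t p q, 0 <= t <= 1 -> D p -> D q ->
     m * d p q <= `|segpt (g p) (h p) t - segpt (g q) (h q) t|) ->
  (forall p q, D p -> D q -> `|(h p - g p) - (h q - g q)| <= M * d p q) ->
  ambient_isotopic (g @` D) (h @` D).
Proof.
move=> D0 m0 M0 low up.
pose N := (Num.bound (M / m)).+1.
have N0 : (0 : R) < N%:R by rewrite ltr0n.
have MN : M / (m * N%:R) < 1.
  rewrite ltr_pdivrMr ?mulr_gt0 // mul1r mulrC -ltr_pdivrMr //.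
  have Mm : 0 <= M / m by rewrite divr_ge0 // ltW.
  apply: (lt_trans (archi_boundP Mm)); by rewrite ltr_nat.
have segE (p : T) (t : R) : segpt (g p) (h p) t = g p + t *: (h p - g p).
  by rewrite /segpt scalerBl scalerBr scale1r -addrA (addrC (t *: h p)).
have steps k : (k < N)%N ->
    ambient_isotopic (g @` D) ((fun p => segpt (g p) (h p) (k.+1%:R / N%:R)) @` D).
  have step j : (j < N)%N -> ambient_isotopic
     ((fun p => segpt (g p) (h p) (j%:R / N%:R)) @` D)
     ((fun p => segpt (g p) (h p) (j.+1%:R / N%:R)) @` D).
    move=> jN; apply: (@isotopic_of_small_displacement _ _ _ _ _ (M / (m * N%:R))) => //.
      by rewrite MN divr_ge0 // mulr_ge0 // ltW.
    move=> p q Dp Dq.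
    have -> : segpt (g p) (h p) (j.+1%:R / N%:R) - segpt (g p) (h p) (j%:R / N%:R)
      - (segpt (g q) (h q) (j.+1%:R / N%:R) - segpt (g q) (h q) (j%:R / N%:R)) =
      N%:R^-1 *: ((h p - g p) - (h q - g q)).
      rewrite !segE -natr1; apply/rowP => i; rewrite !mxE; ring.
    have j01 : 0 <= (j%:R / N%:R : R) <= 1.
      rewrite divr_ge0 //= ?ler0n // ler_pdivrMr // mul1r ler_nat.
      exact: ltnW.
    rewrite normrZ ger0_norm ?invr_ge0 ?ler0n //.
    have h1 := low _ p q j01 Dp Dq.
    have h2 := up p q Dp Dq.
    rewrite invfM mulrA (mulrC _ N%:R^-1) -mulrA ler_wpM2l ?invr_ge0 ?ler0n //.
    apply: (le_trans h2); rewrite -mulrA ler_wpM2l //.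
    by rewrite mulrC ler_pdivlMr // mulrC.
  elim: k => [k0|k IH kN].
    have := step 0%N k0; congr ambient_isotopic.
    by apply: eq_imagel => p Dp; rewrite segE mul0r scale0r addr0.
  exact: ambient_isotopic_trans (IH (ltnW kN)) (step _ kN).
have := steps N.-1 (leqnn _); congr ambient_isotopic.
apply: eq_imagel => p Dp.
by rewrite segE divff ?gt_eqF // scale1r addrC subrK.
Qed.

(** * Motions of the vertices of a polygon *)

Lemma segpt0 (R : realType) (a b : 'rV[R]_3) : segpt a b 0 = a.
Proof. by rewrite /segpt subr0 scale1r scale0r addr0. Qed.

Lemma segpt1 (R : realType) (a b : 'rV[R]_3) : segpt a b 1 = b.
Proof. by rewrite /segpt subrr scale1r scale0r add0r. Qed.

Lemma segpt_coord (R : realType) (a b : 'rV[R]_3) t i :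
  segpt a b t 0 i = (1 - t) * a 0 i + t * b 0 i.
Proof. by rewrite !mxE. Qed.

Lemma segpt_continuous (R : realType) (T : topologicalType)
    (a b : T -> 'rV[R]_3) (t : T -> R) :
  continuous a -> continuous b -> continuous t ->
  continuous (fun x => segpt (a x) (b x) (t x)).
Proof.
move=> ca cb ct x; apply: cvgD; apply: cvgZ; [|exact: ca|exact: ct|exact: cb].
by apply: cvgB; [exact: cvg_cst|exact: ct].
Qed.

Lemma unit_cube_lower_bound (R : realType) (f : R * R * R -> R) :
  continuous f ->
  (forall r s t, 0 <= r <= 1 -> 0 <= s <= 1 -> 0 <= t <= 1 -> 0 < f (r, s, t)) ->
  exists2 m, 0 < m &
    forall r s t, 0 <= r <= 1 -> 0 <= s <= 1 -> 0 <= t <= 1 -> m <= f (r, s, t).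
Proof.
move=> cf fpos.
pose I : set R := `[0, 1]%classic.
have cI : compact I by exact: segment_compact.
have cube0 : (I `*` I `*` I) !=set0.
  by exists (0, 0, 0); rewrite /I /= !in_itv /= lexx ler01.
have [[[r s] t]] := compact_EVT_min cube0
  (compact_setX (compact_setX cI cI) cI) (continuous_subspaceT cf).
rewrite inE /I /= !in_itv /= => -[[r01 s01] t01] min.
exists (f (r, s, t)) => [|r' s' t' h1 h2 h3]; first exact: fpos.
by apply: min; rewrite inE /I /= !in_itv.
Qed.

Lemma uniform_positive (R : realType) (I : finType) (P : I -> R -> Prop) :
  (forall i x y, y <= x -> P i x -> P i y) ->
  (forall i, exists2 m, 0 < m & P i m) -> exists2 m, 0 < m & forall i, P i m.
Proof.
move=> mono ex.
have [m mP] := choice (fun i => let: ex_intro2 m a b := ex i in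
  ex_intro (fun m => 0 < m /\ P i m) m (conj a b)).
exists (\big[Order.min/1]_i m i).
  by elim/big_ind: _ => // [x y x0 y0|i _]; [rewrite lt_min x0|case: (mP i)].
by move=> i; apply: mono (proj2 (mP i)); exact: bigmin_le.
Qed.

Lemma ordS_neq n (i : 'I_n) : (1 < n)%N -> ordS i != i.
Proof.
move=> n1; apply/eqP => /(congr1 val) /= h.
have := ltn_ord i; rewrite leq_eqVlt => /orP[/eqP e|lt].
  by move: h; rewrite e modnn; lia.
by move: h; rewrite modn_small //; lia.
Qed.

Definition closed_pt (R : realType) n (v : 'I_n -> 'rV[R]_3) (p : 'I_n * R) :=
  segpt (v p.1) (v (ordS p.1)) p.2.

Definition edge_params (R : realType) n : set ('I_n * R) :=
  [set p | 0 <= p.2 <= 1].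

Lemma path_carrierE (R : realType) n (v : 'I_n -> 'rV[R]_3) :
  path_carrier v = closed_pt v @` @edge_params R n.
Proof.
apply/seteqP; split => [x [i _ [t t01 <-]]|x [[i t] t01 <-]].
  by exists (i, t).
by exists i => //; exists t.
Qed.

(** The distance along a polygon with edges of length 1, truncated to 1 on edges
    without a common vertex.  It bounds the distance in space of two points of any
    embedded polygon from both sides, up to factors. *)
Definition gauge (R : realType) n (p q : 'I_n * R) : R :=
  if p.1 == q.1 then `|p.2 - q.2|
  else if q.1 == ordS p.1 then (1 - p.2) + q.2
  else if p.1 == ordS q.1 then (1 - q.2) + p.2
  else 1.

Lemma gauge_upper (R : realType) n (u : 'I_n -> 'rV[R]_3) (c : R)
    (p q : 'I_n * R) :
  (forall i, `|u i| <= c) -> edge_params p -> edge_params q ->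
  `|closed_pt u p - closed_pt u q| <= 2 * c * gauge p q.
Proof.
move=> uc; case: p q => [i s] [j t]; rewrite /edge_params /= => /andP[s0 s1] /andP[t0 t1].
have c0 : 0 <= c by apply: le_trans (uc i).
have dif a b : `|u a - u b| <= 2 * c.
  by apply: (le_trans (ler_normB _ _)); have := uc a; have := uc b; lra.
rewrite /gauge /closed_pt /=; case: eqVneq => [->|ij].
  have -> : segpt (u j) (u (ordS j)) s - segpt (u j) (u (ordS j)) t =
            (s - t) *: (u (ordS j) - u j).
    by apply/rowP => k; rewrite !mxE; ring.
  by rewrite normrZ mulrC ler_wpM2r.
have adj (k : 'I_n) x y : 0 <= x <= 1 -> 0 <= y <= 1 ->
    `|segpt (u k) (u (ordS k)) x -
      segpt (u (ordS k)) (u (ordS (ordS k))) y| <= 2 * c * ((1 - x) + y).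
  move=> /andP[x0 x1] /andP[y0 y1].
  have -> : segpt (u k) (u (ordS k)) x -
      segpt (u (ordS k)) (u (ordS (ordS k))) y =
      (1 - x) *: (u k - u (ordS k)) + y *: (u (ordS k) - u (ordS (ordS k))).
    by apply/rowP => l; rewrite !mxE; ring.
  rewrite mulrDr; apply: (le_trans (ler_normD _ _)); apply: lerD.
    by rewrite normrZ mulrC ger0_norm ?subr_ge0 // ler_wpM2r ?subr_ge0.
  by rewrite normrZ mulrC ger0_norm // ler_wpM2r.
case: eqVneq => [->|_]; first by apply: adj; apply/andP.
case: eqVneq => [->|_]; first by rewrite distrC; apply: adj; apply/andP.
rewrite mulr1 -[2]/(1 + 1) mulrDl mul1r.
have bd k x : 0 <= x -> x <= 1 -> `|segpt (u k) (u (ordS k)) x| <= c.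
  move=> x0 x1; apply: (le_trans (ler_normD _ _)).
  rewrite !normrZ !ger0_norm ?subr_ge0 //.
  have h1 : (1 - x) * `|u k| <= (1 - x) * c by rewrite ler_wpM2l ?subr_ge0.
  have h2 : x * `|u (ordS k)| <= x * c by rewrite ler_wpM2l.
  lra.
by apply: (le_trans (ler_normB _ _)); apply: lerD; exact: bd.
Qed.

Lemma nsi_edge_neq (R : realType) n (v : 'I_n -> 'rV[R]_3) (i : 'I_n) :
  non_self_intersecting v -> v (ordS i) != v i.
Proof.
move=> nsi; apply/eqP => e.
have half : 0 <= (2^-1 : R) < 1.
  by rewrite invr_ge0 ler0n /= invf_lt1 ?ltr0n // ltr1n.
have zero : 0 <= (0 : R) < 1 by rewrite lexx ltr01.
have [] := nsi i i 0 2^-1 zero half.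
  by rewrite e /segpt -!scalerDl subr0 addr0 subrK.
by move=> _ /eqP; rewrite eq_sym invr_eq0 pnatr_eq0.
Qed.

(** Two consecutive edges make an angle: otherwise the second one starts back
    along the first. *)
Lemma nsi_angle (R : realType) n (v : 'I_n -> 'rV[R]_3) (i : 'I_n) (l : R) :
  (1 < n)%N -> non_self_intersecting v -> 0 <= l <= 1 ->
  segpt (v (ordS i) - v i) (v (ordS (ordS i)) - v (ordS i)) l != 0.
Proof.
move=> n1 nsi /andP[l0 l1]; apply/eqP => e.
have hl : 0 <= l / 2 < 1 by apply/andP; split; lra.
have hl' : 0 <= (1 + l) / 2 <= 1 by apply/andP; split; lra.
have [l1'|l1'] := eqVneq l 1.
  by move: e; rewrite l1' segpt1 => /eqP; rewrite subr_eq0; apply/negP; exact: nsi_edge_neq.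
have hs : 0 <= (1 + l) / 2 < 1.
  by move: l1 l1'; rewrite le_eqVlt => /orP[/eqP ->|]; 
    [rewrite eqxx|move=> ? _; apply/andP; split; lra].
have [] := nsi i (ordS i) _ _ hs hl.
  apply/rowP => k; move/rowP: e => /(_ k); rewrite !mxE => e.
  apply/eqP; rewrite -subr_eq0; apply/eqP.
  by apply: (@mulfI _ (-2)); [rewrite oppr_eq0 pnatr_eq0|rewrite mulr0 -[RHS]e; field].
by move=> /esym /eqP; rewrite (negbTE (ordS_neq _ n1)).
Qed.

Lemma nsi_nonadjacent (R : realType) n (v : 'I_n -> 'rV[R]_3) (p q : 'I_n * R) :
  non_self_intersecting v -> edge_params p -> edge_params q ->
  p.1 != q.1 -> q.1 != ordS p.1 -> p.1 != ordS q.1 ->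
  closed_pt v p != closed_pt v q.
Proof.
case: p q => [i s] [j t] nsi; rewrite /edge_params /closed_pt /= => /andP[s0 s1] /andP[t0 t1].
move=> ij ji ij'; apply/eqP => e.
have zero : 0 <= (0 : R) < 1 by rewrite lexx ltr01.
have norm (k : 'I_n) x : 0 <= x -> x <= 1 -> exists k' x',
   [/\ 0 <= x' < 1, segpt (v k) (v (ordS k)) x = segpt (v k') (v (ordS k')) x' &
     k' = k \/ (k' = ordS k /\ x = 1)].
  move=> x0; rewrite le_eqVlt => /orP[/eqP ->|x1].
    by exists (ordS k), 0; split => //; [rewrite segpt1 segpt0|right].
  by exists k, x; split; [rewrite x0|by []|left].
have [i' [s' [hs es ei]]] := norm i s s0 s1.
have [j' [t' [ht et ej]]] := norm j t t0 t1.
have [eij _] := nsi i' j' s' t' hs ht (etrans (esym es) (etrans e et)).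
case: ei ej => [ei|[ei _]] [ej|[ej _]]; rewrite ei ej in eij.
- by rewrite eij eqxx in ij.
- by rewrite eij eqxx in ij'.
- by rewrite eij eqxx in ji.
- by move/ordS_inj: eij => eij; rewrite eij eqxx in ij.
Qed.

Definition stage (R : realType) n (v w : 'I_n -> 'rV[R]_3) (r : R) :=
  fun i => segpt (v i) (w i) r.

(** On two edges with the same or a common vertex, dividing the distance by the
    gauge leaves the length of an edge, or of a convex combination of two
    consecutive edges.  So there are three kinds of continuous positive functions
    to bound below on a compact cube. *)
Lemma gauge_lower (R : realType) n (v w : 'I_n -> 'rV[R]_3) :
  (2 < n)%N ->
  (forall r, 0 <= r <= 1 -> non_self_intersecting (stage v w r)) ->
  exists2 m, 0 < m & forall r p q, 0 <= r <= 1 ->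
    edge_params p -> edge_params q ->
    m * gauge p q <= `|closed_pt (stage v w r) p - closed_pt (stage v w r) q|.
Proof.
move=> n2 nsi.
have n1 : (1 < n)%N by exact: ltnW.
have cst i : continuous (fun x : R * R * R => stage v w x.1.1 i).
  apply: segpt_continuous => [x|x|x]; [exact: cvg_cst|exact: cvg_cst|].
  by apply: (cvg_comp _ _ cvg_fst); exact: cvg_fst.
have c2 : continuous (fun x : R * R * R => x.1.2).
  by move=> x; apply: (cvg_comp _ _ cvg_fst); exact: cvg_snd.
have c3 : continuous (fun x : R * R * R => x.2) by move=> x; exact: cvg_snd.
have cB (f g : R * R * R -> 'rV[R]_3) : continuous f -> continuous g ->
    continuous (fun x => f x - g x).
  by move=> cf cg x; apply: cvgB; [exact: cf|exact: cg].
have cN (f : R * R * R -> 'rV[R]_3) : continuous f -> continuous (fun x => `|f x|).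
  by move=> cf x; apply: cvg_norm; exact: cf.
have cpt (i : 'I_n) (c : R * R * R -> R) : continuous c ->
    continuous (fun x => closed_pt (stage v w x.1.1) (i, c x)).
  by move=> cc; exact: segpt_continuous (cst i) (cst (ordS i)) cc.
have zer01 : 0 <= (0 : R) <= 1 by rewrite lexx ler01.
have [m1 m10 m1P] : exists2 m, 0 < m & forall i r, 0 <= r <= 1 ->
    m <= `|stage v w r (ordS i) - stage v w r i|.
  apply: uniform_positive => [i x y yx h r r01|i].
    by apply: (le_trans yx); exact: h.
  have [|r s t r01 _ _|m m0 h] := @unit_cube_lower_bound _
    (fun x => `|stage v w x.1.1 (ordS i) - stage v w x.1.1 i|).
  - by apply: cN; apply: cB; exact: cst.
  - by rewrite /= normr_gt0 subr_eq0; apply: nsi_edge_neq; exact: nsi.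
  - by exists m => // r r01; exact: (h _ _ _ r01 zer01 zer01).
have [m2 m20 m2P] : exists2 m, 0 < m & forall i r l, 0 <= r <= 1 -> 0 <= l <= 1 ->
    m <= `|segpt (stage v w r (ordS i) - stage v w r i)
            (stage v w r (ordS (ordS i)) - stage v w r (ordS i)) l|.
  apply: uniform_positive => [i x y yx h r l r01 l01|i].
    by apply: (le_trans yx); exact: h.
  have [|r s t r01 s01 _|m m0 h] := @unit_cube_lower_bound _
    (fun x => `|segpt (stage v w x.1.1 (ordS i) - stage v w x.1.1 i)
            (stage v w x.1.1 (ordS (ordS i)) - stage v w x.1.1 (ordS i)) x.1.2|).
  - by apply: cN; apply: segpt_continuous => //; apply: cB; exact: cst.
  - by rewrite /= normr_gt0; apply: nsi_angle => //; exact: nsi.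
  - by exists m => // r l r01 l01; exact: (h _ _ _ r01 l01 zer01).
have [m3 m30 m3P] : exists2 m, 0 < m & forall ij : 'I_n * 'I_n, forall r s t,
    ij.1 != ij.2 -> ij.2 != ordS ij.1 -> ij.1 != ordS ij.2 ->
    0 <= r <= 1 -> 0 <= s <= 1 -> 0 <= t <= 1 ->
    m <= `|closed_pt (stage v w r) (ij.1, s) - closed_pt (stage v w r) (ij.2, t)|.
  apply: uniform_positive => [i x y yx h r s t h1 h2 h3 h4 h5 h6|[i j] /=].
    by apply: (le_trans yx); exact: h.
  have [ij|ij] := eqVneq i j; first by exists 1 => // r s t; rewrite ij eqxx.
  have [ji|ji] := eqVneq j (ordS i); first by exists 1 => // r s t.
  have [ij'|ij'] := eqVneq i (ordS j); first by exists 1 => // r s t.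
  have [|r s t r01 s01 t01|m m0 h] := @unit_cube_lower_bound _
    (fun x => `|closed_pt (stage v w x.1.1) (i, x.1.2) -
                closed_pt (stage v w x.1.1) (j, x.2)|).
  - exact: cN _ (cB _ _ (cpt i _ c2) (cpt j _ c3)).
  - rewrite /= normr_gt0 subr_eq0; apply: nsi_nonadjacent => //; exact: nsi.
  - by exists m => // r s t _ _ _; exact: h.
pose m := Order.min m1 (Order.min m2 m3).
have mm1 : m <= m1 by rewrite ge_min lexx.
have mm2 : m <= m2 by rewrite !ge_min lexx orbT.
have mm3 : m <= m3 by rewrite !ge_min lexx !orbT.
exists m => [|r [i s] [j t] r01]; first by rewrite !lt_min m10 m20 m30.
rewrite /edge_params /gauge /closed_pt /= => /andP[s0 s1] /andP[t0 t1].
set u := stage v w r.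
case: eqVneq => [->|ij].
  have -> : segpt (u j) (u (ordS j)) s - segpt (u j) (u (ordS j)) t =
            (s - t) *: (u (ordS j) - u j).
    by apply/rowP => k; rewrite !mxE; ring.
  rewrite normrZ mulrC ler_wpM2l //; apply: (le_trans mm1); exact: m1P.
have adj (k : 'I_n) x y : 0 <= x <= 1 -> 0 <= y <= 1 ->
    m * ((1 - x) + y) <= `|segpt (u k) (u (ordS k)) x -
      segpt (u (ordS k)) (u (ordS (ordS k))) y|.
  move=> /andP[x0 x1] /andP[y0 y1].
  have : 0 <= 1 - x + y by lra.
  rewrite le_eqVlt => /orP[/eqP <-|pos]; first by rewrite mulr0.
  have -> : segpt (u k) (u (ordS k)) x -
      segpt (u (ordS k)) (u (ordS (ordS k))) y =
      - (1 - x + y) *: segpt (u (ordS k) - u k) (u (ordS (ordS k)) - u (ordS k))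
         (y / (1 - x + y)).
    apply/rowP => l; rewrite !mxE; field; exact: lt0r_neq0.
  rewrite normrZ normrN mulrC ger0_norm ?(ltW pos) // ler_wpM2l ?(ltW pos) //.
  apply: (le_trans mm2); apply: m2P => //.
  by rewrite divr_ge0 ?(ltW pos) //= ler_pdivrMr // mul1r; lra.
case: eqVneq => [->|ji]; first by apply: adj; apply/andP.
case: eqVneq => [->|ij']; first by rewrite distrC; apply: adj; apply/andP.
rewrite mulr1; apply: (le_trans mm3).
by apply: (m3P (i, j)) => //; apply/andP.
Qed.

Lemma edge_params_neq0 (R : realType) n : (2 < n)%N ->
  @edge_params R n !=set0.
Proof.
by case: n => // n _; exists (ord0, 0); rewrite /edge_params /= lexx ler01.
Qed.

(** The bounds on the gauge make the stages an expanding family. *)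
Lemma isotopic_of_deformation (R : realType) n (v w : 'I_n -> 'rV[R]_3) :
  (2 < n)%N ->
  (forall r, 0 <= r <= 1 -> non_self_intersecting (stage v w r)) ->
  ambient_isotopic (path_carrier v) (path_carrier w).
Proof.
move=> n2 nsi; have [m m0 low] := gauge_lower n2 nsi.
rewrite !path_carrierE.
pose c := \sum_i `|w i - v i|.
have wvc i : `|w i - v i| <= c.
  by rewrite /c (bigD1 i) //= lerDl sumr_ge0.
have c0 : 0 <= c by apply: sumr_ge0.
apply: (@isotopic_of_expanding_family _ _ _ _ _ (@gauge R n) m (2 * c)) => //.
- exact: edge_params_neq0.
- by rewrite mulr_ge0.
- move=> r p q r01 Dp Dq; apply: (le_trans (low r p q r01 Dp Dq)).
  rewrite /stage /closed_pt le_eqVlt; apply/orP; left; apply/eqP; congr (`|_|).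
  by apply/rowP => k; rewrite !mxE; ring.
- move=> p q Dp Dq; apply: le_trans (gauge_upper wvc Dp Dq).
  rewrite /closed_pt le_eqVlt; apply/orP; left; apply/eqP; congr (`|_|).
  by apply/rowP => k; rewrite !mxE; ring.
Qed.

Lemma nsi_of_gauge_lower (R : realType) n (w : 'I_n -> 'rV[R]_3) m :
  0 < m ->
  (forall p q, edge_params p -> edge_params q ->
     m * gauge p q <= `|closed_pt w p - closed_pt w q|) ->
  non_self_intersecting w.
Proof.
move=> m0 low i j s t /andP[s0 s1] /andP[t0 t1] e.
have Dp : edge_params (i, s) by rewrite /edge_params /= s0 ltW.
have Dq : edge_params (j, t) by rewrite /edge_params /= t0 ltW.
have := low _ _ Dp Dq; rewrite /closed_pt /= e subrr normr0 pmulr_rle0 //.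
rewrite /gauge /=; case: eqVneq => [->|_].
  by rewrite normr_le0 subr_eq0 => /eqP.
by case: eqVneq => [_|_]; [lra|case: eqVneq => [_|_]; lra].
Qed.

(** The lower bound m on the gauge loses at most 2 e when the vertices move by
    e. *)
Lemma isotopic_of_perturbation (R : realType) n (v : 'I_n -> 'rV[R]_3) :
  (2 < n)%N -> non_self_intersecting v ->
  exists2 e, 0 < e & forall w, (forall i, `|w i - v i| <= e) ->
    non_self_intersecting w /\ ambient_isotopic (path_carrier v) (path_carrier w).
Proof.
move=> n2 nsi.
have stE r : stage v v r = v.
  by apply/funext => i; apply/rowP => k; rewrite !mxE; ring.
have [m m0 low] : exists2 m, 0 < m & forall r p q, 0 <= r <= 1 ->
    edge_params p -> edge_params q ->
    m * gauge p q <= `|closed_pt (stage v v r) p - closed_pt (stage v v r) q|.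
  by apply: gauge_lower => // r _; rewrite stE.
exists (m / 4) => [|w wv]; first by rewrite divr_gt0.
have nsis r : 0 <= r <= 1 -> non_self_intersecting (stage v w r).
  move=> /andP[r0 r1].
  apply: (@nsi_of_gauge_lower _ _ _ (m / 2)) => [|p q Dp Dq]; first by rewrite divr_gt0.
  have h1 : forall i, `|stage v w r i - v i| <= m / 4.
    move=> i; apply: le_trans (wv i).
    have -> : stage v w r i - v i = r *: (w i - v i).
      by apply/rowP => k; rewrite !mxE; ring.
    by rewrite normrZ ger0_norm // ler_piMl.
  have h2 := gauge_upper h1 Dp Dq.
  have zer01 : 0 <= (0 : R) <= 1 by rewrite lexx ler01.
  have h3 := low 0 p q zer01 Dp Dq; rewrite stE in h3.
  have h4 := lerB_dist (closed_pt v p - closed_pt v q)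
    (- (closed_pt (fun i => stage v w r i - v i) p - closed_pt (fun i => stage v w r i - v i) q)).
  rewrite normrN in h4.
  have e5 : closed_pt v p - closed_pt v q - - (closed_pt (fun i => stage v w r i - v i) p
    - closed_pt (fun i => stage v w r i - v i) q) =
    closed_pt (stage v w r) p - closed_pt (stage v w r) q.
    by apply/rowP => k; rewrite !mxE; ring.
  rewrite e5 in h4.
  lra.
split; last exact: isotopic_of_deformation.
have one : 0 <= (1 : R) <= 1 by rewrite lexx ler01.
have := nsis 1 one; congr non_self_intersecting.
by apply/funext => i; rewrite /stage segpt1.
Qed.

(** * Polygons as cyclic sequences of vertices *)

Definition walk (T : Type) (x : T) (s : seq T) : seq (T * T) := pairmap pair x s.

Definition edges (T : Type) (s : seq T) : seq (T * T) := zip s (rot 1 s).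

Lemma walk_cat (T : Type) (x : T) (s1 s2 : seq T) :
  walk x (s1 ++ s2) = walk x s1 ++ walk (last x s1) s2.
Proof. exact: pairmap_cat. Qed.

Lemma walk_rcons (T : Type) (x y : T) (s : seq T) :
  walk x (rcons s y) = rcons (walk x s) (last x s, y).
Proof. by rewrite -cats1 walk_cat cats1. Qed.

Lemma edges_cons (T : Type) (x : T) (s : seq T) :
  edges (x :: s) = walk x (rcons s x).
Proof.
have gen z y (t : seq T) : zip (z :: t) (rcons t y) = walk z (rcons t y).
  by elim: t z => [|u t IH] z //; rewrite /walk /=; congr (_ :: _); exact: IH.
by rewrite /edges rot1_cons gen.
Qed.

Lemma edges_cat (T : Type) (a b : T) (s t : seq T) :
  edges ((a :: s) ++ b :: t) = walk a (rcons s b) ++ walk b (rcons t a).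
Proof.
rewrite cat_cons edges_cons -cat_rcons rcons_cat walk_cat last_rcons //.
Qed.

Lemma size_edges (T : Type) (s : seq T) : size (edges s) = size s.
Proof. by rewrite size_zip size_rot minnn. Qed.

Lemma edges_rot (T : Type) k (s : seq T) : edges (rot k s) = rot k (edges s).
Proof.
rewrite -[RHS]zip_unzip /unzip1 /unzip2 !map_rot -/unzip1 -/unzip2.
rewrite /edges unzip1_zip ?size_rot // unzip2_zip ?size_rot //.
by rewrite (rot_rot 1).
Qed.

Lemma edges_map (T U : Type) (f : T -> U) (s : seq T) :
  edges (map f s) = [seq (f e.1, f e.2) | e <- edges s].
Proof.
rewrite /edges -map_rot; elim: s (rot 1 s) => [|x s IH] [|y t] //=.
by rewrite IH.
Qed.

Definition halfopen (R : realType) (e : 'rV[R]_3 * 'rV[R]_3) : set 'rV[R]_3 :=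
  [set segpt e.1 e.2 t | t in [set t : R | 0 <= t < 1]].

Definition cover (R : realType) (es : seq ('rV[R]_3 * 'rV[R]_3)) :
    set 'rV[R]_3 :=
  [set x | exists2 e, e \in es & halfopen e x].

(** Half-open edges partition an embedded closed polygon, so that embeddedness can
    be stated for the set of its edges, whatever the first vertex. *)
Definition simple (R : realType) (es : seq ('rV[R]_3 * 'rV[R]_3)) : Prop :=
  [/\ uniq es, (forall e, e \in es -> e.1 != e.2) &
   forall e f x, e \in es -> f \in es -> halfopen e x -> halfopen f x -> e = f].

Lemma halfopen_start (R : realType) (e : 'rV[R]_3 * 'rV[R]_3) : halfopen e e.1.
Proof. by exists 0; rewrite ?segpt0 //= lexx ltr01. Qed.

Lemma eq_simple (R : realType) (es fs : seq ('rV[R]_3 * 'rV[R]_3)) :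
  perm_eq es fs -> simple es -> simple fs.
Proof.
move=> p [u n d]; split.
- by rewrite -(perm_uniq p).
- by move=> e; rewrite -(perm_mem p); exact: n.
- by move=> e f x; rewrite -!(perm_mem p); exact: d.
Qed.

Lemma eq_cover (R : realType) (es fs : seq ('rV[R]_3 * 'rV[R]_3)) :
  es =i fs -> cover es = cover fs.
Proof. by move=> h; apply/seteqP; split=> x [e]; [rewrite h|rewrite -h] => ? ?; exists e. Qed.

Lemma cover_cat (R : realType) (es fs : seq ('rV[R]_3 * 'rV[R]_3)) x :
  cover (es ++ fs) x <-> cover es x \/ cover fs x.
Proof.
split=> [[e]|[[e ee ex]|[e ee ex]]].
- by rewrite mem_cat => /orP[] ? ?; [left|right]; exists e.
- by exists e => //; rewrite mem_cat ee.
- by exists e => //; rewrite mem_cat ee orbT.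
Qed.

Lemma cover_cons (R : realType) e (fs : seq ('rV[R]_3 * 'rV[R]_3)) x :
  cover (e :: fs) x <-> halfopen e x \/ cover fs x.
Proof.
split=> [[f]|[ex|[f ff fx]]].
- by rewrite inE => /orP[/eqP ->|? ?]; [left|right; exists f].
- by exists e => //; rewrite mem_head.
- by exists f => //; rewrite inE ff orbT.
Qed.

Lemma cover_nil (R : realType) (x : 'rV[R]_3) : cover [::] x <-> False.
Proof. by split=> // -[]. Qed.

Lemma simple_cat (R : realType) (es fs : seq ('rV[R]_3 * 'rV[R]_3)) :
  simple (es ++ fs) <->
  [/\ simple es, simple fs & forall x, cover es x -> cover fs x -> False].
Proof.
split=> [[u n d]|[[u1 n1 d1] [u2 n2 d2] d]].
  have us := u; move: us; rewrite cat_uniq => /and3P[u1 /hasPn h u2].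
  split.
  - split=> // [e ee|e f x ee ff]; first by apply: n; rewrite mem_cat ee.
    by apply: d; rewrite mem_cat ?ee ?ff.
  - split=> // [e ee|e f x ee ff]; first by apply: n; rewrite mem_cat ee orbT.
    by apply: d; rewrite mem_cat ?ee ?ff orbT.
  - move=> x [e ee ex] [f ff fx]; have := h f ff; rewrite /= => /negP; apply.
    by rewrite -(d e f x) // mem_cat ?ee ?ff ?orbT.
split.
- rewrite cat_uniq u1 u2 andbT; apply/hasPn => e e2; apply/negP => e1.
  by apply: (d e.1); exists e => //; exact: halfopen_start.
- by move=> e; rewrite mem_cat => /orP[]; [exact: n1|exact: n2].
- move=> e f x; rewrite !mem_cat => /orP[e1|e2] /orP[f1|f2] ex fx.
  + exact: d1 ex fx.
  + by case: (d x); [exists e|exists f].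
  + by case: (d x); [exists f|exists e].
  + exact: d2 ex fx.
Qed.

Lemma simple_cons (R : realType) e (fs : seq ('rV[R]_3 * 'rV[R]_3)) :
  simple (e :: fs) <->
  [/\ e.1 != e.2, simple fs & forall x, halfopen e x -> cover fs x -> False].
Proof.
rewrite -cat1s simple_cat; split=> [[[_ n _] sf d]|[n sf d]]; split=> //.
- by apply: n; rewrite mem_head.
- by move=> x ex; apply: d; apply/cover_cons; left.
- split=> // [f|f g x]; rewrite !inE; first by move=> /eqP ->.
  by move=> /eqP -> /eqP ->.
- by move=> x /cover_cons[ex|[]//]; exact: d.
Qed.

Lemma simple_nil (R : realType) : @simple R [::].
Proof. by split. Qed.

Definition edge_list (R : realType) n (v : 'I_n -> 'rV[R]_3) :=
  [seq (v i, v (ordS i)) | i <- enum 'I_n].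

Lemma edges_codom (R : realType) n (v : 'I_n -> 'rV[R]_3) :
  edges (codom v) = edge_list v.
Proof.
case: n v => [|n] v.
  have -> : edge_list v = [::] by apply: size0nil; rewrite size_map size_enum_ord.
  by apply: size0nil; rewrite size_edges size_codom card_ord.
apply: (@eq_from_nth _ (0, 0)).
  by rewrite size_edges size_codom size_map size_enum_ord card_ord.
move=> i; rewrite size_edges size_codom card_ord => lti.
rewrite /edges nth_zip ?size_rot //.
have nv x0 k (ltk : (k < n.+1)%N) : nth x0 (codom v) k = v (Ordinal ltk).
  rewrite /codom /image_mem (nth_map ord0) ?size_enum_ord //; congr v.
  by apply: val_inj; rewrite /= nth_enum_ord.
have -> : nth (0, 0) (edge_list v) i = (v (Ordinal lti), v (ordS (Ordinal lti))).
  have e : nth ord0 (enum 'I_n.+1) i = Ordinal lti.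
    by apply: val_inj; rewrite /= nth_enum_ord.
  by rewrite /edge_list (nth_map ord0) ?size_enum_ord // e.
rewrite nv; congr pair.
have sc : size (codom v) = n.+1 by rewrite size_codom card_ord.
rewrite /rot nth_cat size_drop sc subn1 /=.
have [h|h] := ltnP i n.
  have lti1 : (i.+1 < n.+1)%N by [].
  rewrite nth_drop add1n nv; congr v; apply: val_inj.
  by rewrite /= modn_small.
have iE : i = n by lia.
rewrite {1}iE subnn nth_take // nv; congr v; apply: val_inj.
by rewrite /= iE modnn.
Qed.

(** Both sides say that the half-open edges are disjoint; two equal edges would
    contradict the injectivity of the parametrisation or uniq. *)
Lemma nsi_simple (R : realType) n (v : 'I_n -> 'rV[R]_3) :
  non_self_intersecting v <-> simple (edges (codom v)).
Proof.
rewrite edges_codom; split=> [nsi|[u ne d]].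
  have zero : 0 <= (0 : R) < 1 by rewrite lexx ltr01.
  split.
  - rewrite map_inj_uniq ?enum_uniq // => i j [e _].
    by have [] := nsi i j 0 0 zero zero; rewrite ?segpt0.
  - by move=> e /mapP[i _ ->] /=; rewrite eq_sym; exact: nsi_edge_neq.
  - move=> e f x /mapP[i _ ->] /mapP[j _ ->] [s s01 <-] [t t01 /= h].
    by have [-> _] := nsi i j s t s01 t01 (esym h).
move=> i j s t s01 t01 e.
have mi (k : 'I_n) : (v k, v (ordS k)) \in edge_list v.
  by apply/mapP; exists k => //; rewrite mem_enum.
have eij : i = j.
  have h1 : halfopen (v i, v (ordS i)) (segpt (v i) (v (ordS i)) s) by exists s.
  have h2 : halfopen (v j, v (ordS j)) (segpt (v i) (v (ordS i)) s).
    by rewrite e; exists t.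
  have /injectiveP inj : injectiveb (fun k => (v k, v (ordS k))) by exact: u.
  by apply: inj; exact: d _ _ _ (mi i) (mi j) h1 h2.
split=> //; subst j.
have := ne _ (mi i); rewrite /= => vne.
apply/eqP; rewrite -subr_eq0; apply: contraT => st.
have : (s - t) *: (v (ordS i) - v i) = 0.
  move/eqP: e; rewrite -subr_eq0 => /eqP <-.
  by apply/rowP => k; rewrite !mxE; ring.
move/eqP; rewrite scaler_eq0 (negbTE st) /= subr_eq0 eq_sym.
by rewrite (negbTE vne).
Qed.

Lemma path_carrier_cover (R : realType) n (v : 'I_n -> 'rV[R]_3) :
  path_carrier v = cover (edges (codom v)).
Proof.
rewrite edges_codom.
have mi (k : 'I_n) : (v k, v (ordS k)) \in edge_list v.
  by apply/mapP; exists k => //; rewrite mem_enum.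
apply/seteqP; split=> [x [i _ [t /= /andP[t0]]]|x [e /mapP[i _ ->] [t /= /andP[t0 t1] <-]]].
  rewrite le_eqVlt => /orP[/eqP -> <-|t1 <-].
    rewrite segpt1; exists (v (ordS i), v (ordS (ordS i))) => //.
    exact: halfopen_start.
  by exists (v i, v (ordS i)) => //; exists t => //=; rewrite t0.
by exists i => //; exists t => //=; rewrite t0 ltW.
Qed.

Lemma codom_nth (R : realType) (s : seq 'rV[R]_3) n (sn : size s = n) :
  codom (fun i : 'I_n => nth 0 s i) = s.
Proof.
apply: (@eq_from_nth _ 0); first by rewrite size_codom card_ord.
move=> i; rewrite size_codom card_ord => lti.
case: n sn lti => // n sn lti.
rewrite /codom /image_mem (nth_map ord0) ?size_enum_ord //.
by rewrite nth_enum_ord.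
Qed.

Definition mix (R : realType) (s s' : seq 'rV[R]_3) (r : R) :=
  [seq segpt p.1 p.2 r | p <- zip s s'].

Lemma isotopic_mix (R : realType) (s s' : seq 'rV[R]_3) :
  size s = size s' -> (2 < size s)%N ->
  (forall r, 0 <= r <= 1 -> simple (edges (mix s s' r))) ->
  ambient_isotopic (cover (edges s)) (cover (edges s')).
Proof.
move=> ss s2 sim.
have := @isotopic_of_deformation R _ (fun i : 'I_(size s) => nth 0 s i)
  (fun i : 'I_(size s) => nth 0 s' i) s2.
rewrite !path_carrier_cover !codom_nth //; apply => r r01.
apply/nsi_simple.
have -> : stage (fun i : 'I_(size s) => nth 0 s i)
    (fun i : 'I_(size s) => nth 0 s' i) r =
    (fun i : 'I_(size s) => nth 0 (mix s s' r) i).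
  apply/funext => i; rewrite /mix (nth_map (0, 0)) ?size_zip -?ss ?minnn //.
  by rewrite nth_zip.
rewrite codom_nth; first exact: sim.
by rewrite /mix size_map size_zip -ss minnn.
Qed.

Lemma isotopic_map_near (R : realType) (s : seq 'rV[R]_3) :
  (2 < size s)%N -> simple (edges s) ->
  exists2 e, 0 < e & forall f, (forall x, x \in s -> `|f x - x| <= e) ->
    simple (edges (map f s)) /\
    ambient_isotopic (cover (edges s)) (cover (edges (map f s))).
Proof.
move=> s2 sim.
have nsi : non_self_intersecting (fun i : 'I_(size s) => nth 0 s i).
  by apply/nsi_simple; rewrite codom_nth.
have [e e0 eP] := isotopic_of_perturbation s2 nsi.
exists e => // f fe.
have [] := eP (fun i => nth 0 (map f s) i).
  by move=> i; rewrite (nth_map 0) //; apply: fe; rewrite mem_nth.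
by rewrite nsi_simple !path_carrier_cover !codom_nth // size_map.
Qed.

Lemma halfopen_split (R : realType) (a b : 'rV[R]_3) l x :
  0 < l < 1 -> halfopen (a, b) x <->
  halfopen (a, segpt a b l) x \/ halfopen (segpt a b l, b) x.
Proof.
move=> /andP[l0 l1]; 
split=> [[t /= /andP[t0 t1] <-]|
  [[t /= /andP[t0 t1] <-]|[t /= /andP[t0 t1] <-]]].
- have [tl|lt] := ltP t l.
    left; exists (t / l); first by rewrite /= divr_ge0 ?(ltW l0) //= ltr_pdivrMr ?mul1r.
    by apply/rowP => i; rewrite !mxE /=; field; exact: lt0r_neq0.
  have l1' : 0 < 1 - l by rewrite subr_gt0.
  right; exists ((t - l) / (1 - l)).
    rewrite /= divr_ge0 ?subr_ge0 ?(ltW l1) //= ltr_pdivrMr ?mul1r; lra.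
  by apply/rowP => i; rewrite !mxE /=; field; exact: lt0r_neq0.
- exists (l * t); last by apply/rowP => i; rewrite !mxE /=; ring.
  rewrite /= mulr_ge0 ?(ltW l0) //=.
  by apply: le_lt_trans l1; rewrite ler_piMr // ltW.
- exists (l + t * (1 - l)); last by apply/rowP => i; rewrite !mxE /=; ring.
  have h1 : 0 <= t * (1 - l) by rewrite mulr_ge0 ?subr_ge0 // ltW.
  have h2 : t * (1 - l) < 1 - l by rewrite gtr_pMl ?subr_gt0.
  by apply/andP => /=; split; lra.
Qed.

Lemma segpt_inj (R : realType) (a b : 'rV[R]_3) s t :
  a != b -> segpt a b s = segpt a b t -> s = t.
Proof.
move=> ab e; apply/eqP; rewrite -subr_eq0; apply: contraT => st.
have : (s - t) *: (b - a) = 0.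
  move/eqP: e; rewrite -subr_eq0 => /eqP <-.
  by apply/rowP => k; rewrite !mxE; ring.
by move/eqP; rewrite scaler_eq0 (negbTE st) /= subr_eq0 eq_sym (negbTE ab).
Qed.

Lemma halfopen_split_disjoint (R : realType) (a b : 'rV[R]_3) l x :
  a != b -> 0 < l < 1 -> halfopen (a, segpt a b l) x ->
  halfopen (segpt a b l, b) x -> False.
Proof.
move=> ab /andP[l0 l1] [t /= /andP[t0 t1] <-] [s /= /andP[s0 s1]].
have -> : segpt (segpt a b l) b s = segpt a b (l + s * (1 - l)).
  by apply/rowP => i; rewrite !mxE /=; ring.
have -> : segpt a (segpt a b l) t = segpt a b (l * t).
  by apply/rowP => i; rewrite !mxE /=; ring.
move=> /(segpt_inj ab) e.
have h1 : 0 <= s * (1 - l) by rewrite mulr_ge0 ?subr_ge0 // ltW.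
have h2 : l * t < l by rewrite gtr_pMr.
lra.
Qed.

Lemma cover_split (R : realType) (a b : 'rV[R]_3) l es :
  0 < l < 1 ->
  cover ((a, segpt a b l) :: (segpt a b l, b) :: es) = cover ((a, b) :: es).
Proof.
move=> l01; apply/seteqP; split=> x; have h := halfopen_split a b x l01;
  rewrite !cover_cons; tauto.
Qed.

Lemma simple_split (R : realType) (a b : 'rV[R]_3) l es :
  a != b -> 0 < l < 1 ->
  simple ((a, segpt a b l) :: (segpt a b l, b) :: es) <-> simple ((a, b) :: es).
Proof.
move=> ab l01; have /andP[l0 l1] := l01.
have n1 : a != segpt a b l.
  apply/eqP => e; have := @segpt_inj _ a b 0 l ab; rewrite segpt0 => /(_ e) e'.
  by rewrite -e' ltxx in l0.
have n2 : segpt a b l != b.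
  apply/eqP => e; have := @segpt_inj _ a b l 1 ab; rewrite segpt1 => /(_ e) e'.
  by rewrite e' ltxx in l1.
split=> [/simple_cons[_ /simple_cons[_ ses d2] d1]|/simple_cons[_ ses d]].
  apply/simple_cons; split=> // x /(halfopen_split _ _ _ l01)[h1|h2] h; last exact: d2 h2 h.
  by apply: (d1 x) => //; apply/cover_cons; right.
apply/simple_cons; split=> //.
  apply/simple_cons; split=> // x h; apply: d.
  by apply/(halfopen_split _ _ _ l01); right.
move=> x h1 /cover_cons[h2|h2].
  by exact: halfopen_split_disjoint h1 h2.
by apply: (d x) => //; apply/(halfopen_split _ _ _ l01); left.
Qed.

(** * Moving a part of a polygon *)

Definition embedded (R : realType) (s : seq 'rV[R]_3) : Prop :=
  (2 < size s)%N /\ simple (edges s).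

Definition carrier (R : realType) (s : seq 'rV[R]_3) : set 'rV[R]_3 :=
  cover (edges s).

Lemma embedded_rot (R : realType) k (s : seq 'rV[R]_3) :
  embedded s -> embedded (rot k s).
Proof.
move=> [s2 sim]; split; first by rewrite size_rot.
by apply: eq_simple sim; rewrite edges_rot perm_sym perm_rot.
Qed.

Lemma carrier_rot (R : realType) k (s : seq 'rV[R]_3) :
  carrier (rot k s) = carrier s.
Proof. by apply: eq_cover => e; rewrite edges_rot mem_rot. Qed.

Lemma embedded_rot1 (R : realType) (x : 'rV[R]_3) s :
  embedded (rcons s x) <-> embedded (x :: s).
Proof.
split=> [/(embedded_rot (size s))|]; last by rewrite -rot1_cons; exact: embedded_rot.
by rewrite -cats1 rot_size_cat.
Qed.

Lemma carrier_rot1 (R : realType) (x : 'rV[R]_3) s :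
  carrier (rcons s x) = carrier (x :: s).
Proof. by rewrite -rot1_cons carrier_rot. Qed.

Lemma ambient_isotopic_refl (R : realType) (A : set 'rV[R]_3) :
  ambient_isotopic A A.
Proof.
exists (fun _ x => x); split=> //; last exact: image_id.
  by apply: continuous_subspaceT => -[t x]; exact: cvg_snd.
move=> t _; split; first by move=> x; exact: cvg_id.
by exists (fun x => x); split=> // x; exact: cvg_id.
Qed.

Definition affine (R : realType) (l : 'rV[R]_3 -> R) : Prop :=
  forall a b t, l (segpt a b t) = (1 - t) * l a + t * l b.

Definition below (R : realType) (l : 'rV[R]_3 -> R) : rel 'rV[R]_3 :=
  fun x y => l x < l y.

Lemma affine_convex (R : realType) (l : 'rV[R]_3 -> R) a b t :
  affine l -> 0 <= t < 1 -> l a < l b -> l a <= l (segpt a b t) < l b.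
Proof.
move=> al /andP[t0 t1] lt; rewrite al.
have h1 : 0 <= t * (l b - l a) by rewrite mulr_ge0 // subr_ge0 ltW.
have h2 : t * (l b - l a) < l b - l a by rewrite gtr_pMl // subr_gt0.
by apply/andP; split; lra.
Qed.

(** A path along which an affine function increases cannot meet itself, nor
    anything on which the function takes other values: this is how collisions are
    excluded throughout. *)
Lemma cover_rising (R : realType) (l : 'rV[R]_3 -> R) x s y :
  affine l -> path (below l) x s -> cover (walk x s) y ->
  l x <= l y < l (last x s).
Proof.
move=> al; elim: s x => [|z s IH] x /=; first by move=> _ /cover_nil.
move=> /andP[xz zs] /cover_cons[[t t01 <-]|h].
  have /andP[h1 h2] := affine_convex al t01 xz.
  rewrite h1 /=; apply: (lt_le_trans h2).
  elim: s z zs {IH xz h1 h2} => [|w s IH] z //= /andP[zw ws].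
  by apply: (le_trans (ltW zw)); exact: IH.
have /andP[h1 ->] := IH z zs h; rewrite andbT.
exact: le_trans (ltW xz) h1.
Qed.

Lemma simple_rising (R : realType) (l : 'rV[R]_3 -> R) x s :
  affine l -> path (below l) x s -> simple (walk x s).
Proof.
move=> al; elim: s x => [|z s IH] x /=; first by move=> _; exact: simple_nil.
move=> /andP[xz zs]; apply/simple_cons; split=> /=.
- by apply: contraTneq xz => ->; rewrite /below ltxx.
- exact: IH.
- move=> y [t t01 <-] h.
  have /andP[_ h1] := affine_convex al t01 xz.
  have /andP[h2 _] := cover_rising al zs h.
  by move: (lt_le_trans h1 h2); rewrite ltxx.
Qed.

Lemma rising_mix (R : realType) (l : 'rV[R]_3 -> R) x y s t r :
  affine l -> 0 <= r <= 1 -> size s = size t ->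
  path (below l) x s -> path (below l) y t ->
  path (below l) (segpt x y r) (mix s t r).
Proof.
move=> al /andP[r0 r1].
elim: s t x y => [|a s IH] [|b t] x y //= [st] /andP[xa sa] /andP[yb tb].
apply/andP; split; last exact: IH.
rewrite /below !al.
have [e|ne] := eqVneq r 1.
  by rewrite e subrr !mul0r !add0r !mul1r.
have h1 : 0 < (1 - r) * (l a - l x).
  by rewrite mulr_gt0 // subr_gt0 // lt_neqAle ne.
have h2 : 0 <= r * (l b - l y) by rewrite mulr_ge0 // subr_ge0 ltW.
lra.
Qed.

Lemma mix_self (R : realType) (s : seq 'rV[R]_3) r : mix s s r = s.
Proof.
elim: s => //= x s IH; congr (_ :: _) => //=.
by apply/rowP => k; rewrite !mxE; ring.
Qed.

Lemma mix_cat (R : realType) (s t s' t' : seq 'rV[R]_3) r :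
  size s = size s' -> mix (s ++ t) (s' ++ t') r = mix s s' r ++ mix t t' r.
Proof. by move=> ss; rewrite /mix zip_cat // map_cat. Qed.

(** All local moves are of this form: the part from a to b moves, and only this
    part has to be watched. *)
Lemma isotopic_replace (R : realType) (a b : 'rV[R]_3) (s s' t : seq 'rV[R]_3) :
  size s = size s' -> (2 < size (a :: s ++ b :: t))%N ->
  simple (walk b (rcons t a)) ->
  (forall r, 0 <= r <= 1 -> simple (walk a (rcons (mix s s' r) b)) /\
    forall x, cover (walk a (rcons (mix s s' r) b)) x ->
      cover (walk b (rcons t a)) x -> False) ->
  embedded (a :: s' ++ b :: t) /\
  ambient_isotopic (carrier (a :: s ++ b :: t)) (carrier (a :: s' ++ b :: t)).
Proof.
move=> ss s2 simt h.
have mixE r : mix (a :: s ++ b :: t) (a :: s' ++ b :: t) r =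
    (a :: mix s s' r) ++ b :: t.
  rewrite -!cat_cons mix_cat /=; last by rewrite ss.
  by congr ((_ :: _) ++ _); [apply/rowP => k; rewrite !mxE; ring|exact: mix_self].
have sim r : 0 <= r <= 1 ->
    simple (edges (mix (a :: s ++ b :: t) (a :: s' ++ b :: t) r)).
  by move=> r01; rewrite mixE edges_cat simple_cat; have [] := h r r01.
have sss : size (a :: s ++ b :: t) = size (a :: s' ++ b :: t).
  by rewrite /= !size_cat ss.
split; last exact: isotopic_mix.
split; first by rewrite -sss.
have one : 0 <= (1 : R) <= 1 by rewrite ler01 lexx.
have := sim 1 one; congr (simple (edges _)).
rewrite /mix; elim: {s2 mixE sim}(a :: _) (a :: s' ++ b :: t) sss => [|x u IH] [|y w] //= [uw].
by rewrite segpt1 IH.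
Qed.

Lemma affine_midpoint (R : realType) (l : 'rV[R]_3 -> R) a b :
  affine l -> l a < l b -> l a < l (segpt a b 2^-1) < l b.
Proof. by move=> al h; rewrite al; apply/andP; split; lra. Qed.

(** The vertex v moves to the midpoint of a and b, where it ceases to be a
    corner and can be dropped.  The linear form l keeps the two edges apart while
    they move. *)
Lemma cut_corner (R : realType) (a v b : 'rV[R]_3) t (l : 'rV[R]_3 -> R) :
  embedded (a :: v :: b :: t) -> (0 < size t)%N ->
  affine l -> l a < l v -> l v < l b ->
  (forall r x, 0 <= r <= 1 ->
    let v' := segpt v (segpt a b 2^-1) r in
    halfopen (a, v') x \/ halfopen (v', b) x ->
    cover (walk b (rcons t a)) x -> False) ->
  embedded (a :: b :: t) /\
  ambient_isotopic (carrier (a :: v :: b :: t)) (carrier (a :: b :: t)).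
Proof.
move=> [s2 sim] t0 al av vb free.
have ab : a != b.
  by apply: contraTneq (lt_trans av vb) => ->; rewrite ltxx.
have half : 0 < (2^-1 : R) < 1.
  by rewrite invr_gt0 ltr0n /= invf_lt1 ?ltr0n // ltr1n.
have halfc : 0 <= (2^-1 : R) < 1 by case/andP: half => /ltW -> ->.
have mlt : l a < l (segpt a b 2^-1) < l b.
  exact: affine_midpoint (lt_trans av vb).
have simt : simple (walk b (rcons t a)).
  by move: sim; rewrite (edges_cat a b [:: v]) => /simple_cat[].
have [] := @isotopic_replace _ a b [:: v] [:: segpt a b 2^-1] t _ _ simt _ => //.
  move=> r r01 /=; split.
    apply: (@simple_rising _ l a [:: segpt v (segpt a b 2^-1) r; b] al).
    rewrite /= andbT.
    have := @rising_mix _ l a a [:: v; b] [:: segpt a b 2^-1; b] r al r01 erefl.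
    have e c : segpt c c r = c by apply/rowP => k; rewrite !mxE; ring.
    rewrite /= !andbT !e /below av vb; case/andP: mlt => -> ->; exact.
  move=> x /cover_cons[h|/cover_cons[h|/cover_nil//]]; apply: (free r) => //;
    [by left|by right].
move=> [s2' sim'] iso.
have E (w : 'rV[R]_3) : edges (a :: w :: b :: t) = (a, w) :: (w, b) :: walk b (rcons t a).
  exact: (edges_cat a b [:: w]).
have E' : edges (a :: b :: t) = (a, b) :: walk b (rcons t a).
  exact: (edges_cat a b [::]).
split.
  split; first by rewrite /= !ltnS.
  by rewrite E'; apply/(simple_split _ ab half); rewrite -E.
by rewrite /carrier E' -(cover_split _ _ _ half) -E.
Qed.

Lemma mem_walk_last (R : realType) (b : 'rV[R]_3) s e :
  e \in walk b s -> cover (walk b s) e.2 \/ e.2 = last b s.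
Proof.
elim: s b => [|c s IH] b //=; rewrite inE => /orP[/eqP ->|/IH[h|h]]; last by right.
  case: s {IH} => [|d s] /=; first by right.
  left; apply/cover_cons; right; apply/cover_cons; left.
  exact: (@halfopen_start _ (_, _)).
by left; apply/cover_cons; right.
Qed.

Lemma walk_closed (R : realType) (b : 'rV[R]_3) s e t :
  e \in walk b s -> 0 <= t <= 1 ->
  cover (walk b s) (segpt e.1 e.2 t) \/ segpt e.1 e.2 t = last b s.
Proof.
move=> es /andP[t0]; rewrite le_eqVlt => /orP[/eqP ->|t1].
  by rewrite segpt1; exact: mem_walk_last.
by left; exists e => //; exists t => //=; rewrite t0.
Qed.

Lemma segment_distance (R : realType) (a b : 'rV[R]_3)
    (es : seq ('rV[R]_3 * 'rV[R]_3)) :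
  (forall e s t, e \in es -> 0 <= s <= 1 -> 0 <= t <= 1 ->
     segpt a b s != segpt e.1 e.2 t) ->
  exists2 m, 0 < m & forall e s t, e \in es -> 0 <= s <= 1 -> 0 <= t <= 1 ->
     m <= `|segpt a b s - segpt e.1 e.2 t|.
Proof.
elim: es => [|f es IH] h; first by exists 1.
have [m1 m10 m1P] : exists2 m, 0 < m & forall e s t, e \in es -> 0 <= s <= 1 ->
    0 <= t <= 1 -> m <= `|segpt a b s - segpt e.1 e.2 t|.
  by apply: IH => e s t ees; apply: h; rewrite inE ees orbT.
have cst (c : 'rV[R]_3) : continuous (fun _ : R * R * R => c).
  by move=> x; exact: cvg_cst.
have c2 : continuous (fun x : R * R * R => x.1.2).
  by move=> x; apply: (cvg_comp _ _ cvg_fst); exact: cvg_snd.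
have c3 : continuous (fun x : R * R * R => x.2) by move=> x; exact: cvg_snd.
have [|r s t _ s01 t01|m m0 mP] := @unit_cube_lower_bound _
    (fun x => `|segpt a b x.1.2 - segpt f.1 f.2 x.2|).
- have ca := segpt_continuous (cst a) (cst b) c2.
  have cf := segpt_continuous (cst f.1) (cst f.2) c3.
  by move=> x; apply: cvg_norm; apply: cvgB; [exact: ca|exact: cf].
- by rewrite /= normr_gt0 subr_eq0; apply: h => //; rewrite mem_head.
exists (Order.min m m1) => [|e s t]; first by rewrite lt_min m0.
rewrite inE => /orP[/eqP ->|ees] s01 t01.
  by rewrite ge_min; apply/orP; left; exact: (mP s s t s01 s01 t01).
by rewrite ge_min m1P ?orbT.
Qed.

Lemma simple_angle (R : realType) es (a v b : 'rV[R]_3) x y :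
  simple es -> (a, v) \in es -> (v, b) \in es -> 0 <= x -> 0 <= y -> 0 < x + y ->
  x *: (v - a) + y *: (b - v) != 0.
Proof.
move=> [_ n d] ea eb x0 y0 xy; apply/eqP => e.
have xy0 : x + y != 0 by rewrite gt_eqF.
have va : v != a by rewrite eq_sym; exact: (n _ ea).
have [z|nz] := eqVneq x 0.
  move: e xy; rewrite z scale0r !add0r => /eqP; rewrite scaler_eq0 subr_eq0.
  by have := n _ eb; rewrite /= eq_sym => /negbTE -> /orP[/eqP ->|//]; rewrite ltxx.
have xp : 0 < x by rewrite lt_neqAle eq_sym nz.
pose s := 1 - x / (2 * (x + y)); pose t := y / (2 * (x + y)).
have q2 : 0 < 2 * (x + y) by rewrite mulr_gt0.
have h1 : halfopen (a, v) (segpt a v s).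
  exists s => //=; rewrite /s; apply/andP; split.
    by rewrite subr_ge0 ler_pdivrMr // mul1r; lra.
  by rewrite ltrBlDr ltrDl divr_gt0.
have h2 : halfopen (v, b) (segpt v b t).
  exists t => //=; rewrite /t divr_ge0 //=; last exact: ltW.
  by rewrite ltr_pdivrMr // mul1r; lra.
have est : segpt v b t = segpt a v s.
  apply/rowP => k; move/rowP: e => /(_ k); rewrite !mxE /s /t => e.
  apply/eqP; rewrite -subr_eq0; apply/eqP.
  apply: (@mulfI _ (2 * (x + y))); first exact: lt0r_neq0.
  by rewrite mulr0 -[RHS]e; field.
rewrite est in h2.
by have [e1 _] := d _ _ _ ea eb h1 h2; rewrite e1 eqxx in va.
Qed.

(** * Consecutive edges in a common octant *)

Definition dir (R : realType) (e : 'rV[R]_3 * 'rV[R]_3) : 'rV[R]_3 := e.2 - e.1.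

Lemma ball_convex (R : realType) (a b v : 'rV[R]_3) m t :
  `|a - v| < m -> `|b - v| < m -> 0 <= t <= 1 -> `|segpt a b t - v| < m.
Proof.
move=> am bm /andP[t0 t1].
have -> : segpt a b t - v = (1 - t) *: (a - v) + t *: (b - v).
  by apply/rowP => k; rewrite !mxE; ring.
apply: (le_lt_trans (ler_normD _ _)); rewrite !normrZ !ger0_norm ?subr_ge0 //.
have [->|t0'] := eqVneq t 0; first by rewrite subr0 mul1r mul0r addr0.
have h1 : t * `|b - v| < t * m by rewrite ltr_pM2l // lt_neqAle eq_sym t0'.
have h2 : (1 - t) * `|a - v| <= (1 - t) * m.
  by rewrite ler_wpM2l ?subr_ge0 // ltW.
lra.
Qed.

(** The linear form that increases along d1 and d2 only involves x_i, in which
    they disagree, and one other coordinate k, in which q d1 + p d2 is nonzero;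
    the coefficient c is the midpoint of the interval of admissible ones. *)
Lemma common_ascent (R : realType) (d1 d2 : 'rV[R]_3) (i k : 'I_3) :
  let p := d1 0 i in let q := - d2 0 i in
  0 < p * q -> q * d1 0 k + p * d2 0 k != 0 ->
  exists l, [/\ affine l,
    forall a x, 0 < x -> 0 < l (a + x *: d1) - l a &
    forall a x, 0 < x -> 0 < l (a + x *: d2) - l a].
Proof.
move=> p q pq0 mk0; set mk := q * d1 0 k + p * d2 0 k in mk0.
have p0 : p != 0 by apply: contraTneq pq0 => ->; rewrite mul0r ltxx.
have q0 : q != 0 by apply: contraTneq pq0 => ->; rewrite mulr0 ltxx.
pose c := (d2 0 k / q - d1 0 k / p) / 2.
exists (fun x => p * mk * (x 0 k + c * x 0 i)); split.
- by move=> a b t; rewrite !segpt_coord; ring.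
- move=> a x x0.
  have -> : p * mk * ((a + x *: d1) 0 k + c * (a + x *: d1) 0 i)
      - p * mk * (a 0 k + c * a 0 i) = x * (p * q) * (mk / q) ^+ 2 / 2.
    by rewrite !mxE /c /mk -/p; field; rewrite ?p0 ?q0.
  have sq : 0 < (mk / q) ^+ 2 by rewrite exprn_even_gt0 //= mulf_neq0 ?invr_eq0.
  by rewrite divr_gt0 // mulr_gt0 // mulr_gt0.
- move=> a x x0.
  have -> : p * mk * ((a + x *: d2) 0 k + c * (a + x *: d2) 0 i)
      - p * mk * (a 0 k + c * a 0 i) = x * mk ^+ 2 / 2.
    have d2E : d2 0 i = - q by rewrite /q opprK.
    by rewrite !mxE d2E /c /mk; field; rewrite ?p0 ?q0.
  by rewrite divr_gt0 // mulr_gt0 // exprn_even_gt0.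
Qed.

(** The other edges are compact and do not contain v: their points are on their
    half-open parts or are the vertex a. *)
Lemma vertex_distance (R : realType) (a v b : 'rV[R]_3) t :
  embedded (a :: v :: b :: t) ->
  exists2 m, 0 < m & forall e u, e \in walk b (rcons t a) -> 0 <= u <= 1 ->
    m <= `|v - segpt e.1 e.2 u|.
Proof.
move=> [_]; rewrite (edges_cat a b [:: v]) /=.
move=> /simple_cons[/= av /simple_cons[/= vb _ dE] _].
have vv u : segpt v v u = v by apply/rowP => j; rewrite !mxE; ring.
have [e s u eE s01 u01|m m0 far] := @segment_distance _ v v (walk b (rcons t a)).
  rewrite vv; apply/eqP => ve; have [] := walk_closed eE u01; rewrite -ve.
    by move=> h; apply: (dE v) => //; exact: (@halfopen_start _ (v, b)).
  by rewrite last_rcons => e'; rewrite e' eqxx in av.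
exists m => // e u eE u01.
have z01 : 0 <= (0 : R) <= 1 by rewrite lexx ler01.
by have := far e 0 u eE z01 u01; rewrite vv.
Qed.

(** The new edge has direction q d1 + p d2, where p = |d1_i| and q = |d2_i|; as
    d1_i and d2_i have opposite signs its i-th coordinate vanishes.  The cut is
    made so small that the other edges are out of reach, and the two neighbours are
    kept away by a linear form that increases along d1 and d2. *)
Lemma bend_corner (R : realType) (a v b : 'rV[R]_3) t (i : 'I_3) :
  embedded (a :: v :: b :: t) ->
  dir (a, v) 0 i * dir (v, b) 0 i < 0 ->
  exists a' b' : 'rV[R]_3, exists x y z w : R,
    [/\ [/\ 0 < x, 0 < y, 0 < z & 0 < w],
        [/\ dir (a, a') = x *: dir (a, v), dir (b', b) = y *: dir (v, b),
          dir (a', b') = z *: dir (a, v) + w *: dir (v, b) & dir (a', b') 0 i = 0],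
        embedded (a :: a' :: b' :: b :: t) &
        ambient_isotopic (carrier (a :: v :: b :: t))
          (carrier (a :: a' :: b' :: b :: t))].
Proof.
move=> emb; set d1 := dir (a, v); set d2 := dir (v, b) => conf.
have [s2 sim] := emb.
have edgE : edges (a :: v :: b :: t) = (a, v) :: (v, b) :: walk b (rcons t a).
  exact: (edges_cat a b [:: v]).
have := sim; rewrite edgE => /simple_cons[/= av' /simple_cons[/= vb' _ _] _].
have [eta eta0 far] := vertex_distance emb.
set E := walk b (rcons t a) in far edgE *.
pose p := `|d1 0 i|; pose q := `|d2 0 i|.
have p0 : 0 < p by rewrite normr_gt0; apply: contraTneq conf => ->; rewrite mul0r ltxx.
have q0 : 0 < q by rewrite normr_gt0; apply: contraTneq conf => ->; rewrite mulr0 ltxx.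
have mi : q * d1 0 i + p * d2 0 i = 0.
  rewrite /p /q; have [h1|h1|h1] := ltrgtP (d1 0 i) 0.
  - have h2 : 0 < d2 0 i by rewrite -(nmulr_rlt0 _ h1).
    by rewrite (gtr0_norm h2) (ltr0_norm h1); ring.
  - have h2 : d2 0 i < 0 by rewrite -(pmulr_rlt0 _ h1).
    by rewrite (ltr0_norm h2) (gtr0_norm h1); ring.
  - by move: conf; rewrite h1 mul0r ltxx.
have m0 : q *: d1 + p *: d2 != 0.
  apply: (simple_angle sim); rewrite ?edgE ?inE ?eqxx ?orbT //; first exact: ltW.
    exact: ltW.
  exact: addr_gt0.
have [k mk] : exists k, (q *: d1 + p *: d2) 0 k != 0.
  apply/existsP; apply: contraR m0 => /existsPn h.
  by apply/eqP/rowP => k; rewrite [RHS]mxE; apply/eqP; rewrite -[_ == _]negbK; exact: h.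
have [l [al l1 l2]] : exists l, [/\ affine l,
    forall a x, 0 < x -> 0 < l (a + x *: d1) - l a &
    forall a x, 0 < x -> 0 < l (a + x *: d2) - l a].
  have sg : - d2 0 i = d1 0 i * (q / p).
    apply: (@mulfI _ p); first exact: lt0r_neq0.
    have -> : p * - d2 0 i = q * d1 0 i by move: mi; lra.
    by field; exact: lt0r_neq0.
  apply: (@common_ascent _ d1 d2 i k).
    rewrite sg mulrA -expr2 mulr_gt0 ?divr_gt0 //.
    by rewrite exprn_even_gt0 //= -normr_gt0.
  have -> : - d2 0 i * d1 0 k + d1 0 i * d2 0 k = (d1 0 i / p) * (q *: d1 + p *: d2) 0 k.
    rewrite sg !mxE; field; exact: lt0r_neq0.
  have d1i : d1 0 i != 0 by rewrite -normr_gt0.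
  by rewrite mulf_neq0 // mulf_neq0 // invr_eq0 lt0r_neq0.
(* dividing by D makes the cut shorter than both edges and than eta *)
pose D := 1 + p + q + (q * `|d1| + p * `|d2|) / eta.
have r0 : 0 <= (q * `|d1| + p * `|d2|) / eta.
  by rewrite divr_ge0 ?addr_ge0 ?mulr_ge0 // ltW.
have D0 : 0 < D by rewrite /D; lra.
have pD : 0 < p / D < 1 by rewrite divr_gt0 //= ltr_pdivrMr // mul1r /D; lra.
have qD : 0 < q / D < 1 by rewrite divr_gt0 //= ltr_pdivrMr // mul1r /D; lra.
have nearD : (q * `|d1| + p * `|d2|) / D < eta.
  rewrite ltr_pdivrMr //.
  have -> : eta * D = eta * (1 + p + q) + (q * `|d1| + p * `|d2|).
    by rewrite /D; field; exact: lt0r_neq0.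
  by rewrite ltrDr mulr_gt0 //; lra.
have [pD0 pD1] := andP pD; have [qD0 qD1] := andP qD.
pose a' := segpt a v (1 - q / D); pose b' := segpt v b (p / D).
have a'E : a' = a + (1 - q / D) *: d1 by apply/rowP => j; rewrite !mxE; ring.
have va' : v = a' + (q / D) *: d1 by apply/rowP => j; rewrite !mxE; ring.
have b'E : b' = v + (p / D) *: d2 by apply/rowP => j; rewrite !mxE; ring.
have bb' : b = b' + (1 - p / D) *: d2 by apply/rowP => j; rewrite !mxE; ring.
have la : l a < l a' by rewrite -subr_gt0 a'E l1 // subr_gt0.
have lv : l a' < l v by rewrite -subr_gt0 {1}va' l1.
have lb' : l v < l b' by rewrite -subr_gt0 b'E l2.
have lb : l b' < l b by rewrite -subr_gt0 {1}bb' l2 // subr_gt0.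
have na' : `|a' - v| < eta.
  apply: le_lt_trans nearD.
  have -> : a' - v = - ((q / D) *: d1) by rewrite {1}va' opprD addrA subrr add0r.
  rewrite normrN normrZ gtr0_norm // mulrAC ler_wpM2r ?invr_ge0 ?(ltW D0) //.
  by rewrite lerDl mulr_ge0 // ltW.
have nb' : `|b' - v| < eta.
  apply: le_lt_trans nearD.
  have -> : b' - v = (p / D) *: d2 by rewrite b'E (addrC v) addrK.
  rewrite normrZ gtr0_norm // mulrAC ler_wpM2r ?invr_ge0 ?(ltW D0) //.
  by rewrite lerDr mulr_ge0 // ltW.
have edgE5 : edges (a :: a' :: v :: b' :: b :: t) =
    (a, a') :: (a', v) :: (v, b') :: (b', b) :: E.
  exact: (edges_cat a b [:: a'; v; b']).
have qD' : 0 < 1 - q / D < 1 by rewrite subr_gt0 qD1 ltrBlDr ltrDl qD0.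
have sim5 : simple (edges (a :: a' :: v :: b' :: b :: t)).
  rewrite edgE5; apply/(simple_split _ av' qD').
  apply: (@eq_simple _ ((v, b') :: (b', b) :: (a, v) :: E)).
    by rewrite (perm_catCA [:: _; _] [:: _]).
  apply/(simple_split _ vb' pD); apply: eq_simple sim; rewrite edgE.
  by rewrite (perm_catCA [:: _] [:: _]).
have car5 : carrier (a :: v :: b :: t) = carrier (a :: a' :: v :: b' :: b :: t).
  rewrite /carrier edgE edgE5 (cover_split _ _ _ qD').
  have -> : cover ((a, v) :: (v, b') :: (b', b) :: E) =
            cover ((v, b') :: (b', b) :: (a, v) :: E).
    by apply: eq_cover; apply: perm_mem; rewrite (perm_catCA [:: _] [:: _; _]).
  rewrite (cover_split _ _ _ pD).
  by apply: eq_cover; apply: perm_mem; rewrite (perm_catCA [:: _] [:: _]).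
exists a', b', (1 - q / D), (1 - p / D), (q / D), (p / D).
have emb5 : embedded (a' :: v :: b' :: rcons (b :: t) a).
  by apply/(embedded_rot1 a (a' :: v :: b' :: b :: t)); split.
have [||emb4 iso] := @cut_corner _ a' v b' (rcons (b :: t) a) l emb5 _ al lv lb'.
- by rewrite size_rcons.
- move=> r x r01 v' h.
  have nv' : `|v' - v| < eta.
    apply: ball_convex => //; first by rewrite subrr normr0.
    apply: ball_convex => //.
    by rewrite invr_ge0 ler0n /= invf_le1 ?ltr0n // ler1n.
  have mid : l a' < l (segpt a' b' 2^-1) < l b'.
    exact: affine_midpoint (lt_trans lv lb').
  have lv' : l a' < l v' < l b'.
    have /= := @rising_mix _ l a' a' [:: v; b'] [:: segpt a' b' 2^-1; b'] r al r01 erefl.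
    have e c : segpt c c r = c by apply/rowP => j; rewrite !mxE; ring.
    rewrite !andbT !e /below lv lb'; case/andP: mid => -> -> /(_ isT isT).
    by [].
  have /andP[lv1 lv2] := lv'.
  have [nx lx] : `|x - v| < eta /\ l a' <= l x < l b'.
    case: h => -[u u01 <-] /=.
      have u01' : 0 <= u <= 1 by case/andP: u01 => -> /ltW ->.
      split; first exact: ball_convex.
      have /andP[-> h2] := affine_convex al u01 lv1; exact: lt_trans lv2.
    have u01' : 0 <= u <= 1 by case/andP: u01 => -> /ltW ->.
    split; first exact: ball_convex.
    have /andP[h1 ->] := affine_convex al u01 lv2; rewrite andbT.
    exact: le_trans (ltW lv1) h1.
  have -> : walk b' (rcons (rcons (b :: t) a) a') = (b', b) :: rcons E (a, a').
    by rewrite rcons_cons /= walk_rcons last_rcons.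
  move=> /cover_cons[[u u01 e]|].
    have := affine_convex al u01 lb; rewrite e => /andP[h1 _].
    by case/andP: lx => _ h2; have := le_lt_trans h1 h2; rewrite ltxx.
  rewrite -cats1 => /cover_cat[[e eE [u /= u01 e']]|].
    have u01' : 0 <= u <= 1 by case/andP: u01 => -> /ltW ->.
    have := far e u eE u01'; rewrite e' distrC => h2.
    by have := le_lt_trans h2 nx; rewrite ltxx.
  move=> /cover_cons[[u u01 e]|/cover_nil//].
  have := affine_convex al u01 la; rewrite e => /andP[_ h1].
  by case/andP: lx => h2 _; have := lt_le_trans h1 h2; rewrite ltxx.
split.
- by split; rewrite ?subr_gt0.
- split.
  + by rewrite /dir /= a'E (addrC a) addrK.
  + by rewrite {1}/dir /= {1}bb' (addrC b') addrK.
  + by rewrite {1}/dir /= b'E {1}va'; apply/rowP => j; rewrite !mxE; ring.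
  + have -> : dir (a', b') 0 i = (q * d1 0 i + p * d2 0 i) / D.
      rewrite {1}/dir /= b'E va'.
      have -> : a' + q / D *: d1 + p / D *: d2 - a' = (q / D) *: d1 + (p / D) *: d2.
        by rewrite -(addrA a') (addrC a') addrK.
      by rewrite !mxE; field; exact: lt0r_neq0.
    by rewrite mi mul0r.
- by apply/(embedded_rot1 a (a' :: b' :: b :: t)).
- rewrite car5 -(carrier_rot1 a (a' :: v :: b' :: b :: t)).
  by rewrite -(carrier_rot1 a (a' :: b' :: b :: t)).
Qed.

Lemma rot_edge (T : eqType) (s : seq T) e :
  e \in edges s -> (1 < size s)%N ->
  exists k t, rot k s = e.1 :: e.2 :: t.
Proof.
move=> es s1.
have : rot (index e (edges s)) (edges s) = e :: _ := rot_index es.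
rewrite -edges_rot; set k := index _ _.
have : (1 < size (rot k s))%N by rewrite size_rot.
case E: (rot k s) => [|x [|y t]] //= _.
by rewrite edges_cons /walk /= => -[<- _]; exists k, t.
Qed.

Lemma rot_turn (T : eqType) (s : seq T) p :
  p \in edges (edges s) -> (2 < size s)%N ->
  exists k a v b t, rot k s = a :: v :: b :: t /\ p = ((a, v), (v, b)).
Proof.
move=> ps s2.
have : rot (index p (edges (edges s))) (edges (edges s)) = p :: _ := rot_index ps.
rewrite -!edges_rot; set k := index _ _.
have : (2 < size (rot k s))%N by rewrite size_rot.
case E: (rot k s) => [|a [|v [|b t]]] //= _.
rewrite (edges_cons a) /walk /= edges_cons /walk /= => -[<- _].
by exists k, a, v, b, t.
Qed.

(** The two edges lie in a common closed octant. *)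
Definition agree (R : realType) (e f : 'rV[R]_3 * 'rV[R]_3) : Prop :=
  forall i, 0 <= dir e 0 i * dir f 0 i.

Definition disagreements (R : realType) (e f : 'rV[R]_3 * 'rV[R]_3) : nat :=
  (\sum_(i < 3) (dir e 0 i * dir f 0 i < 0)%R)%N.

Definition disagreement (R : realType) (s : seq 'rV[R]_3) : nat :=
  (\sum_(p <- edges (edges s)) disagreements p.1 p.2)%N.

Lemma disagreements_scale (R : realType) (e e' f f' : 'rV[R]_3 * 'rV[R]_3) x y :
  0 < x -> 0 < y -> dir e' = x *: dir e -> dir f' = y *: dir f ->
  disagreements e' f' = disagreements e f.
Proof.
move=> x0 y0 ee ff; apply: eq_bigr => i _; rewrite ee ff !mxE.
by rewrite mulrACA pmulr_rlt0 // mulr_gt0.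
Qed.

Lemma disagreement_ends (R : realType) (e e' f f' : 'rV[R]_3 * 'rV[R]_3) x y es :
  0 < x -> 0 < y -> dir e' = x *: dir e -> dir f' = y *: dir f ->
  (\sum_(p <- walk e' (rcons es f')) disagreements p.1 p.2 =
   \sum_(p <- walk e (rcons es f)) disagreements p.1 p.2)%N.
Proof.
move=> x0 y0 ee ff; elim: es e e' x x0 ee => [|g es IH] e e' x x0 ee.
  by rewrite /walk /= !big_seq1 /=; exact: disagreements_scale ee ff.
rewrite /walk /= !big_cons /=; congr addn.
  by apply: (@disagreements_scale _ _ _ _ _ x 1) => //; rewrite scale1r.
by apply: (IH _ _ 1) => //; rewrite scale1r.
Qed.

Lemma disagreement_rot (R : realType) k (s : seq 'rV[R]_3) :
  disagreement (rot k s) = disagreement s.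
Proof.
by rewrite /disagreement !edges_rot; apply: perm_big; rewrite perm_rot.
Qed.

(** An intermediate direction splits the disagreements of a turn between its two
    halves. *)
Lemma disagreements_between (R : realType) (e m f : 'rV[R]_3 * 'rV[R]_3) x y i :
  0 < x -> 0 < y -> dir m = x *: dir e + y *: dir f -> dir m 0 i = 0 ->
  dir e 0 i * dir f 0 i < 0 ->
  (disagreements e m + disagreements m f < disagreements e f)%N.
Proof.
move=> x0 y0 mE mi di; rewrite /disagreements -big_split /=.
have le j : ((dir e 0 j * dir m 0 j < 0)%R + (dir m 0 j * dir f 0 j < 0)%R <=
             (dir e 0 j * dir f 0 j < 0)%R)%N.
  have [neg|nneg] := ltP (dir e 0 j * dir f 0 j) 0.
    case: ltP => h1; case: ltP => h2 //.
    have h3 : 0 < (dir e 0 j * dir m 0 j) * (dir m 0 j * dir f 0 j).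
      by rewrite nmulr_rgt0.
    have h4 : dir m 0 j ^+ 2 * (dir e 0 j * dir f 0 j) <= 0.
      by rewrite mulr_ge0_le0 ?sqr_ge0 // ltW.
    move: h3; rewrite ltNge; case/negP; apply: le_trans h4.
    by rewrite le_eqVlt; apply/orP; left; apply/eqP; ring.
  have -> : dir m 0 j = x * dir e 0 j + y * dir f 0 j by rewrite mE !mxE.
  have -> : (dir e 0 j * (x * dir e 0 j + y * dir f 0 j) < 0) = false.
    apply/negbTE; rewrite -leNgt.
    have -> : dir e 0 j * (x * dir e 0 j + y * dir f 0 j) =
      x * dir e 0 j ^+ 2 + y * (dir e 0 j * dir f 0 j) by ring.
    by apply: addr_ge0; apply: mulr_ge0; rewrite ?sqr_ge0 ?(ltW x0) ?(ltW y0).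
  have -> : ((x * dir e 0 j + y * dir f 0 j) * dir f 0 j < 0) = false.
    apply/negbTE; rewrite -leNgt.
    have -> : (x * dir e 0 j + y * dir f 0 j) * dir f 0 j =
      y * dir f 0 j ^+ 2 + x * (dir e 0 j * dir f 0 j) by ring.
    by apply: addr_ge0; apply: mulr_ge0; rewrite ?sqr_ge0 ?(ltW x0) ?(ltW y0).
  by [].
rewrite (bigD1 i) //= [in X in (_ < X)%N](bigD1 i) //=.
rewrite mi mulr0 mul0r ltxx di add0n addSn ltnS add0n.
by apply: leq_sum => j _; exact: le.
Qed.

(** Each cut of a corner lowers the total number of disagreements. *)
Lemma isotopic_agreeing (R : realType) (s : seq 'rV[R]_3) :
  embedded s -> exists s', [/\ embedded s',
    ambient_isotopic (carrier s) (carrier s') &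
    forall p, p \in edges (edges s') -> agree p.1 p.2].
Proof.
have [n] := ubnP (disagreement s); elim: n s => // n IH s; rewrite ltnS => sn emb.
have [ok|[p [ps bad]]] : (forall p, p \in edges (edges s) -> agree p.1 p.2) \/
    exists p, p \in edges (edges s) /\ ~ agree p.1 p.2.
  have [h|h] := pselect (exists p, p \in edges (edges s) /\ ~ agree p.1 p.2).
    by right.
  left=> p ps; apply: contrapT => bad; by apply: h; exists p.
- by exists s; split=> //; exact: ambient_isotopic_refl.
have [i di] : exists i, dir p.1 0 i * dir p.2 0 i < 0.
  apply: contrapT => h; apply: bad => i; rewrite leNgt; apply/negP => di.
  by apply: h; exists i.
have [k [a [v [b [t [rk pE]]]]]] := rot_turn ps emb.1.
have embk := embedded_rot k emb; rewrite rk in embk.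
rewrite pE in di.
have [a' [b' [x [y [z [w [[x0 y0 z0 w0] [da db dm mi] emb' iso]]]]]]] := bend_corner embk di.
have dec : (disagreement (a :: a' :: b' :: b :: t) < disagreement s)%N.
  rewrite -(disagreement_rot k s) rk /disagreement.
  rewrite (edges_cat a b [:: v]) (edges_cat a b [:: a'; b']) /=.
  rewrite !edges_cons /walk /= !big_cons /= addnA.
  have -> := @disagreement_ends _ _ _ _ _ y x (walk b (rcons t a)) y0 x0 db da.
  rewrite ltn_add2r.
  have -> : disagreements (a, a') (a', b') = disagreements (a, v) (a', b').
    by apply: (@disagreements_scale _ _ _ _ _ x 1) => //; rewrite scale1r.
  have -> : disagreements (a', b') (b', b) = disagreements (a', b') (v, b).
    by apply: (@disagreements_scale _ _ _ _ _ 1 y) => //; rewrite scale1r.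
  exact: disagreements_between z0 w0 dm mi di.
have [s' [emb'' iso' ok]] := IH _ (leq_trans dec sn) emb'.
exists s'; split=> //.
by apply: ambient_isotopic_trans iso'; rewrite -(carrier_rot k s) rk.
Qed.

(** Rounding is nondecreasing, so it turns no agreement into a disagreement. *)
Lemma isotopic_rational (R : realType) (s : seq 'rV[R]_3) :
  embedded s -> (forall p, p \in edges (edges s) -> agree p.1 p.2) ->
  exists s' N, [/\ embedded s', ambient_isotopic (carrier s) (carrier s'),
    forall p, p \in edges (edges s') -> agree p.1 p.2, (0 < N)%N &
    forall x i, x \in s' -> N%:R * x 0 i \in Num.int].
Proof.
move=> [s2 sim] ok.
have [e e0 near] := isotopic_map_near s2 sim.
pose N := (Num.bound (e^-1)).+1.
have N0 : (0 : R) < N%:R by rewrite ltr0n.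
have eN : N%:R^-1 <= e.
  rewrite invf_ple ?posrE //.
  have ei : 0 <= e^-1 by rewrite invr_ge0 ltW.
  by apply/ltW/(lt_le_trans (archi_boundP ei)); rewrite ler_nat.
(* rounding down to the grid of mesh 1/N moves points by at most 1/N <= e *)
pose r (x : R) : R := (Num.floor (N%:R * x))%:~R / N%:R.
have rmono x y : x <= y -> r x <= r y.
  move=> xy; rewrite /r ler_wpM2r ?invr_ge0 ?ler0n // ler_int le_floor //.
  by rewrite ler_pM2l.
pose f (x : 'rV[R]_3) : 'rV[R]_3 := \row_i r (x 0 i).
have [sim' iso] : simple (edges (map f s)) /\
    ambient_isotopic (carrier s) (carrier (map f s)).
  apply: near => x _; apply: norm_le_coord => [|i]; first exact: ltW.
  rewrite !mxE /r.
  have h1 := floor_le (N%:R * x 0 i).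
  have h2 := floorD1_gt (N%:R * x 0 i).
  rewrite intrD in h2.
  set F := (Num.floor _)%:~R in h1 h2 *.
  have -> : F / N%:R - x 0 i = (F - N%:R * x 0 i) / N%:R.
    by field; exact: lt0r_neq0.
  rewrite normrM (ger0_norm (_ : 0 <= N%:R^-1)) ?invr_ge0 ?ler0n //.
  apply: le_trans eN; rewrite ler_piMl ?invr_ge0 ?ler0n //.
  by rewrite ler_norml; apply/andP; split; lra.
exists (map f s), N; split=> //.
- by split; first by rewrite size_map.
- move=> p; rewrite edges_map edges_map => /mapP[q qs ->] i.
  have := ok q qs i; rewrite /dir /= !mxE => h.
  have sub x y : 0 <= y - x -> 0 <= r y - r x by rewrite !subr_ge0; exact: rmono.
  have sub' x y : y - x <= 0 -> r y - r x <= 0 by rewrite !subr_le0; exact: rmono.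
  set A := _ - _ in h; set B := (X in A * X) in h.
  have [A0|A0|A0] := ltrgtP A 0.
  + by apply: mulr_le0; apply: sub'; [exact: ltW|rewrite -(nmulr_rge0 _ A0)].
  + by apply: mulr_ge0; apply: sub; [exact: ltW|rewrite -(pmulr_rge0 _ A0)].
  + by move/eqP: A0; rewrite subr_eq0 => /eqP ->; rewrite subrr mul0r.
- move=> x i /mapP[y _ ->]; by rewrite mxE /r mulrC divfK ?gt_eqF.
Qed.

(** * Staircases *)

Definition trail (R : realType) (x : 'rV[R]_3) (w : seq 'rV[R]_3) :=
  scanl +%R x w.

Lemma trail_cat (R : realType) (x : 'rV[R]_3) w w' :
  trail x (w ++ w') = trail x w ++ trail (x + \sum_(f <- w) f) w'.
Proof.
elim: w x => [|f w IH] x /=; first by rewrite big_nil addr0.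
by rewrite big_cons addrA -IH.
Qed.

Lemma last_trail (R : realType) (x : 'rV[R]_3) w :
  last x (trail x w) = x + \sum_(f <- w) f.
Proof.
elim: w x => [|f w IH] x /=; first by rewrite big_nil addr0.
by rewrite big_cons addrA -IH.
Qed.

Lemma dir_trail (R : realType) (x : 'rV[R]_3) w e :
  e \in walk x (trail x w) -> dir e \in w.
Proof.
elim: w x => [|f w IH] x //=; rewrite !inE => /orP[/eqP ->|/IH ->].
  by rewrite /dir /= addrC addKr eqxx.
by rewrite orbT.
Qed.

Lemma trail_invariant (R : realType) (P : 'rV[R]_3 -> Prop) (x : 'rV[R]_3) w y :
  (forall z f, P z -> f \in w -> P (z + f)) -> P x -> y \in trail x w -> P y.
Proof.
elim: w x => [|f w IH] x //= h Px; rewrite inE.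
have Pxf : P (x + f) by apply: h; rewrite ?mem_head.
move=> /orP[/eqP -> //|]; apply: IH => // z g Pz gw.
by apply: h; rewrite // inE gw orbT.
Qed.

Lemma path_trail (R : realType) (l : 'rV[R]_3 -> R) (x : 'rV[R]_3) w :
  (forall z f, f \in w -> l z < l (z + f)) -> path (below l) x (trail x w).
Proof.
elim: w x => [|f w IH] x //= h; rewrite {1}/below h ?mem_head //=.
by apply: IH => z g gw; apply: h; rewrite inE gw orbT.
Qed.

(** The first point splits off an edge, and the others subdivide the
    remainder. *)
Lemma subdivision (R : realType) (x f : 'rV[R]_3) n es :
  f != 0 -> (cover (walk x (trail x (nseq n.+1 f)) ++ es) =
             cover ((x, x + n.+1%:R *: f) :: es)) /\
  (simple ((x, x + n.+1%:R *: f) :: es) ->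
   simple (walk x (trail x (nseq n.+1 f)) ++ es)).
Proof.
move=> f0; elim: n x es => [|n IH] x es; first by rewrite scale1r.
have nz : x != x + n.+2%:R *: f.
  by rewrite -subr_eq0 opprD addrA subrr add0r oppr_eq0 scaler_eq0 pnatr_eq0.
have l01 : 0 < (n.+2%:R^-1 : R) < 1.
  by rewrite invr_gt0 ltr0n /= invf_lt1 ?ltr0n // ltr1n.
have xf : x + f = segpt x (x + n.+2%:R *: f) n.+2%:R^-1.
  apply/rowP => k; rewrite !mxE; field; by rewrite -(natrD _ 1) pnatr_eq0 || rewrite ?pnatr_eq0.
have xn : x + n.+2%:R *: f = (x + f) + n.+1%:R *: f.
  by apply/rowP => k; rewrite !mxE; ring.
have wE : walk x (trail x (nseq n.+2 f)) ++ es =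
    (x, x + f) :: walk (x + f) (trail (x + f) (nseq n.+1 f)) ++ es by [].
have pE (A B : seq ('rV[R]_3 * 'rV[R]_3)) e : perm_eq (e :: A ++ B) (A ++ e :: B).
  by rewrite -cat1s (perm_catCA [:: e] A).
have [IH1 IH2] := IH (x + f) ((x, x + f) :: es).
rewrite wE; split.
  rewrite (eq_cover (perm_mem (pE _ _ _))) IH1 -[RHS](cover_split _ _ _ l01) -xf xn.
  by apply: eq_cover; apply: perm_mem; rewrite (perm_catCA [:: _] [:: _]).
move=> sim; apply: (@eq_simple _ (walk (x + f) (trail (x + f) (nseq n.+1 f)) ++ (x, x + f) :: es)).
  by rewrite perm_sym; exact: pE.
apply: IH2; rewrite -xn.
apply: (@eq_simple _ ((x, x + f) :: (x + f, x + n.+2%:R *: f) :: es)).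
  by rewrite (perm_catCA [:: _] [:: _]).
by rewrite xf; apply/simple_split.
Qed.

Definition close (R : realType) (c : R) : rel 'rV[R]_3 :=
  fun x y => `|x - y| <= c.

Lemma all2_cat_eqsize (T U : Type) (r : T -> U -> bool) s1 t1 s2 t2 :
  all2 r s1 t1 -> all2 r s2 t2 -> all2 r (s1 ++ s2) (t1 ++ t2).
Proof.
elim: s1 t1 => [|x s IH] [|y t] //=.
 move=> /andP[xy st] h.
by rewrite xy IH.
Qed.

Lemma trail_bound (R : realType) (x : 'rV[R]_3) w y :
  y \in trail x w -> `|y - x| <= \sum_(f <- w) `|f|.
Proof.
elim: w x => [|f w IH] x /=; first by rewrite in_nil.
rewrite inE big_cons => /orP[/eqP ->|/IH h].
  by rewrite addrC addKr lerDl sumr_ge0.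
have -> : y - x = f + (y - (x + f)) by apply/rowP => k; rewrite !mxE; ring.
by apply: (le_trans (ler_normD _ _)); rewrite lerD2l.
Qed.

(** Two trails made of repetitions of blocks with the same sum meet after each
    block, hence stay close. *)
Lemma trail_close (R : realType) (x : 'rV[R]_3) (u w : seq 'rV[R]_3) n :
  size u = size w -> \sum_(f <- u) f = \sum_(f <- w) f ->
  all2 (close (\sum_(f <- u) `|f| + \sum_(f <- w) `|f|))
    (trail x (flatten (nseq n u))) (trail x (flatten (nseq n w))).
Proof.
move=> suw sumuw; set c := _ + _.
have block z : all2 (close c) (trail z u) (trail z w).
  have : size (trail z u) = size (trail z w) by rewrite !size_scanl.
  have bu y : y \in trail z u -> `|y - z| <= \sum_(f <- u) `|f| by exact: trail_bound.
  have bw y : y \in trail z w -> `|y - z| <= \sum_(f <- w) `|f| by exact: trail_bound.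
  elim: (trail z u) (trail z w) bu bw => [|p s IH] [|q t] //= bu bw [st].
  rewrite IH //; last 2 first.
  - by move=> y yt; apply: bu; rewrite inE yt orbT.
  - by move=> y yt; apply: bw; rewrite inE yt orbT.
  rewrite andbT /close.
  have -> : p - q = (p - z) - (q - z) by rewrite opprB addrA subrK.
  apply: (le_trans (ler_normB _ _)); apply: lerD; [apply: bu|apply: bw];
    exact: mem_head.
elim: n x => [|n IH] x //=; rewrite !trail_cat sumuw.
exact: all2_cat_eqsize.
Qed.

(** A point of an intermediate path is compared with the point of the first path
    that has the same parameter. *)
Lemma cover_mix_close (R : realType) c (x y : 'rV[R]_3) s t r z :
  0 <= r <= 1 -> close c x y -> all2 (close c) s t ->
  cover (walk (segpt x y r) (mix s t r)) z ->
  exists2 z', cover (walk x s) z' & `|z - z'| <= c.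
Proof.
move=> r01; elim: s t x y => [|a s IH] [|b t] x y //= xy; first by move=> _ /cover_nil.
move=> /andP[ab st] /cover_cons[[u u01 <-] /=|h].
  exists (segpt x a u); first by apply/cover_cons; left; exists u.
  have -> : segpt (segpt x y r) (segpt a b r) u - segpt x a u =
      - (r *: segpt (x - y) (a - b) u) by apply/rowP => k; rewrite !mxE; ring.
  rewrite normrN normrZ ger0_norm; last by case/andP: r01.
  have h : `|segpt (x - y) (a - b) u| <= c.
    case/andP: u01 => u0 u1.
    apply: (le_trans (ler_normD _ _)); rewrite !normrZ !ger0_norm ?subr_ge0 ?(ltW u1) //.
    have h1 : (1 - u) * `|x - y| <= (1 - u) * c by rewrite ler_wpM2l ?subr_ge0 ?(ltW u1).
    have h2 : u * `|a - b| <= u * c by rewrite ler_wpM2l.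
    lra.
  by apply: le_trans h; rewrite ler_piMl //; case/andP: r01.
have [z' cz' zz'] := IH t a b ab st h.
by exists z' => //; apply/cover_cons; right.
Qed.

Definition ascends (R : realType) (sg : 'I_3 -> R) (d : 'rV[R]_3) : Prop :=
  d != 0 /\ forall i, 0 <= sg i * d 0 i.

(** The linear form that increases in all directions of the octant of signs
    sg. *)
Definition height (R : realType) (sg : 'I_3 -> R) (x : 'rV[R]_3) : R :=
  \sum_i sg i * x 0 i.

Lemma height_affine (R : realType) (sg : 'I_3 -> R) : affine (height sg).
Proof.
move=> a b t; rewrite /height !mulr_sumr -big_split /=; apply: eq_bigr => i _.
by rewrite segpt_coord; ring.
Qed.

Lemma height_ascends (R : realType) (sg : 'I_3 -> R) d x :
  (forall i, sg i != 0) -> ascends sg d -> height sg x < height sg (x + d).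
Proof.
move=> sg0 [d0 asc].
have -> : height sg (x + d) = height sg x + \sum_i sg i * d 0 i.
  by rewrite /height -big_split /=; apply: eq_bigr => i _; rewrite mxE mulrDr.
rewrite ltrDl lt_neqAle sumr_ge0 // andbT eq_sym.
apply: contraNneq d0 => /eqP; rewrite psumr_eq0 // => /allP h.
apply/eqP/rowP => i; rewrite [RHS]mxE; apply/eqP.
by have := h i (mem_index_enum i); rewrite mulf_eq0 (negbTE (sg0 i)).
Qed.

Lemma agree_ascends (R : realType) (e f : 'rV[R]_3 * 'rV[R]_3) :
  agree e f -> dir e != 0 -> dir f != 0 ->
  exists2 sg, forall i, sg i != 0 & ascends sg (dir e) /\ ascends sg (dir f).
Proof.
move=> ag e0 f0.
pose sg i : R := if (0 <= dir e 0 i) && (0 <= dir f 0 i) then 1 else -1.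
exists sg => [i|]; first by rewrite /sg; case: ifP => _; rewrite ?oppr_eq0 oner_eq0.
have h i : 0 <= sg i * dir e 0 i /\ 0 <= sg i * dir f 0 i.
  rewrite /sg; case: ifP => [/andP[h1 h2]|]; rewrite ?mul1r // !mulN1r !oppr_ge0.
  move=> /negbT; rewrite negb_and -!ltNge => /orP[h|h]; have := ag i.
    by rewrite nmulr_rge0 // (ltW h).
  by rewrite nmulr_lge0 // (ltW h).
by split; split=> // i; have [] := h i.
Qed.

Definition part (R : realType) (d : 'rV[R]_3) (i : 'I_3) : 'rV[R]_3 :=
  d 0 i *: delta_mx 0 i.

Lemma part_coord (R : realType) (d : 'rV[R]_3) i j :
  part d i 0 j = if j == i then d 0 i else 0.
Proof.
by rewrite /part !mxE eqxx /=; case: (j == i); rewrite ?mulr1 ?mulr0.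
Qed.

Definition step_of (R : realType) (d f : 'rV[R]_3) : Prop :=
  exists i c, [/\ d 0 i != 0, 0 < c & f = c *: part d i].

Lemma step_ascends (R : realType) sg (d f : 'rV[R]_3) :
  step_of d f -> ascends sg d -> ascends sg f.
Proof.
move=> [i [c [di c0 ->]]] [_ asc]; split.
  apply/eqP => /rowP /(_ i); rewrite !mxE !eqxx mulr1 => /eqP.
  by rewrite mulf_eq0 (negbTE di) gt_eqF.
move=> j; rewrite !mxE eqxx /=; case: eqVneq => [->|_]; last by rewrite !mulr0.
by rewrite mulr1 mulrCA mulr_ge0 // ltW.
Qed.

Lemma sum_parts (R : realType) (d : 'rV[R]_3) :
  \sum_(f <- [seq part d i | i <- enum 'I_3 & d 0 i != 0]) f = d.
Proof.
rewrite big_map big_filter big_enum_cond /= big_mkcond /= [RHS]row_sum_delta.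
apply: eq_bigr => i _; rewrite /part; case: eqVneq => [->|//].
by rewrite scale0r.
Qed.

Lemma flatten_nseq_nseq (T : Type) (x : T) m n :
  flatten (nseq m (nseq n x)) = nseq (m * n) x.
Proof. by elim: m => //= m ->; rewrite mulSn nseqD. Qed.

(** The staircase from a to b repeats M times the coordinate steps of (b - a)/M;
    it follows the regular subdivision of the segment in as many pieces. *)
Lemma staircase (R : realType) (a b : 'rV[R]_3) (c : R) :
  a != b -> 0 < c -> exists s s' : seq 'rV[R]_3,
  [/\ size s = size s', all2 (close c) (rcons s b) (rcons s' b),
    forall es, cover (walk a (rcons s b) ++ es) = cover ((a, b) :: es),
    forall sg, (forall i, sg i != 0) -> ascends sg (b - a) ->
      path (below (height sg)) a (rcons s b) /\
      path (below (height sg)) a (rcons s' b) &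
    (forall e, e \in walk a (rcons s' b) -> step_of (b - a) (dir e)) /\
    exists2 M, (0 < M)%N & forall N, (forall i, N%:R * a 0 i \in Num.int) ->
      (forall i, N%:R * b 0 i \in Num.int) ->
      forall x i, x \in s' -> (N * M)%:R * x 0 i \in Num.int].
Proof.
move=> ab c0; set d := b - a.
have d0 : d != 0 by rewrite subr_eq0 eq_sym.
pose fs := [seq part d i | i <- enum 'I_3 & d 0 i != 0].
have fsP f : f \in fs -> exists2 i, d 0 i != 0 & f = part d i.
  by move=> /mapP[i]; rewrite mem_filter => /andP[di _] ->; exists i.
have sum_fs : \sum_(f <- fs) f = d by exact: sum_parts.
have fs0 : (0 < size fs)%N.
  by rewrite lt0n; apply: contraNneq d0 => /size0nil e; rewrite -sum_fs e big_nil.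
pose S := (\sum_(f <- fs) `|f| + `|d|) / c.
have S0 : 0 <= S.
  by rewrite divr_ge0 ?(ltW c0) // addr_ge0 // sumr_ge0.
pose M := (Num.bound S).+1.
have M0 : (0 : R) < M%:R by rewrite ltr0n.
have SM : (\sum_(f <- fs) `|f| + `|d|) / M%:R <= c.
  rewrite ler_pdivrMr // mulrC -ler_pdivrMr //.
  by apply/ltW/(lt_le_trans (archi_boundP S0)); rewrite ler_nat.
pose u := [seq M%:R^-1 *: f | f <- fs].
pose g := (M * size fs)%:R^-1 *: d.
have Mr0 : (M * size fs)%:R != 0 :> R by rewrite pnatr_eq0 muln_eq0 negb_or /= -lt0n.
have g0 : g != 0 by rewrite scaler_eq0 invr_eq0 negb_or Mr0.
have gE : (M * size fs)%:R *: g = d by rewrite /g scalerA divff // scale1r.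
have sum_u : \sum_(f <- u) f = M%:R^-1 *: d.
  by rewrite /u big_map -scaler_sumr sum_fs.
have sum_w : \sum_(f <- nseq (size fs) g) f = M%:R^-1 *: d.
  rewrite big_nseq iter_addr_0.
  rewrite -scaler_nat scalerA natrM invfM mulrCA mulfV ?mulr1 //.
  by rewrite pnatr_eq0 -lt0n.
have reach w : \sum_(f <- w) f = M%:R^-1 *: d ->
    last a (trail a (flatten (nseq M w))) = b.
  move=> sw; rewrite last_trail.
  have -> : \sum_(f <- flatten (nseq M w)) f = d.
    rewrite big_flatten big_nseq sw iter_addr_0.
    by rewrite -scaler_nat scalerA divff ?scale1r // gt_eqF.
  by rewrite addrC subrK.
have split_last w : size w = size fs -> \sum_(f <- w) f = M%:R^-1 *: d ->
    exists s, trail a (flatten (nseq M w)) = rcons s b.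
  move=> sw sumw; have := reach w sumw.
  case/lastP E : (trail a (flatten (nseq M w))) => [|s x].
    have := congr1 size E; rewrite size_scanl size_flatten /shape map_nseq sw.
    by rewrite sumn_nseq => /eqP; rewrite muln_eq0 /= eqn0Ngt fs0.
  by rewrite last_rcons => ->; exists s.
have [s sE] := split_last (nseq (size fs) g) (size_nseq _ _) sum_w.
have [s' s'E] := split_last u (size_map _ _) sum_u.
have cl : all2 (close c) (rcons s b) (rcons s' b).
  rewrite -sE -s'E.
  have suw : size (nseq (size fs) g) = size u by rewrite size_nseq /u size_map.
  have := trail_close a M suw (etrans sum_w (esym sum_u)).
  rewrite !all2E => /andP[-> /=]; apply: sub_all => -[x y] /=; rewrite /close => h.
  apply: (le_trans h); apply: le_trans SM.
  rewrite big_nseq iter_addr_0 /u big_map.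
  have -> : `|g| *+ size fs = `|d| / M%:R.
    rewrite /g normrZ ger0_norm ?invr_ge0 ?ler0n // -mulr_natl natrM invfM.
    by field; rewrite ?pnatr_eq0 -?lt0n ?fs0 ?gt_eqF.
  have -> : \sum_(f <- fs) `|M%:R^-1 *: f| = (\sum_(f <- fs) `|f|) / M%:R.
    rewrite mulr_suml; apply: eq_bigr => f _.
    by rewrite normrZ ger0_norm ?invr_ge0 ?ler0n // mulrC.
  by rewrite -mulrDl addrC.
exists s, s'; split.
- by move: cl; rewrite all2E !size_rcons eqSS => /andP[/eqP].
- exact: cl.
- move=> es; rewrite -sE flatten_nseq_nseq.
  have [n nE] : exists n, (M * size fs)%N = n.+1.
    by case: (M * size fs)%N Mr0 => [|n _]; [rewrite eqxx|exists n].
  rewrite nE; have [-> _] := subdivision a n es g0.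
  by rewrite nE in gE; rewrite gE addrC subrK.
- move=> sg sg0 asc; rewrite -sE -s'E; split; apply: path_trail => z f.
    rewrite flatten_nseq_nseq => /nseqP[-> _]; apply: height_ascends => //.
    split=> // i; rewrite mxE mulrCA mulr_ge0 ?invr_ge0 ?ler0n //.
    by case: asc.
  move=> /flattenP[w /nseqP[-> _] /mapP[h /fsP[i di ->] ->]].
  apply: height_ascends => //; apply: step_ascends asc.
  by exists i, M%:R^-1; split=> //; rewrite invr_gt0.
split.
  move=> e; rewrite -s'E => /dir_trail /flattenP[w /nseqP[-> _] /mapP[h /fsP[i di ->] ->]].
  by exists i, M%:R^-1; split=> //; rewrite invr_gt0.
exists M => // N Na Nb x i xs'.
have : x \in trail a (flatten (nseq M u)) by rewrite s'E mem_rcons inE xs' orbT.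
apply: (@trail_invariant _ (fun x => (N * M)%:R * x 0 i \in Num.int)); last first.
  by rewrite natrM mulrAC rpredM // natr_int.
move=> z f Pz /flattenP[w /nseqP[-> _] /mapP[h /fsP[j dj ->] ->]].
rewrite mxE mulrDr rpredD //.
have -> : (N * M)%:R * (M%:R^-1 *: part d j) 0 i =
    (N%:R * d 0 j) * (delta_mx 0 j : 'rV[R]_3) 0 i.
  by rewrite mxE /part mxE natrM -mulrA mulVKf ?mulrA // lt0r_neq0.
rewrite rpredM //; last by rewrite mxE; case: (_ && _); rewrite ?rpred0 ?rpred1.
by rewrite /d !mxE mulrBr rpredB.
Qed.

Definition agreeing (R : realType) (s : seq 'rV[R]_3) : Prop :=
  forall p, p \in edges (edges s) -> agree p.1 p.2.

Definition on_grid (R : realType) (N : nat) (s : seq 'rV[R]_3) : Prop :=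
  forall x i, x \in s -> N%:R * x 0 i \in Num.int.

Lemma agree_sym (R : realType) (e f : 'rV[R]_3 * 'rV[R]_3) :
  agree e f -> agree f e.
Proof. by move=> h i; rewrite mulrC; exact: h. Qed.

Lemma agree_step (R : realType) (d : 'rV[R]_3 * 'rV[R]_3) e f :
  agree d f -> step_of (dir d) (dir e) -> agree e f.
Proof.
move=> ag [i [c [di c0 eE]]] j; rewrite eE mxE part_coord.
case: eqVneq => [->|_]; last by rewrite mulr0 mul0r.
by rewrite -mulrA; apply: mulr_ge0; [exact: ltW|exact: ag].
Qed.

Lemma agree_steps (R : realType) (d : 'rV[R]_3 * 'rV[R]_3) e f :
  step_of (dir d) (dir e) -> step_of (dir d) (dir f) -> agree e f.
Proof.
move=> he hf; apply: agree_step he; apply: agree_sym; apply: agree_step hf.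
by move=> i; rewrite -expr2 sqr_ge0.
Qed.

Lemma mem_walk (T : eqType) (x : T) s p :
  p \in walk x s -> p.1 \in x :: s /\ p.2 \in s.
Proof.
elim: s x => [|y s IH] x //=; rewrite inE => /orP[/eqP ->|/IH[h1 h2]] /=.
  by split; rewrite !inE eqxx ?orbT.
split; first by rewrite h1 orbT.
by rewrite inE h2 orbT.
Qed.

(** The coordinates of a step of d are zero or have the sign of those of d, so
    whatever agrees with d agrees with its steps. *)
Lemma agreeing_refine (R : realType) (a b : 'rV[R]_3) s t :
  agreeing (a :: b :: t) ->
  (forall e, e \in walk a (rcons s b) -> step_of (dir (a, b)) (dir e)) ->
  agreeing (a :: s ++ b :: t).
Proof.
rewrite /agreeing (edges_cat a b [::]) (edges_cat a b s) /=.
have [e [E EE]] : exists e E, walk b (rcons t a) = e :: E.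
  by case: t => [|c t]; [exists (b, a), [::]|exists (b, c), (walk c (rcons t a))].
have [w [W WE]] : exists e E, walk a (rcons s b) = e :: E.
  by case: s => [|c s]; [exists (a, b), [::]|exists (a, c), (walk c (rcons s b))].
rewrite EE WE => ag st p; rewrite (edges_cat (a, b) e [::]) /= in ag.
rewrite (edges_cat w e W) mem_cat !walk_rcons !mem_rcons !inE.
rewrite walk_rcons /= in ag.
case/orP => /orP[/eqP ->|h].
- apply: (@agree_step _ (a, b)); last by apply: st; exact: mem_last.
  by apply: (ag ((a, b), e)); rewrite mem_head.
- have [h1 h2] := mem_walk h.
  by apply: (@agree_steps _ (a, b)); apply: st => //; rewrite inE h2 orbT.
- apply: agree_sym; apply: (@agree_step _ (a, b)); last by apply: st; exact: mem_head.
  apply: agree_sym; apply: (ag (last e E, (a, b))).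
  by rewrite inE mem_rcons mem_head orbT.
- by apply: ag; rewrite inE mem_rcons inE h !orbT.
Qed.

(** In a thin neighbourhood of the edge there are only its two neighbours.  Each
    of them lies in a common octant with the edge, and so does every step of the
    staircase; hence a height separates it from the moving part. *)
Lemma refine_edge (R : realType) (a b : 'rV[R]_3) t N :
  embedded (a :: b :: t) -> agreeing (a :: b :: t) -> on_grid N (a :: b :: t) ->
  (0 < N)%N ->
  exists s M, [/\ embedded (a :: s ++ b :: t),
    ambient_isotopic (carrier (a :: b :: t)) (carrier (a :: s ++ b :: t)),
    agreeing (a :: s ++ b :: t), (0 < M)%N /\ on_grid M (a :: s ++ b :: t) &
    forall e, e \in walk a (rcons s b) -> step_of (dir (a, b)) (dir e)].
Proof.
case: t => [|c t] [s2 sim] // ag grid N0.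
have edgE : edges (a :: b :: c :: t) = (a, b) :: (b, c) :: rcons (walk c t) (last c t, a).
  by rewrite edges_cons /walk /= -/(walk c _) walk_rcons.
have sim0 := sim; rewrite edgE in sim0.
set z := last c t in edgE sim0.
have /simple_cons[/= ab simE dab] := sim0.
have /simple_cons[/= bc simE' dbc] := simE.
have agab : agree (a, b) (b, c).
  by apply: (ag ((a, b), (b, c))); rewrite edgE edges_cons /walk /= mem_head.
have agza : agree (z, a) (a, b).
  apply: (ag ((z, a), (a, b))); rewrite edgE edges_cons walk_rcons mem_rcons.
  by rewrite /= last_rcons mem_head.
have za : z != a.
  by have [_ h _] := simE'; apply: (h (z, a)); rewrite mem_rcons mem_head.
have nz (x y : 'rV[R]_3) : x != y -> dir (x, y) != 0 by rewrite subr_eq0 eq_sym.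
have [eta eta0 far] : exists2 m, 0 < m & forall e u v, e \in walk c t -> 0 <= u <= 1 ->
    0 <= v <= 1 -> m <= `|segpt a b u - segpt e.1 e.2 v|.
  apply: segment_distance => e u v eE u01 v01; apply/eqP => same.
  have yE : cover (rcons (walk c t) (z, a)) (segpt e.1 e.2 v).
    rewrite -cats1; apply/cover_cat; have [h|->] := walk_closed eE v01; first by left.
    by right; apply/cover_cons; left; exact: (@halfopen_start _ (_, _)).
  case/andP: u01 => u0; rewrite le_eqVlt => /orP[/eqP u1|u1].
    rewrite u1 segpt1 in same; apply: (dbc b); first exact: (@halfopen_start _ (b, c)).
    by rewrite same.
  apply: (dab (segpt a b u)); first by exists u => //=; rewrite u0.
  by rewrite same; apply/cover_cons; right.
have eta2 : 0 < eta / 2 by rewrite divr_gt0.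
have [s [s' [ss cl cov rise [steps [M M0 int]]]]] := staircase ab eta2.
have mixE r : rcons (mix s s' r) b = mix (rcons s b) (rcons s' b) r.
  rewrite -!cats1 mix_cat //; congr (_ ++ [:: _]).
  by apply/rowP => k; rewrite !mxE; ring.
have aE r : a = segpt a a r by apply/rowP => k; rewrite !mxE; ring.
have [sg sg0 [asc1 asc2]] := agree_ascends agab (nz _ _ ab) (nz _ _ bc).
have [sg' sg'0 [asc1' asc2']] := agree_ascends agza (nz _ _ za) (nz _ _ ab).
have risem h r : (forall i, h i != 0) -> ascends h (b - a) -> 0 <= r <= 1 ->
    path (below (height h)) a (rcons (mix s s' r) b).
  move=> h0 asc r01; have [p1 p2] := rise h h0 asc.
  rewrite mixE (aE r); apply: rising_mix => //; first exact: height_affine.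
  by rewrite !size_rcons ss.
have [||r r01|emb iso] := @isotopic_replace _ a b s s' (c :: t) ss.
- by rewrite /= size_cat /= !addnS.
- rewrite rcons_cons /walk /= -/(walk c _) walk_rcons; exact: simE.
- split.
    by apply: simple_rising (risem sg r sg0 asc1 r01); exact: height_affine.
  move=> x xm; rewrite rcons_cons /walk /= -/(walk c _) walk_rcons -/z.
  case/cover_cons => [[u u01 /= xE]|].
    have hbc : height sg b < height sg c.
      by have := height_ascends b sg0 asc2; rewrite addrC subrK.
    have /andP[h1 _] := affine_convex (@height_affine _ sg) u01 hbc.
    have /andP[_] := cover_rising (@height_affine _ sg) (risem sg r sg0 asc1 r01) xm.
    by rewrite last_rcons -xE ltNge h1.
  rewrite -cats1 => /cover_cat[[e eE [u u01 xE]]|/cover_cons[[u u01 /= xE]|/cover_nil//]].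
    have [x' cx' xx'] : exists2 x', cover (walk a (rcons s b)) x' & `|x - x'| <= eta / 2.
      apply: (@cover_mix_close _ _ a a (rcons s b) (rcons s' b) r) => //.
        by rewrite /close subrr normr0 ltW.
      by rewrite -mixE -aE.
    have := cov [::]; rewrite cats0 => covE; rewrite covE in cx'.
    case/cover_cons: cx' => [[v v01 x'E]|/cover_nil//].
    have v01' : 0 <= v <= 1 by case/andP: v01 => -> /ltW ->.
    have u01' : 0 <= u <= 1 by case/andP: u01 => -> /ltW ->.
    have := far e v u eE v01' u01'; rewrite x'E xE distrC => h.
    by have := le_trans h xx'; lra.
  have hza : height sg' z < height sg' a.
    by have := height_ascends z sg'0 asc1'; rewrite addrC subrK.
  have /andP[_ h1] := affine_convex (@height_affine _ sg') u01 hza.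
  have /andP[h2 _] := cover_rising (@height_affine _ sg') (risem sg' r sg'0 asc2' r01) xm.
  by move: h1; rewrite xE ltNge h2.
exists s', (N * M)%N; split=> //.
- have -> : carrier (a :: b :: c :: t) = carrier (a :: s ++ b :: c :: t).
    by rewrite /carrier (edges_cat a b [::]) (edges_cat a b s) cov.
  exact: iso.
- exact: agreeing_refine.
- split; first by rewrite muln_gt0 N0.
  move=> x i; rewrite inE mem_cat => xs.
  have old : x \in a :: b :: c :: t -> (N * M)%:R * x 0 i \in Num.int.
    by move=> h; rewrite natrM mulrAC rpredM ?natr_int // grid.
  case/or3P: xs => h; [by apply: old; rewrite inE h| |by apply: old; rewrite inE h orbT].
  by apply: int => // j; apply: grid; rewrite !inE eqxx ?orbT.
Qed.

(** Induction on the number of bad edges, each of which can be brought to the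
    front by a rotation. *)
Lemma repair_edges (T : eqType) (bad : pred (T * T)) (P : seq T -> Prop) s :
  (forall k s, P s -> P (rot k s)) -> (forall s, P s -> (1 < size s)%N) ->
  (forall a b t, P (a :: b :: t) -> bad (a, b) ->
     exists s, P (a :: s ++ b :: t) /\ forall e, e \in walk a (rcons s b) -> ~~ bad e) ->
  P s -> exists s', P s' /\ forall e, e \in edges s' -> ~~ bad e.
Proof.
move=> Prot Psize Pstep.
have [n] := ubnP (count bad (edges s)); elim: n s => // n IH s; rewrite ltnS => sn Ps.
have [/hasP[e es be]|/hasPn h] := boolP (has bad (edges s)); last by exists s.
have [k [t rk]] := rot_edge es (Psize s Ps).
have Pk := Prot k s Ps; rewrite rk in Pk.
have bad_e : bad (e.1, e.2) by case: (e) be.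
have [u [Pu ok]] := Pstep _ _ _ Pk bad_e.
apply: (IH _ _ Pu); apply: leq_trans sn.
have -> : count bad (edges s) = count bad (edges (e.1 :: e.2 :: t)).
  by rewrite -rk edges_rot; apply/permP; rewrite perm_sym perm_rot.
rewrite (edges_cat e.1 e.2 u) (edges_cat e.1 e.2 [::]) !count_cat ltn_add2r.
rewrite /= bad_e addn0.
have /eqP -> : count bad (walk e.1 (rcons u e.2)) == 0%N by
  rewrite -leqn0 leqNgt -has_count; apply/hasPn.
by [].
Qed.

Definition axial (R : realType) (e : 'rV[R]_3 * 'rV[R]_3) : bool :=
  [exists i, dir e == part (dir e) i].

Lemma step_axial (R : realType) (d : 'rV[R]_3) e : step_of d (dir e) -> axial e.
Proof.
move=> [i [c [_ _ eE]]]; apply/existsP; exists i; rewrite eE; apply/eqP/rowP => j.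
by rewrite [in LHS]mxE !part_coord mxE part_coord eqxx; case: ifP; rewrite ?mulr0.
Qed.

Lemma isotopic_axial (R : realType) (s : seq 'rV[R]_3) :
  embedded s -> exists s' N, [/\ embedded s',
    ambient_isotopic (carrier s) (carrier s'), (0 < N)%N, on_grid N s' &
    forall e, e \in edges s' -> axial e].
Proof.
move=> emb.
have [s1 [emb1 iso1 ag1]] := isotopic_agreeing emb.
have [s2 [N [emb2 iso2 ag2 N0 grid2]]] := isotopic_rational emb1 ag1.
pose P u := [/\ embedded u, ambient_isotopic (carrier s) (carrier u), agreeing u &
  exists2 N, (0 < N)%N & on_grid N u].
have P2 : P s2.
  split=> //; first exact: ambient_isotopic_trans iso2.
  by exists N => // x i; exact: grid2.
have [|||s3 [[emb3 iso3 _ [M M0 grid3]] ok]] :=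
    @repair_edges _ (fun e => ~~ axial e) P s2 _ _ _ P2.
- move=> k u [e i ag [K K0 grid]]; split.
  + exact: embedded_rot.
  + by rewrite carrier_rot.
  + by move=> p; rewrite !edges_rot mem_rot; exact: ag.
  + by exists K => // x j; rewrite mem_rot; exact: grid.
- by move=> u [[u2 _] _ _ _]; exact: ltnW.
- move=> a b t [e i ag [K K0 grid]] _.
  have [u [K' [e' i' ag' [K'0 grid'] st]]] := refine_edge e ag grid K0.
  exists u; split; last by move=> f fu; rewrite negbK; exact: step_axial (st f fu).
  split=> //; first exact: ambient_isotopic_trans i'.
  by exists K'.
- exists s3, M; split=> // e es.
  by have := ok e es; rewrite negbK.
Qed.

(** * Lattice polygons *)

Lemma isotopic_map (R : realType) (f : 'rV[R]_3 -> 'rV[R]_3) s :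
  (2 < size s)%N ->
  (forall r, 0 <= r <= 1 -> simple (edges (map (fun x => segpt x (f x) r) s))) ->
  embedded (map f s) /\ ambient_isotopic (carrier s) (carrier (map f s)).
Proof.
move=> s2 sim.
have mixE r : mix s (map f s) r = map (fun x => segpt x (f x) r) s.
  by elim: s {s2 sim} => //= x s IH; congr (_ :: _).
split; last first.
  apply: isotopic_mix; rewrite ?size_map // => r r01.
  by rewrite mixE; exact: sim.
have one : 0 <= (1 : R) <= 1 by rewrite ler01 lexx.
split; first by rewrite size_map.
have := sim 1 one; congr (simple (edges _)).
by apply: eq_map => x; rewrite segpt1.
Qed.

Lemma simple_map (R : realType) (f : 'rV[R]_3 -> 'rV[R]_3)
    (es : seq ('rV[R]_3 * 'rV[R]_3)) :
  injective f ->
  (forall e y, e \in es -> halfopen (f e.1, f e.2) y ->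
     exists2 x, halfopen e x & y = f x) ->
  simple es -> simple [seq (f e.1, f e.2) | e <- es].
Proof.
move=> finj fh [u n d]; split.
- rewrite map_inj_uniq // => -[a b] [a' b'] [/finj -> /finj ->] //.
- move=> _ /mapP[e es' ->] /=; rewrite (inj_eq finj); exact: n.
- move=> _ _ y /mapP[e ees ->] /mapP[g ges ->] h h'.
  have [x ex yx] := fh e y ees h; have [x' gx yx'] := fh g y ges h'.
  have xx' : x = x' by apply: finj; rewrite -yx.
  by rewrite -xx' in gx; rewrite (d e g x).
Qed.

Definition affine_map (R : realType) (f : 'rV[R]_3 -> 'rV[R]_3) : Prop :=
  forall a b t, f (segpt a b t) = segpt (f a) (f b) t.

Lemma isotopic_affine_map (R : realType) (f : 'rV[R]_3 -> 'rV[R]_3) s :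
  affine_map f ->
  (forall r, 0 <= r <= 1 -> injective (fun x => segpt x (f x) r)) ->
  embedded s ->
  embedded (map f s) /\ ambient_isotopic (carrier s) (carrier (map f s)).
Proof.
move=> af inj [s2 sim]; apply: isotopic_map => // r r01.
rewrite edges_map.
apply: (@simple_map _ (fun x => segpt x (f x) r)) => //; first exact: inj.
move=> e y _ [t t01 <-]; exists (segpt e.1 e.2 t); first by exists t.
by rewrite /= af; apply/rowP => k; rewrite !mxE; ring.
Qed.

Definition lattice_multiple (R : realType) (L : lattice R)
    (e : 'rV[R]_3 * 'rV[R]_3) : Prop :=
  exists f n, (f \in lattice_directions L \/ - f \in lattice_directions L) /\
    dir e = n.+1%:R *: f.

Lemma lattice_polygonP (R : realType) (L : lattice R) (P : set 'rV[R]_3) :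
  lattice_polygon L P <-> exists s, [/\ embedded s, P = carrier s &
    forall e, e \in edges s -> lattice_edge L e.1 e.2].
Proof.
split=> [[n [v [n2 le nsi PE]]]|[s [[s2 sim] PE le]]].
  exists (codom v); split.
  - by split; [rewrite size_codom card_ord|apply/nsi_simple].
  - by rewrite PE path_carrier_cover.
  - by move=> e; rewrite edges_codom => /mapP[i _ ->]; exact: le.
exists (size s), (fun i : 'I_(size s) => nth 0 s i); split=> //.
- move=> i; apply: (le (nth 0 s i, nth 0 s (ordS i))).
  rewrite -[X in edges X](codom_nth (erefl (size s))).
  by rewrite edges_codom; apply/mapP; exists i; rewrite ?mem_enum.
- by apply/nsi_simple; rewrite codom_nth.
- by rewrite path_carrier_cover codom_nth.
Qed.

Lemma mem_edges (T : eqType) (s : seq T) e :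
  e \in edges s -> e.1 \in s /\ e.2 \in s.
Proof.
case: s => [|x s]; first by [].
rewrite edges_cons => /mem_walk[]; rewrite mem_rcons inE mem_rcons => h1 h2.
by split=> //; case/orP: h1 => // /eqP ->; rewrite mem_head.
Qed.

(** The long edges are cut at the lattice points on them. *)
Lemma lattice_polygon_of_multiples (R : realType) (L : lattice R) s :
  (forall x f, f \in lattice_directions L -> lattice_point L x ->
     lattice_point L (x + f) /\ lattice_point L (x - f)) ->
  embedded s -> (forall x, x \in s -> lattice_point L x) ->
  (forall e, e \in edges s -> lattice_multiple L e) ->
  lattice_polygon L (carrier s).
Proof.
move=> closedL emb pts mult.
pose P u := [/\ embedded u, carrier s = carrier u,
  forall x, x \in u -> lattice_point L x & forall e, e \in edges u -> lattice_multiple L e].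
have Ps : P s by split.
have [|||s' [[emb' car' _ _] ok]] :=
    @repair_edges _ (fun e => ~~ `[< lattice_edge L e.1 e.2 >]) P s _ _ _ Ps.
- move=> k u [e c p m]; split.
  + exact: embedded_rot.
  + by rewrite carrier_rot.
  + by move=> x; rewrite mem_rot; exact: p.
  + by move=> x; rewrite edges_rot mem_rot; exact: m.
- by move=> u [[u2 _] _ _ _]; exact: ltnW.
- move=> a b t [[t2 sim] c p m] _.
  have [f [n [fL dE]]] : lattice_multiple L (a, b).
    by apply: m; rewrite edges_cons mem_head.
  have stepL x : lattice_point L x -> lattice_point L (x + f).
    move=> Lx; case: fL => [fL|fL]; first by have [] := closedL x f fL Lx.
    by have [_] := closedL x (- f) fL Lx; rewrite opprK.
  have ab : a != b.
    by have [_ ne _] := sim; apply: (ne (a, b)); rewrite edges_cons mem_head.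
  have f0 : f != 0.
    by apply: contraNneq ab => f0; move/eqP: dE; rewrite f0 scaler0 subr_eq0 eq_sym.
  have bE : b = a + n.+1%:R *: f by rewrite -dE addrC subrK.
  case/lastP E : (trail a (nseq n.+1 f)) => [|u b'].
    by move: (congr1 size E); rewrite size_scanl size_nseq.
  have b'E : b' = b.
    have := last_trail a (nseq n.+1 f); rewrite E last_rcons => ->.
    by rewrite big_nseq iter_addr_0 -scaler_nat -bE.
  rewrite b'E in E.
  have [cov simp] := subdivision a n (walk b (rcons t a)) f0.
  rewrite -bE E in cov simp.
  have La : lattice_point L a by apply: p; rewrite mem_head.
  have ptsu x : x \in rcons u b -> lattice_point L x.
    rewrite -E; apply: (@trail_invariant _ (lattice_point L)) => // z g Lz.
    by rewrite mem_nseq => /andP[_ /eqP ->]; exact: stepL.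
  have diru e : e \in walk a (rcons u b) -> dir e = f.
    by rewrite -E => /dir_trail; rewrite mem_nseq => /andP[_ /eqP].
  exists u; split.
    have s2' : (2 < size (a :: u ++ b :: t))%N.
      by move: t2; rewrite /= size_cat /=; lia.
    split.
    + split=> //; rewrite (edges_cat a b u); apply: simp.
      by move: sim; rewrite (edges_cat a b [::]).
    + by rewrite c /carrier (edges_cat a b [::]) (edges_cat a b u) cov.
    + move=> x; rewrite inE mem_cat => /or3P[/eqP ->//|xu|xbt].
        by apply: ptsu; rewrite mem_rcons inE xu orbT.
      by apply: p; rewrite inE xbt orbT.
    + move=> e; rewrite (edges_cat a b u) mem_cat => /orP[h|h].
        by exists f, 0%N; rewrite scale1r; split=> //; exact: diru.
      by apply: m; rewrite (edges_cat a b [::]) mem_cat h orbT.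
  move=> e eu; rewrite negbK; apply/asboolP.
  have [e1 e2] := mem_walk eu.
  split.
  + by move: e1; rewrite inE => /orP[/eqP ->//|]; exact: ptsu.
  + exact: ptsu.
  + have := diru e eu; rewrite /dir => ->.
    by case: fL => fL; [exists f => //; left|exists (- f) => //; right; rewrite opprK].
apply/lattice_polygonP; exists s'; split=> // e es.
by have := ok e es; rewrite negbK => /asboolP.
Qed.

Lemma vec3_0 (R : realType) (a b c : R) : vec3 a b c 0 0 = a.
Proof. by rewrite mxE. Qed.
Lemma vec3_1 (R : realType) (a b c : R) : vec3 a b c 0 1 = b.
Proof. by rewrite mxE. Qed.
Lemma vec3_2 (R : realType) (a b c : R) : vec3 a b c 0 2 = c.
Proof. by rewrite mxE. Qed.

Lemma row3P (R : realType) (x y : 'rV[R]_3) :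
  x 0 0 = y 0 0 -> x 0 1 = y 0 1 -> x 0 2 = y 0 2 -> x = y.
Proof.
move=> h0 h1 h2; apply/rowP => -[[|[|[|//]]] lt3].
- by rewrite (_ : Ordinal lt3 = 0) //; exact: val_inj.
- by rewrite (_ : Ordinal lt3 = 1) //; exact: val_inj.
- by rewrite (_ : Ordinal lt3 = 2) //; exact: val_inj.
Qed.

Lemma cubic_directionP (R : realType) (d : 'rV[R]_3) :
  d \in lattice_directions (cubic_lattice R) <-> exists i, d = delta_mx 0 i.
Proof.
have e0 : vec3 1 0 0 = delta_mx 0 0 :> 'rV[R]_3 by apply: row3P; rewrite !mxE.
have e1 : vec3 0 1 0 = delta_mx 0 1 :> 'rV[R]_3 by apply: row3P; rewrite !mxE.
have e2 : vec3 0 0 1 = delta_mx 0 2 :> 'rV[R]_3 by apply: row3P; rewrite !mxE.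
rewrite /= !inE e0 e1 e2; split=> [/or3P[]/eqP ->|[[[|[|[|//]]] lt3] ->]].
- by exists 0.
- by exists 1.
- by exists 2.
- by rewrite (_ : Ordinal lt3 = 0) ?eqxx //; exact: val_inj.
- by rewrite (_ : Ordinal lt3 = 1) ?eqxx ?orbT //; exact: val_inj.
- by rewrite (_ : Ordinal lt3 = 2) ?eqxx ?orbT //; exact: val_inj.
Qed.

Lemma cubic_combination (R : realType) (a b c : int) :
  vec3 1 0 0 *~ a + vec3 0 1 0 *~ b + vec3 0 0 1 *~ c =
  vec3 a%:~R b%:~R c%:~R :> 'rV[R]_3.
Proof.
have coordD (x y : 'rV[R]_3) i : (x + y) 0 i = x 0 i + y 0 i by rewrite mxE.
have coordZ (x : 'rV[R]_3) (m : int) i : (x *~ m) 0 i = m%:~R * x 0 i.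
  by rewrite -scaler_int mxE.
apply: row3P; rewrite !coordD !coordZ.
- by rewrite !vec3_0 mulr1 !mulr0 !addr0.
- by rewrite !vec3_1 mulr1 !mulr0 add0r addr0.
- by rewrite !vec3_2 mulr1 !mulr0 !add0r.
Qed.

Lemma cubic_pointP (R : realType) (x : 'rV[R]_3) :
  lattice_point (cubic_lattice R) x <-> forall i, x 0 i \in Num.int.
Proof.
split=> [[a [b [c ->]]] i|h].
  rewrite cubic_combination mxE.
  by case: i => -[|[|[|//]]] lt3 /=; exact: intr_int.
have [a ea] := intrP (h 0); have [b eb] := intrP (h 1); have [c ec] := intrP (h 2).
exists a, b, c; rewrite cubic_combination.
by apply: row3P; rewrite ?vec3_0 ?vec3_1 ?vec3_2.
Qed.

Definition integral (R : realType) (s : seq 'rV[R]_3) : Prop :=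
  forall x i, x \in s -> x 0 i \in Num.int.

Lemma lattice_multiple_int (R : realType) (L : lattice R) d e (m : int) :
  d \in lattice_directions L -> m != 0 -> dir e = m%:~R *: d -> lattice_multiple L e.
Proof.
move=> dL; case: m => [[|n]|n] // _ eE.
  by exists d, n; split; [left|rewrite eE].
exists (- d), n; split; first by right; rewrite opprK.
by rewrite eE NegzE mulrNz scaleNr scalerN.
Qed.

Lemma dir_integral (R : realType) (s : seq 'rV[R]_3) e i :
  integral s -> e \in edges s -> dir e 0 i \in Num.int.
Proof.
by move=> ints /mem_edges[e1 e2]; rewrite !mxE rpredB ?ints.
Qed.

Lemma edge_dir_neq0 (R : realType) (s : seq 'rV[R]_3) e :
  embedded s -> e \in edges s -> dir e != 0.
Proof. by move=> [_ [_ ne _]] /ne; rewrite subr_eq0 eq_sym. Qed.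

Lemma cubic_multiple (R : realType) (s : seq 'rV[R]_3) e :
  embedded s -> integral s -> e \in edges s -> axial e ->
  lattice_multiple (cubic_lattice R) e.
Proof.
move=> emb ints es /existsP[i /eqP eE].
have [m mE] := intrP (dir_integral i ints es).
apply: (@lattice_multiple_int _ _ (delta_mx 0 i) _ m).
- by apply/cubic_directionP; exists i.
- apply: contraTneq (edge_dir_neq0 emb es) => m0.
  by rewrite eE /part mE m0 scale0r eqxx.
- by rewrite {1}eE /part mE.
Qed.

Lemma cubic_polygon_of_axial (R : realType) (s : seq 'rV[R]_3) :
  embedded s -> integral s -> (forall e, e \in edges s -> axial e) ->
  lattice_polygon (cubic_lattice R) (carrier s).
Proof.
move=> emb ints ax; apply: lattice_polygon_of_multiples => //.
- move=> x f /cubic_directionP[i ->] /cubic_pointP xint.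
  have dint j : (delta_mx 0 i : 'rV[R]_3) 0 j \in Num.int.
    by rewrite mxE; case: (_ && _); rewrite ?rpred1 ?rpred0.
  split; apply/cubic_pointP => j; first by rewrite mxE rpredD.
  by rewrite mxE [X in _ + X]mxE rpredB.
- by move=> x xs; apply/cubic_pointP => i; exact: ints.
- by move=> e es; exact: cubic_multiple emb ints es (ax e es).
Qed.

Lemma isotopic_integral (R : realType) (s : seq 'rV[R]_3) :
  embedded s -> exists s', [/\ embedded s',
    ambient_isotopic (carrier s) (carrier s'), integral s' &
    forall e, e \in edges s' -> axial e].
Proof.
move=> /isotopic_axial[u [N [emb iso N0 grid ax]]].
have N1 : (1 : R) <= N%:R by rewrite ler1n.
have [||emb' iso'] := @isotopic_affine_map _ (fun x => N%:R *: x) u _ _ emb.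
- by move=> a b t; apply/rowP => k; rewrite !mxE; ring.
- move=> r /andP[r0 r1] x y /rowP e; apply/rowP => k; have := e k; rewrite !mxE => h.
  have c0 : 1 - r + r * N%:R != 0.
    have h1 : r * 1 <= r * N%:R by rewrite ler_wpM2l.
    by apply: lt0r_neq0; lra.
  apply: (mulfI c0); move: h; rewrite !mulrDl -!mulrA => h; lra.
exists (map (fun x => N%:R *: x) u); split=> //.
- exact: ambient_isotopic_trans iso'.
- by move=> x i /mapP[y yu ->]; rewrite mxE grid.
- move=> e; rewrite edges_map => /mapP[f /ax /existsP[i /eqP fE] ->].
  apply/existsP; exists i; have -> : dir (N%:R *: f.1, N%:R *: f.2) = N%:R *: dir f.
    by rewrite /dir /= scalerBr.
  by rewrite /part mxE -scalerA -/(part (dir f) i) -fE.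
Qed.

(** * Sticks of a polygon that turns at each vertex *)

Definition turning (R : realType) (s : seq 'rV[R]_3) : Prop :=
  forall p c, p \in edges (edges s) -> dir p.2 <> c *: dir p.1.

(** Parallel consecutive edges point in the same direction, as the polygon does
    not turn back; the vertex between them is removed. *)
Lemma merge_collinear (R : realType) (s : seq 'rV[R]_3) :
  embedded s -> integral s -> (forall e, e \in edges s -> axial e) ->
  exists s', [/\ embedded s', carrier s' = carrier s, integral s',
    forall e, e \in edges s' -> axial e & turning s'].
Proof.
have [n] := ubnP (size s); elim: n s => // n IH s; rewrite ltnS => sn emb ints ax.
have [tu|] := pselect (turning s); first by exists s.
move=> /existsNP[p /existsNP[c /not_implyP[ps /contrapT pc]]].
have [k [a [v [b [t [rk pE]]]]]] := rot_turn ps emb.1.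
have embk := embedded_rot k emb; rewrite rk in embk.
have axk e : e \in edges (a :: v :: b :: t) -> axial e.
  by rewrite -rk edges_rot mem_rot; exact: ax.
have intk : integral (a :: v :: b :: t).
  by move=> x i; rewrite -rk mem_rot; exact: ints.
have edgE : edges (a :: v :: b :: t) = (a, v) :: (v, b) :: walk b (rcons t a).
  exact: (edges_cat a b [:: v]).
have [_ sim] := embk.
rewrite pE /dir /= in pc.
have c0 : 0 < c.
  rewrite ltNge; apply/negP => c0.
  have : (- c) *: (v - a) + 1 *: (b - v) != 0.
    apply: (simple_angle sim); rewrite ?edgE ?inE ?eqxx ?orbT ?oppr_ge0 //.
    by rewrite ltr_wpDl ?oppr_ge0.
  by rewrite pc scaleNr scale1r addNr eqxx.
have c1 : 0 < 1 + c by rewrite addr_gt0.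
have l01 : 0 < (1 + c)^-1 < 1 by rewrite invr_gt0 c1 invf_lt1 // ltrDl.
have bE : b = v + c *: (v - a) by rewrite -pc addrC subrK.
have vE : v = segpt a b (1 + c)^-1.
  apply/rowP => j; rewrite bE !mxE; field; exact: lt0r_neq0.
have av : a != v by have [_ ne _] := sim; apply: (ne (a, v)); rewrite edgE mem_head.
have dirab : dir (a, b) = (1 + c) *: dir (a, v).
  by apply/rowP => j; rewrite /dir /= bE !mxE; ring.
have ab : a != b.
  apply: contraNneq av => eab.
  have : dir (a, b) == 0 by rewrite /dir /= eab subrr.
  by rewrite dirab scaler_eq0 gt_eqF //= subr_eq0 eq_sym.
rewrite edgE in sim.
have sim' : simple ((a, b) :: walk b (rcons t a)).
  by apply/(simple_split _ ab l01); rewrite -vE.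
have t0 : (0 < size t)%N.
  case: t {rk axk intk pE embk edgE sim'} sim => // /simple_cons[_ /simple_cons[_ _ d] _].
  case: (d v); first exact: (@halfopen_start _ (v, b)).
  apply/cover_cons; left; exists (1 - (1 + c)^-1).
    by case/andP: l01 => h1 h2; rewrite /= subr_ge0 ltW // ltrBlDr ltrDl.
  by rewrite [RHS]vE; apply/rowP => j; rewrite !mxE /=; ring.
have edgE' : edges (a :: b :: t) = (a, b) :: walk b (rcons t a).
  exact: (edges_cat a b [::]).
have [|||| s' [emb' car' int' ax' tu']] := IH (a :: b :: t).
- apply: leq_trans sn; have := congr1 size rk; rewrite size_rot => -> /=.
  by rewrite ltnS.
- by split; [rewrite /= !ltnS|rewrite edgE'].
- move=> x i; rewrite inE => h; apply: intk; rewrite !inE.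
  by case/orP: h => [->//|h]; rewrite inE in h; rewrite h !orbT.
- move=> e; rewrite edgE' inE => /orP[/eqP ->|h].
    have /existsP[i /eqP fE] : axial (a, v) by apply: axk; rewrite edgE mem_head.
    apply/existsP; exists i; rewrite dirab.
    by rewrite /part mxE -scalerA -/(part (dir (a, v)) i) -fE.
  by apply: axk; rewrite edgE !inE h !orbT.
exists s'; split=> //; rewrite car' -(carrier_rot k s) rk /carrier edgE edgE'.
by rewrite -[LHS](cover_split _ _ _ l01) -vE.
Qed.

Lemma vertex_star (R : realType) (s : seq 'rV[R]_3) e f :
  embedded s -> (e, f) \in edges (edges s) ->
  e.2 = f.1 /\ exists2 m, 0 < m & forall x, carrier s x -> `|e.2 - x| < m ->
    halfopen e x \/ halfopen f x.
Proof.
move=> emb ps; have [k [a [v [b [t [rk [-> ->]]]]]]] := rot_turn ps emb.1.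
split=> //; have embk := embedded_rot k emb; rewrite rk in embk.
have [m m0 far] := vertex_distance embk.
exists m => // x; rewrite -(carrier_rot k s) rk /carrier (edges_cat a b [:: v]) /=.
move=> /cover_cons[|/cover_cons[]]; [by left|by right|].
move=> [g gE [u /andP[u0 u1] <-]]; rewrite ltNge far //.
by rewrite u0 ltW.
Qed.

Lemma edges_neighbours (T : eqType) (s : seq T) x :
  x \in s -> (exists y, (x, y) \in edges s) /\ (exists y, (y, x) \in edges s).
Proof.
move=> xs; have := rot_index xs; set k := index x s.
set t := _ ++ _ => rk.
have memE e : (e \in edges s) = (e \in walk x (rcons t x)).
  by rewrite -(mem_rot k) -edges_rot rk edges_cons.
split; last by exists (last x t); rewrite memE walk_rcons mem_rcons mem_head.
clear rk; case: t memE => [|y t] memE.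
  by exists x; rewrite memE mem_head.
by exists y; rewrite memE mem_head.
Qed.

(** A segment of the polygon cannot pass beyond the vertices of an edge that it
    shares an interval with, since the polygon turns there. *)
Lemma no_overrun (R : realType) (s : seq 'rV[R]_3) e c :
  embedded s -> turning s -> e \in edges s -> 0 < c ->
  ~ ((forall u, 1 < u < 1 + c -> carrier s (segpt e.1 e.2 u)) \/
     (forall u, - c < u < 0 -> carrier s (segpt e.1 e.2 u))).
Proof.
move=> emb tu es c0.
have [[f ef] [g ge]] := edges_neighbours es.
have [_ [_ ne _]] := emb.
have e0 := edge_dir_neq0 emb es.
have norm0 : 0 < `|dir e| + 1 by rewrite ltr_wpDl.
(* v is the amount by which the segment runs beyond the vertex *)
have small m : 0 < m -> exists2 v, 0 < v < c & v * `|dir e| < m.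
  move=> m0; exists (Order.min (c / 2) (m / (`|dir e| + 1))).
    rewrite lt_min !divr_gt0 //= gt_min; apply/orP; left; lra.
  apply: (@le_lt_trans _ _ (m / (`|dir e| + 1) * `|dir e|)).
    by rewrite ler_wpM2r // ge_min lexx orbT.
  by rewrite mulrAC ltr_pdivrMr // mulrDr mulr1 ltrDl.
have [[eE [m m0 star]] [gE [m' m'0 star']]] := (vertex_star emb ef, vertex_star emb ge).
have inE u : halfopen e (segpt e.1 e.2 u) -> 0 <= u < 1.
  by move=> [v v01 /(segpt_inj (ne e es)) <-].
move=> [over|under].
- have [v /andP[v0 vc] vm] := small m m0.
  have cx : carrier s (segpt e.1 e.2 (1 + v)).
    by apply: over; rewrite ltrDl v0 ltrD2l.
  have dE : e.2 - segpt e.1 e.2 (1 + v) = - (v *: dir e).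
    by apply/rowP => j; rewrite !mxE; ring.
  have := star _ cx; rewrite dE normrN normrZ gtr0_norm // => /(_ vm)[/inE|].
    by rewrite -subr_gt0 opprD addNKr oppr_gt0 ltNge (ltW v0) andbF.
  move=> [t /andP[t0 t1] tE].
  have tE' : t *: dir f = v *: dir e.
    apply/rowP => j; move/rowP: tE => /(_ j); rewrite /dir -eE !mxE => h; lra.
  have tn0 : t != 0.
    by apply: contraNneq e0 => t00; move/eqP: tE'; rewrite t00 scale0r eq_sym scaler_eq0 gt_eqF.
  apply: (tu (e, f) (v / t)) => //=.
  by rewrite mulrC -scalerA -tE' scalerA mulVf // scale1r.
- have [v /andP[v0 vc] vm] := small m' m'0.
  have cx : carrier s (segpt e.1 e.2 (- v)).
    by apply: under; rewrite ltrN2 vc oppr_lt0.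
  have dE : g.2 - segpt e.1 e.2 (- v) = v *: dir e.
    by rewrite gE; apply/rowP => j; rewrite !mxE; ring.
  have := star' _ cx; rewrite dE normrZ gtr0_norm // => /(_ vm)[|/inE]; last first.
    by rewrite leNgt oppr_lt0 v0.
  move=> [t /andP[t0 t1] tE].
  have tE' : (1 - t) *: dir g = v *: dir e.
    apply/rowP => j; move/rowP: tE => /(_ j); rewrite /dir gE !mxE => h; lra.
  apply: (tu (g, e) ((1 - t) / v)) => //=.
  by rewrite mulrC -scalerA tE' scalerA mulVf ?gt_eqF // scale1r.
Qed.

Lemma pigeonhole_edges (R : realType) (s : seq 'rV[R]_3) p q :
  segment p q `<=` carrier s ->
  exists e u v, [/\ e \in edges s, 0 <= u <= 1, 0 <= v <= 1, u != v &
    halfopen e (segpt p q u) /\ halfopen e (segpt p q v)].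
Proof.
move=> sub; pose n := size (edges s).
have n0 : (0 : R) < n.+1%:R by rewrite ltr0n.
pose u (k : 'I_n.+1) : R := k%:R / n.+1%:R.
have u01 k : 0 <= u k <= 1.
  by rewrite divr_ge0 ?ler0n //= ler_pdivrMr // mul1r ler_nat ltnW.
have ex k : exists e, e \in edges s /\ halfopen e (segpt p q (u k)).
  by have [|e es h] := sub (segpt p q (u k)); [exists (u k) => //; exact: u01|exists e].
have [f fP] := choice ex.
have [finj|] := boolP (injectiveb f).
  have : (size (codom f) <= size (edges s))%N.
    apply: uniq_leq_size; first exact: finj.
    by move=> _ /codomP[k ->]; have [] := fP k.
  by rewrite size_codom card_ord -/n ltnn.
move=> /injectivePn[k [l kl fkl]].
exists (f k), (u k), (u l); split; [by have [] := fP k|exact: u01|exact: u01| |].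
  apply: contraNneq kl => /(mulIf (invr_neq0 (lt0r_neq0 n0)))/eqP.
  by rewrite eqr_nat => /eqP kl; apply/eqP/val_inj.
by split; [have [] := fP k|rewrite fkl; have [] := fP l].
Qed.

(** Infinitely many points lie on finitely many edges, so some edge contains two
    points of the segment.  The segment then is on the line of this edge, and
    cannot leave the edge. *)
Lemma segment_in_edge (R : realType) (s : seq 'rV[R]_3) p q :
  embedded s -> turning s -> segment p q `<=` carrier s -> p != q ->
  exists2 e, e \in edges s & segment p q `<=` segment e.1 e.2.
Proof.
move=> emb tu sub pq.
have [e [u [v [es u01 v01 uv [[a /andP[a0 a1] aE] [b /andP[b0 b1] bE]]]]]] := pigeonhole_edges sub.
exists e => //.
have vu : v - u != 0 by rewrite subr_eq0 eq_sym.
have ab : b - a != 0.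
  apply: contraNneq uv => /eqP; rewrite subr_eq0 => /eqP ba.
  by apply/eqP; apply: (segpt_inj pq); rewrite -aE -bE ba.
(* h w is the position on the line of e of the point w of the segment *)
pose h w := a + (w - u) / (v - u) * (b - a).
have hE w : segpt p q w = segpt e.1 e.2 (h w).
  have -> : segpt p q w = segpt (segpt p q u) (segpt p q v) ((w - u) / (v - u)).
    by apply/rowP => j; rewrite !mxE; field.
  by rewrite -aE -bE /h; apply/rowP => j; rewrite !mxE; ring.
have onto w x : 0 <= x <= 1 -> (a < w < h x) \/ (h x < w < a) ->
    carrier s (segpt e.1 e.2 w).
  move=> /andP[x0 x1] hw; pose l := (w - a) / (h x - a).
  have [hn l0 l1] : [/\ h x - a != 0, 0 <= l & l <= 1].
    case: hw => /andP[w1 w2].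
      have d0 : 0 < h x - a by rewrite subr_gt0 (lt_trans w1).
      split; first by rewrite gt_eqF.
        by rewrite divr_ge0 // ltW // subr_gt0.
      by rewrite /l ler_pdivrMr // mul1r lerD2r ltW.
    have d0 : 0 < a - h x by rewrite subr_gt0 (lt_trans w1).
    have lE : l = (a - w) / (a - h x).
      by rewrite /l -opprB -[h x - a]opprB invrN mulrNN.
    split; first by rewrite -oppr_eq0 opprB gt_eqF.
      by rewrite lE divr_ge0 // ltW // subr_gt0.
    by rewrite lE ler_pdivrMr // mul1r lerD2l lerN2 ltW.
  have wE : w = h (u + l * (x - u)).
    have -> : h (u + l * (x - u)) = a + l * (h x - a) by rewrite /h; field.
    by rewrite /l divfK // addrC subrK.
  rewrite wE -hE; apply: sub; exists (u + l * (x - u)) => //=.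
  case/andP: u01 => u0 u1.
  have h1 : 0 <= l * x by rewrite mulr_ge0.
  have h2 : 0 <= (1 - l) * u by rewrite mulr_ge0 // subr_ge0.
  have h3 : l * x <= l * 1 by rewrite ler_wpM2l.
  have h4 : (1 - l) * u <= (1 - l) * 1 by rewrite ler_wpM2l // subr_ge0.
  by apply/andP; split; lra.
move=> _ [w w01 <-]; rewrite hE; exists (h w) => //=.
apply/andP; split; rewrite leNgt; apply/negP => hw.
- apply: (no_overrun emb tu es (_ : 0 < - h w)); first by rewrite oppr_gt0.
  right=> x; rewrite opprK => /andP[x0 x1]; apply: (onto _ w w01); right.
  by rewrite x0 (lt_le_trans x1).
- apply: (no_overrun emb tu es (_ : 0 < h w - 1)); first by rewrite subr_gt0.
  left=> x; rewrite addrC subrK => /andP[x0 x1]; apply: (onto _ w w01); left.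
  by rewrite x1 (lt_trans a1).
Qed.

Lemma edge_in_carrier (R : realType) (s : seq 'rV[R]_3) e :
  embedded s -> e \in edges s -> segment e.1 e.2 `<=` carrier s.
Proof.
move=> emb es _ [u /= /andP[u0 u1] <-].
have [[f ef] _] := edges_neighbours es.
have [eE _] := vertex_star emb ef; have [_ /= fs] := mem_edges ef.
move: u1; rewrite le_eqVlt => /orP[/eqP ->|u1].
  by rewrite segpt1; exists f => //; rewrite eE; exact: halfopen_start.
by exists e => //; exists u => //=; rewrite u0.
Qed.

Lemma edge_segment_inj (R : realType) (s : seq 'rV[R]_3) e f :
  embedded s -> e \in edges s -> f \in edges s ->
  segment e.1 e.2 `<=` segment f.1 f.2 -> e = f.
Proof.
move=> [_ [_ ne d]] es fs sub.
have half : 0 <= (2^-1 : R) < 1.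
  by rewrite invr_ge0 ler0n /= invf_lt1 ?ltr0n // ltr1n.
have into u : 0 <= u < 1 -> segpt e.1 e.2 u != f.2 -> e = f.
  move=> u01 nf; apply: (d e f (segpt e.1 e.2 u)) => //; first by exists u.
  have [|v /= /andP[v0 v1] vE] := sub (segpt e.1 e.2 u).
    by exists u => //=; case/andP: u01 => -> /ltW.
  rewrite -vE; exists v => //=; rewrite v0 lt_neqAle v1 andbT.
  by apply: contraNneq nf => v1'; rewrite -vE v1' segpt1.
have [e0|] := eqVneq (segpt e.1 e.2 0) f.2; last first.
  by apply: into; rewrite lexx ltr01.
apply: (into 2^-1 half); rewrite -e0; apply/eqP => /(segpt_inj (ne e es))/eqP.
by rewrite invr_eq0 pnatr_eq0.
Qed.

Lemma segment_sym (R : realType) (a b : 'rV[R]_3) : segment a b = segment b a.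
Proof.
have half (x y : 'rV[R]_3) : segment x y `<=` segment y x.
  move=> _ [u /= /andP[u0 u1] <-]; exists (1 - u).
    by apply/andP => /=; split; lra.
  by rewrite /segpt subKr addrC.
by apply/seteqP.
Qed.

(** A stick lies in an edge by [segment_in_edge], and the edge is itself a segment
    in a lattice direction; by maximality they are equal. *)
Lemma has_sticks_turning (R : realType) (L : lattice R) s :
  (forall d, d \in lattice_directions L -> d != 0) ->
  embedded s -> turning s ->
  (forall e, e \in edges s ->
     exists d r, d \in lattice_directions L /\ dir e = r *: d) ->
  has_sticks L (carrier s) (size s).
Proof.
move=> L0 emb tu along.
have directed e : e \in edges s -> directed_segment L (segment e.1 e.2).
  move=> es; have [d [r [dL eE]]] := along e es.
  have bE : e.2 = e.1 + r *: d by rewrite -eE addrC subrK.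
  have [r0|r0|r0] := ltrgtP r 0.
  - exists e.2, d, (- r); split=> //; first by rewrite oppr_gt0.
    by rewrite segment_sym scaleNr {3}bE addrK.
  - by exists e.1, d, r; split=> //; rewrite -bE.
  - by have := edge_dir_neq0 emb es; rewrite eE r0 scale0r eqxx.
have sticksE : sticks L (carrier s) =
    (fun k => segment (nth (0, 0) (edges s) k).1 (nth (0, 0) (edges s) k).2) @`
      `I_(size s).
  apply/seteqP; split=> [S [[a [d [r [dL r0 SE]]]] sub maxS]|_ [k /= ks <-]].
    have pq : a != a + r *: d.
      rewrite -subr_eq0 opprD addrA subrr sub0r oppr_eq0 scaler_eq0 gt_eqF //=.
      exact: L0.
    have [e es subE] : exists2 e, e \in edges s & S `<=` segment e.1 e.2.
      by rewrite SE; apply: segment_in_edge => //; rewrite -SE.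
    exists (index e (edges s)); first by rewrite /= -size_edges index_mem.
    by rewrite nth_index //; apply: maxS => //; [exact: directed|exact: edge_in_carrier].
  have es : nth (0, 0) (edges s) k \in edges s by rewrite mem_nth // size_edges.
  set e := nth _ _ _ in es *.
  split; [exact: directed|exact: edge_in_carrier|].
  move=> S' [a [d [r [dL r0 SE]]]] sub eS.
  have pq : a != a + r *: d.
    rewrite -subr_eq0 opprD addrA subrr sub0r oppr_eq0 scaler_eq0 gt_eqF //=.
    exact: L0.
  have [f fs subF] : exists2 f, f \in edges s & S' `<=` segment f.1 f.2.
    by rewrite SE; apply: segment_in_edge => //; rewrite -SE.
  have ef : e = f by apply: (edge_segment_inj emb es fs) => x /eS/subF.
  by apply/seteqP; split; rewrite // ef.
rewrite /has_sticks sticksE; apply: inj_card_eq.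
move=> k l; rewrite !inE /= => ks ls kl.
have [_ [u _ _]] := emb.
have mem i : (i < size s)%N -> nth (0, 0) (edges s) i \in edges s.
  by move=> h; rewrite mem_nth // size_edges.
apply/eqP; rewrite -(nth_uniq (0, 0) _ _ u) ?size_edges //; apply/eqP.
by apply: (edge_segment_inj emb (mem k ks) (mem l ls)); rewrite kl.
Qed.

Lemma has_sticks_unique (R : realType) (L : lattice R) P k l :
  has_sticks L P k -> has_sticks L P l -> k = l.
Proof.
rewrite /has_sticks => Pk; rewrite card_eq_sym => Pl.
by apply/esym/card_eq_II; exact: card_eq_trans Pl Pk.
Qed.

(** * Stretching the coordinates and cutting a right angle *)

(** The interval from c to c + 1 is dilated by the factor 1 + L, and what follows
    it is translated. *)
Definition stretch1 (R : realType) (c L x : R) : R :=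
  x + L * Num.max 0 (Num.min 1 (x - c)).

Lemma stretch1_left (R : realType) (c L x : R) : x <= c -> stretch1 c L x = x.
Proof.
move=> xc; rewrite /stretch1 max_l ?mulr0 ?addr0 //.
by rewrite ge_min subr_le0 xc orbT.
Qed.

Lemma stretch1_right (R : realType) (c L x : R) :
  c + 1 <= x -> stretch1 c L x = x + L.
Proof.
move=> xc; have h : 1 <= x - c by lra.
by rewrite /stretch1 min_l // max_r ?ler01 // mulr1.
Qed.

Lemma stretch1_mid (R : realType) (c L x : R) :
  c <= x <= c + 1 -> stretch1 c L x = x + L * (x - c).
Proof.
move=> /andP[x0 x1]; have h : x - c <= 1 by lra.
by rewrite /stretch1 min_r // max_r // subr_ge0.
Qed.

Lemma stretch1_lt (R : realType) (c L x y : R) :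
  0 <= L -> x < y -> stretch1 c L x < stretch1 c L y.
Proof.
move=> L0 xy; apply: ltr_leD => //; rewrite ler_wpM2l //.
have h : x - c <= y - c by rewrite lerD2r ltW.
by rewrite ge_max le_max lexx /= le_max le_min !ge_min lexx h !orbT.
Qed.

Lemma stretch1_inj (R : realType) (c L : R) :
  0 <= L -> injective (stretch1 c L).
Proof.
move=> L0 x y e; have [xy|xy|//] := ltgtP x y.
  by have := stretch1_lt c L0 xy; rewrite e ltxx.
by have := stretch1_lt c L0 xy; rewrite e ltxx.
Qed.

Lemma stretch1_onto (R : realType) (c L y : R) :
  0 <= L -> exists x, stretch1 c L x = y.
Proof.
move=> L0; have L1 : 0 < 1 + L by lra.
have [yc|cy] := leP y c; first by exists y; rewrite stretch1_left.
have [yc|cy'] := leP (c + 1 + L) y.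
  by exists (y - L); rewrite stretch1_right ?subrK // lerBrDr.
exists (c + (y - c) / (1 + L)); rewrite stretch1_mid.
  by field; exact: lt0r_neq0.
rewrite lerDl divr_ge0 ?subr_ge0 ?(ltW cy) ?(ltW L1) //=.
by rewrite lerD2l ler_pdivrMr // mul1r; lra.
Qed.

Definition stretch (R : realType) (c L : 'I_3 -> R) (x : 'rV[R]_3) : 'rV[R]_3 :=
  \row_i stretch1 (c i) (L i) (x 0 i).

Lemma stretch_segpt (R : realType) (c L : 'I_3 -> R) (x : 'rV[R]_3) r :
  segpt x (stretch c L x) r = stretch c (fun i => r * L i) x.
Proof. by apply/rowP => i; rewrite !mxE /stretch1; ring. Qed.

Lemma stretch_inj (R : realType) (c L : 'I_3 -> R) :
  (forall i, 0 <= L i) -> injective (stretch c L).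
Proof.
move=> L0 x y /rowP e; apply/rowP => i.
by have := e i; rewrite !mxE; apply: stretch1_inj.
Qed.

Lemma axial_coord (R : realType) (e : 'rV[R]_3 * 'rV[R]_3) i j :
  dir e = part (dir e) i -> j != i -> e.2 0 j = e.1 0 j.
Proof.
move=> eE ji; have : dir e 0 j = 0 by rewrite eE part_coord (negbTE ji).
by rewrite !mxE => h; apply/eqP; rewrite -subr_eq0; apply/eqP.
Qed.

(** An axis-parallel edge is mapped onto the edge between the images of its
    ends, because a stretching acts on each coordinate separately. *)
Lemma stretch_edge (R : realType) (c L : 'I_3 -> R) e y :
  (forall i, 0 <= L i) -> axial e ->
  halfopen (stretch c L e.1, stretch c L e.2) y ->
  exists2 x, halfopen e x & y = stretch c L x.
Proof.
move=> L0 /existsP[i /eqP eE] [t /= /andP[t0 t1] yE].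
have [x xE] := stretch1_onto (c i) (y 0 i) (L0 i).
pose p := e.1 0 i; pose q := e.2 0 i.
have yi : y 0 i = (1 - t) * stretch1 (c i) (L i) p + t * stretch1 (c i) (L i) q.
  by rewrite -yE !mxE.
have mono u w : u < w -> stretch1 (c i) (L i) u < stretch1 (c i) (L i) w.
  exact: stretch1_lt.
have [u u01 uE] : exists2 u, 0 <= u < 1 & x = (1 - u) * p + u * q.
  have [pq|qp|pq] := ltgtP p q.
  - have dq : 0 < q - p by rewrite subr_gt0.
    have h := mono _ _ pq; set P := stretch1 _ _ p in yi h; set Q := stretch1 _ _ q in yi h.
    have h1 : 0 <= t * (Q - P) by rewrite mulr_ge0 // subr_ge0 ltW.
    have h2 : t * (Q - P) < Q - P by rewrite gtr_pMl // subr_gt0.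
    have px : p <= x.
      by rewrite leNgt; apply/negP => /mono; rewrite xE yi -/P; lra.
    have xq : x < q.
      have [//|] := ltP x q; rewrite le_eqVlt => /orP[/eqP qx|/mono].
        by move: xE; rewrite yi -qx -/Q; lra.
      by rewrite xE yi -/Q; lra.
    exists ((x - p) / (q - p)); last by field; exact: lt0r_neq0.
    by rewrite divr_ge0 ?subr_ge0 ?(ltW pq) //= ltr_pdivrMr // mul1r ltrD2r.
  - have dq : 0 < p - q by rewrite subr_gt0.
    have h := mono _ _ qp; set P := stretch1 _ _ p in yi h; set Q := stretch1 _ _ q in yi h.
    have h1 : 0 <= t * (P - Q) by rewrite mulr_ge0 // subr_ge0 ltW.
    have h2 : t * (P - Q) < P - Q by rewrite gtr_pMl // subr_gt0.
    have px : x <= p.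
      by rewrite leNgt; apply/negP => /mono; rewrite xE yi -/P; lra.
    have xq : q < x.
      have [//|] := ltP q x; rewrite le_eqVlt => /orP[/eqP qx|/mono].
        by move: xE; rewrite yi qx -/Q; lra.
      by rewrite xE yi -/Q; lra.
    exists ((p - x) / (p - q)); last by field; exact: lt0r_neq0.
    by rewrite divr_ge0 ?subr_ge0 ?(ltW qp) //= ltr_pdivrMr // mul1r ltrD2l ltrN2.
  - exists 0; first by rewrite lexx ltr01.
    apply: (stretch1_inj (c := c i) (L0 i)); rewrite xE yi -pq subr0 mul1r mul0r addr0.
    by ring.
exists (segpt e.1 e.2 u); first by exists u.
apply/rowP => j; have [->|ji] := eqVneq j i; first by rewrite [RHS]mxE segpt_coord -uE.
rewrite -yE segpt_coord !mxE (axial_coord eE ji).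
have h z : (1 - u) * z + u * z = z by ring.
by rewrite h; ring.
Qed.

(** The intermediate stages of the motion are stretchings as well. *)
Lemma isotopic_stretch (R : realType) (c L : 'I_3 -> R) s :
  (forall i, 0 <= L i) -> embedded s -> (forall e, e \in edges s -> axial e) ->
  embedded (map (stretch c L) s) /\
  ambient_isotopic (carrier s) (carrier (map (stretch c L) s)).
Proof.
move=> L0 [s2 sim] ax; apply: isotopic_map => // r /andP[r0 r1].
have L0' i : 0 <= r * L i by rewrite mulr_ge0.
under eq_map do rewrite stretch_segpt.
rewrite edges_map; apply: simple_map => //; first exact: stretch_inj.
by move=> e y es; apply: stretch_edge => //; exact: ax.
Qed.

(** An edge parallel to another axis would have its ends in the strip too, so the
    edge is perpendicular to the strip and reaches both of its sides.  The near
    side is z, and k scales (and orients) the depth in the strip. *)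
Lemma cross_strip (R : realType) (e : 'rV[R]_3 * 'rV[R]_3) x i (z k g : R) :
  axial e -> halfopen e x -> 0 < (x 0 i - z) * k < g ->
  ~ 0 < (e.1 0 i - z) * k < g -> ~ 0 < (e.2 0 i - z) * k < g ->
  exists2 u, 0 <= u <= 1 & segpt e.1 e.2 u 0 i = z /\
    forall j, j != i -> segpt e.1 e.2 u 0 j = x 0 j.
Proof.
move=> /existsP[m /eqP eE] [t /= /andP[t0 t1] xE] /andP[x0 xg] e1 e2.
have xi : x 0 i = (1 - t) * e.1 0 i + t * e.2 0 i by rewrite -xE segpt_coord.
have im : i = m.
  apply/eqP; apply: contraT => im; case: e1; rewrite -(_ : x 0 i = e.1 0 i) ?x0 //.
  by rewrite xi (axial_coord eE im); ring.
set P := (e.1 0 i - z) * k in e1; set Q := (e.2 0 i - z) * k in e2.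
have xPQ : (x 0 i - z) * k = (1 - t) * P + t * Q by rewrite xi /P /Q; ring.
have k0 : k != 0 by apply: contraTneq x0 => ->; rewrite mulr0 ltxx.
have sides : (P <= 0 /\ 0 < Q) \/ (Q <= 0 /\ 0 < P).
  have [P0|P0] := leP P 0; [left|right]; split=> //.
    rewrite ltNge; apply/negP => Q0.
    have h1 : (1 - t) * P <= 0 by rewrite mulr_ge0_le0 // subr_ge0 ltW.
    have h2 : t * Q <= 0 by rewrite mulr_ge0_le0.
    by move: x0; rewrite xPQ; lra.
  have Pg : g <= P by rewrite leNgt; apply/negP => h; apply: e1; rewrite P0.
  rewrite leNgt; apply/negP => Q0.
  have Qg : g <= Q by rewrite leNgt; apply/negP => h; apply: e2; rewrite Q0.
  have h1 : (1 - t) * g <= (1 - t) * P by rewrite ler_wpM2l // subr_ge0 ltW.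
  have h2 : t * g <= t * Q by rewrite ler_wpM2l.
  by move: xg; rewrite xPQ; lra.
have PQ : P - Q != 0 by apply/eqP => h; case: sides => -[]; lra.
exists (P / (P - Q)).
  case: sides => -[h1 h2].
    have -> : P / (P - Q) = (- P) / (Q - P) by rewrite -mulrNN -invrN opprB.
    have d : 0 < Q - P by lra.
    by rewrite divr_ge0 ?oppr_ge0 ?(ltW d) //= ler_pdivrMr // mul1r; lra.
  have d : 0 < P - Q by lra.
  by rewrite divr_ge0 ?(ltW d) ?(ltW h2) //= ler_pdivrMr // mul1r; lra.
split.
  apply: (mulIf k0); rewrite segpt_coord.
  apply: (addIr (- (z * k))); rewrite subrr -mulrBl.
  have -> : ((1 - P / (P - Q)) * e.1 0 i + P / (P - Q) * e.2 0 i - z) * k =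
    (1 - P / (P - Q)) * P + P / (P - Q) * Q by rewrite /P /Q; ring.
  by field.
move=> j ji; rewrite -xE !segpt_coord (axial_coord eE); last by rewrite -im.
ring.
Qed.

(** A point of the cut triangle is close to one of the two legs, within the
    strip along this leg that contains no vertex; an edge through this point
    would cross the strip and hit the leg. *)
Lemma cut_right_angle (R : realType) (a v b : 'rV[R]_3) t i j g1 g2 :
  embedded (a :: v :: b :: t) -> (0 < size t)%N -> i != j ->
  dir (a, v) = part (dir (a, v)) i -> dir (v, b) = part (dir (v, b)) j ->
  1 < g1 + g2 ->
  (forall x, x \in a :: v :: b :: t -> ~ 0 < (x 0 i - v 0 i) * - (dir (a, v) 0 i)^-1 < g1) ->
  (forall x, x \in a :: v :: b :: t -> ~ 0 < (x 0 j - v 0 j) * (dir (v, b) 0 j)^-1 < g2) ->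
  (forall e, e \in walk b (rcons t a) -> axial e) ->
  embedded (a :: b :: t) /\
  ambient_isotopic (carrier (a :: v :: b :: t)) (carrier (a :: b :: t)).
Proof.
move=> emb t0 ij; set A := dir (a, v); set B := dir (v, b) => AE BE g12 gap1 gap2 ax.
have edgE : edges (a :: v :: b :: t) = (a, v) :: (v, b) :: walk b (rcons t a).
  exact: (edges_cat a b [:: v]).
have A0 : A != 0 by apply: (edge_dir_neq0 emb); rewrite edgE mem_head.
have B0 : B != 0 by apply: (edge_dir_neq0 emb); rewrite edgE !inE eqxx orbT.
have vA : v = a + A by rewrite /A /dir /= addrC subrK.
have bB : b = v + B by rewrite /B /dir /= addrC subrK.
clearbody A B.
have Ai : A 0 i != 0 by apply: contraNneq A0 => h; rewrite AE /part h scale0r.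
have Bj : B 0 j != 0 by apply: contraNneq B0 => h; rewrite BE /part h scale0r.
have Am m : m != i -> A 0 m = 0 by move=> mi; rewrite AE part_coord (negbTE mi).
have Bm m : m != j -> B 0 m = 0 by move=> mj; rewrite BE part_coord (negbTE mj).
have [_ sim] := emb; move: sim; rewrite edgE.
move=> /simple_cons[/= _ /simple_cons[/= _ _ dvb] dav].
have coordD (x y : 'rV[R]_3) k : (x + y) 0 k = x 0 k + y 0 k by rewrite mxE.
have coordZ (x : 'rV[R]_3) (m : R) k : (m *: x) 0 k = m * x 0 k by rewrite mxE.
pose l (x : 'rV[R]_3) := A 0 i * x 0 i + B 0 j * x 0 j.
have sq (x : R) : x != 0 -> 0 < x * x by move=> x0; rewrite -expr2 exprn_even_gt0.
apply: (@cut_corner _ a v b t l) => //.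
- by move=> x y u; rewrite /l !segpt_coord; ring.
- rewrite /l vA !coordD (Am j) 1?eq_sym //.
  by have := sq _ Ai; lra.
- rewrite /l bB !coordD (Bm i) //.
  by have := sq _ Bj; lra.
move=> r x /andP[r0 r1] v' xin [e eE ex].
(* X and Y are the affine coordinates of x in the triangle, along the legs *)
have [X [Y [X0 Y0 Y1 XY xE]]] : exists X Y, [/\ 0 <= X, 0 <= Y, Y < 1, X + Y <= 1 &
    x = v + (- X) *: A + Y *: B].
  have v'E : v' = v + (- (r / 2)) *: A + (r / 2) *: B.
    by rewrite /v' bB vA; apply/rowP => k; rewrite segpt_coord segpt_coord !coordD !coordZ; field.
  case: xin => -[u /= /andP[u0 u1] uE].
    have h1 : 0 <= u * r by rewrite mulr_ge0.
    have h2 : u * r <= u * 1 by rewrite ler_wpM2l.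
    exists ((1 - u) + u * r / 2), (u * r / 2); split; [lra|lra|lra|lra|].
    by rewrite -uE v'E vA; apply/rowP => k; rewrite segpt_coord !coordD !coordZ; ring.
  have h1 : 0 <= (1 - u) * r by rewrite mulr_ge0 // subr_ge0 ltW.
  have h2 : (1 - u) * r <= (1 - u) * 1 by rewrite ler_wpM2l // subr_ge0 ltW.
  exists ((1 - u) * r / 2), ((1 - u) * r / 2 + u); split; [lra|lra|lra|lra|].
  by rewrite -uE v'E bB; apply/rowP => k; rewrite segpt_coord !coordD !coordZ; ring.
have onA w : 0 < w <= 1 -> halfopen (a, v) (v + (- w) *: A).
  move=> /andP[w0 w1]; exists (1 - w) => /=; first by apply/andP; split; lra.
  by rewrite vA; apply/rowP => k; rewrite segpt_coord !coordD !coordZ; ring.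
have onB w : 0 <= w < 1 -> halfopen (v, b) (v + w *: B).
  move=> w01; exists w => //=.
  by rewrite bB; apply/rowP => k; rewrite segpt_coord !coordD !coordZ; ring.
have offA w : 0 < w <= 1 -> ~ cover (walk b (rcons t a)) (v + (- w) *: A).
  move=> /onA h h'; apply: (dav _ h).
  by apply/cover_cons; right.
have offB w : 0 <= w < 1 -> ~ cover (walk b (rcons t a)) (v + w *: B).
  by move=> /onB h h'; apply: (dvb _ h).
have [Yz|Yn] := eqVneq Y 0.
  have xA : x = v + (- X) *: A by rewrite xE Yz scale0r addr0.
  have [Xz|Xn] := eqVneq X 0.
    apply: (offB 0); rewrite ?lexx ?ltr01 //; exists e => //.
    by rewrite scale0r addr0; move: ex; rewrite xA Xz oppr0 scale0r addr0.
  apply: (offA X); last by exists e => //; rewrite -xA.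
  by rewrite lt_neqAle eq_sym Xn X0 /=; lra.
have [Xz|Xn] := eqVneq X 0.
  apply: (offB Y); first by rewrite Y0.
  by exists e => //; move: ex; rewrite xE Xz oppr0 scale0r addr0.
have Xp : 0 < X by rewrite lt_neqAle eq_sym Xn.
have Yp : 0 < Y by rewrite lt_neqAle eq_sym Yn.
have [e1 e2] : e.1 \in a :: v :: b :: t /\ e.2 \in a :: v :: b :: t.
  by apply: mem_edges; rewrite edgE !inE eE !orbT.
have xi : (x 0 i - v 0 i) * - (A 0 i)^-1 = X.
  by rewrite xE !coordD !coordZ (Bm i) //; field.
have xj : (x 0 j - v 0 j) * (B 0 j)^-1 = Y.
  by rewrite xE !coordD !coordZ (Am j) 1?eq_sym //; field.
have [Xg|Xg] := ltP X g1.
  have xin1 : 0 < (x 0 i - v 0 i) * - (A 0 i)^-1 < g1 by rewrite xi Xp.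
  have [u u01 [yi ym]] := cross_strip (ax e eE) ex xin1 (gap1 _ e1) (gap1 _ e2).
  have yE : segpt e.1 e.2 u = v + Y *: B.
    apply/rowP => k; rewrite [RHS]coordD [in RHS]coordZ; have [->|ki] := eqVneq k i.
      by rewrite yi (Bm i) // mulr0 addr0.
    by rewrite ym // xE !coordD !coordZ (Am k ki) mulr0 addr0.
  have [h|] := walk_closed eE u01; first by apply: (offB Y); rewrite ?Y0 // -yE.
  rewrite last_rcons => h; move: yi; rewrite h vA coordD => /eqP.
  by rewrite -subr_eq0 opprD addrA subrr add0r oppr_eq0 (negbTE Ai).
have Yg : Y < g2 by lra.
have xin2 : 0 < (x 0 j - v 0 j) * (B 0 j)^-1 < g2 by rewrite xj Yp.
have [u u01 [yj ym]] := cross_strip (ax e eE) ex xin2 (gap2 _ e1) (gap2 _ e2).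
have yE : segpt e.1 e.2 u = v + (- X) *: A.
  apply/rowP => k; rewrite [RHS]coordD [in RHS]coordZ; have [->|kj] := eqVneq k j.
    by rewrite yj (Am j) 1?eq_sym // mulr0 addr0.
  by rewrite ym // xE !coordD !coordZ (Bm k kj) mulr0 addr0.
have X1 : X < 1 by lra.
have [h|] := walk_closed eE u01.
  by apply: (offA X); rewrite ?Xp ?(ltW X1) // -yE.
rewrite last_rcons => h; have : v + (- X) *: A = a by rewrite -yE.
rewrite vA => /rowP/(_ i); rewrite !coordD coordZ => /eqP.
rewrite -subr_eq0; have -> : a 0 i + A 0 i + - X * A 0 i - a 0 i = (1 - X) * A 0 i by ring.
by rewrite mulf_eq0 (negbTE Ai) orbF subr_eq0 gt_eqF.
Qed.


(** * Preparing a corner *)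

Definition cycle3 (R : realType) (x : 'rV[R]_3) : 'rV[R]_3 := \row_(i < 3) x 0 (i + 1).

Definition stick_list (R : realType) (s : seq 'rV[R]_3) : Prop :=
  [/\ embedded s, integral s, forall e, e \in edges s -> axial e & turning s].

Lemma ord3 (i : 'I_3) : [\/ i = 0, i = 1 | i = 2].
Proof.
case: i => -[|[|[|//]]] lt3; [apply: Or31|apply: Or32|apply: Or33]; exact: val_inj.
Qed.

Lemma pred3K (i : 'I_3) : i - 1 + 1 = i.
Proof. by case: (ord3 i) => ->; exact: val_inj. Qed.

Lemma succ3_eq (i k : 'I_3) : (k + 1 == i) = (k == i - 1).
Proof. by case: (ord3 i) => ->; case: (ord3 k) => ->. Qed.

(** The cyclic permutation of the axes preserves orientation; it is joined to the
    identity by the segment (1 - r) id + r C, of determinant (1 - r)^3 + r^3. *)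
Lemma cycle3_inj (R : realType) (r : R) :
  0 <= r <= 1 -> injective (fun x : 'rV[R]_3 => segpt x (cycle3 x) r).
Proof.
move=> /andP[r0 r1].
suff ker (x : 'rV[R]_3) : segpt x (cycle3 x) r = 0 -> x = 0.
  move=> x y e; apply/eqP; rewrite -subr_eq0; apply/eqP/ker.
  have -> : segpt (x - y) (cycle3 (x - y)) r =
      segpt x (cycle3 x) r - segpt y (cycle3 y) r.
    by apply/rowP => k; rewrite !mxE; ring.
  by rewrite e subrr.
move=> /rowP e.
(* the combinations below are the rows of the adjugate matrix *)
have d0 : (1 - r) ^+ 3 + r ^+ 3 != 0.
  have h1 : 0 <= (1 - r) ^+ 3 by rewrite exprn_ge0 // subr_ge0.
  have h2 : 0 <= r ^+ 3 by rewrite exprn_ge0.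
  have [r00|rn] := eqVneq r 0; first by rewrite r00 subr0 expr1n expr0n addr0 oner_neq0.
  have h3 : 0 < r ^+ 3 by rewrite exprn_gt0 // lt_neqAle eq_sym rn.
  by apply: lt0r_neq0; lra.
have e0 := e 0; have e1 := e 1; have e2 := e 2.
rewrite !mxE in e0 e1 e2.
have i1 : (0 + 1 : 'I_3) = 1 by exact: val_inj.
have i2 : (1 + 1 : 'I_3) = 2 by exact: val_inj.
have i3 : (2 + 1 : 'I_3) = 0 by exact: val_inj.
rewrite i1 in e0; rewrite i2 in e1; rewrite i3 in e2.
set x0 := x 0 0 in e0 e1 e2; set x1 := x 0 1 in e0 e1 e2; set x2 := x 0 2 in e0 e1 e2.
have z0 : x0 = 0.
  apply: (mulfI d0); rewrite mulr0.
  have -> : ((1 - r) ^+ 3 + r ^+ 3) * x0 = (1 - r) ^+ 2 * ((1 - r) * x0 + r * x1)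
    - (1 - r) * r * ((1 - r) * x1 + r * x2) + r ^+ 2 * ((1 - r) * x2 + r * x0) by ring.
  by rewrite e0 e1 e2; ring.
have z1 : x1 = 0.
  apply: (mulfI d0); rewrite mulr0.
  have -> : ((1 - r) ^+ 3 + r ^+ 3) * x1 = (1 - r) ^+ 2 * ((1 - r) * x1 + r * x2)
    - (1 - r) * r * ((1 - r) * x2 + r * x0) + r ^+ 2 * ((1 - r) * x0 + r * x1) by ring.
  by rewrite e0 e1 e2; ring.
have z2 : x2 = 0.
  apply: (mulfI d0); rewrite mulr0.
  have -> : ((1 - r) ^+ 3 + r ^+ 3) * x2 = (1 - r) ^+ 2 * ((1 - r) * x2 + r * x0)
    - (1 - r) * r * ((1 - r) * x0 + r * x1) + r ^+ 2 * ((1 - r) * x1 + r * x2) by ring.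
  by rewrite e0 e1 e2; ring.
by apply: row3P; rewrite [RHS]mxE.
Qed.

Lemma turning_map (R : realType) (f : 'rV[R]_3 -> 'rV[R]_3) s :
  (forall e g c, dir (f e.1, f e.2) = c *: dir (f g.1, f g.2) -> dir e = c *: dir g) ->
  turning s -> turning (map f s).
Proof.
move=> flin tu p c; rewrite edges_map edges_map => /mapP[q qs ->] /= /flin.
exact: tu.
Qed.

Lemma stick_list_cycle3 (R : realType) (s : seq 'rV[R]_3) :
  stick_list s -> stick_list (map (@cycle3 R) s) /\
  ambient_isotopic (carrier s) (carrier (map (@cycle3 R) s)).
Proof.
move=> [emb ints ax tu].
have [||emb' iso] := @isotopic_affine_map _ (@cycle3 R) s _ _ emb.
- by move=> a b t; apply/rowP => k; rewrite !mxE.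
- by move=> r; exact: cycle3_inj.
have dirE e k : dir (cycle3 e.1, cycle3 e.2) 0 k = dir e 0 (k + 1) by rewrite !mxE.
split=> //; split=> //.
- by move=> x i /mapP[y ys ->]; rewrite mxE ints.
- move=> e; rewrite edges_map => /mapP[g /ax /existsP[i /eqP gE] ->].
  apply/existsP; exists (i - 1); apply/eqP/rowP => k.
  by rewrite part_coord !dirE {1}gE part_coord pred3K -succ3_eq.
- apply: turning_map => // e g c /rowP h; apply/rowP => k.
  have coordZ (v : 'rV[R]_3) m : (c *: v) 0 m = c * v 0 m by rewrite mxE.
  by have := h (k - 1); rewrite !coordZ !dirE pred3K.
Qed.

Lemma turning_axes (R : realType) (s : seq 'rV[R]_3) e f i j :
  embedded s -> turning s -> (e, f) \in edges (edges s) ->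
  dir e = part (dir e) i -> dir f = part (dir f) j -> i != j.
Proof.
move=> emb tu ps eE fE; apply: contraPneq (tu (e, f)) => ij.
have [_ /= fs] := mem_edges ps; have [/= es _] := mem_edges ps.
have ei : dir e 0 i != 0.
  by apply: contraNneq (edge_dir_neq0 emb es) => h; rewrite eE /part h scale0r.
move=> /(_ (dir f 0 j / dir e 0 i) ps); apply.
by rewrite /= fE {2}eE /part -ij scalerA part_coord eqxx divfK.
Qed.

Definition corner_plane (R : realType) (k : 'I_3) (s : seq 'rV[R]_3) : Prop :=
  exists a v b t, [/\ s = a :: v :: b :: t, dir (a, v) 0 k = 0 & dir (v, b) 0 k = 0].

Lemma corner_plane_cycle3 (R : realType) k (s : seq 'rV[R]_3) :
  corner_plane (k + 1) s -> corner_plane k (map (@cycle3 R) s).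
Proof.
move=> [a [v [b [t [-> h1 h2]]]]]; exists (cycle3 a), (cycle3 v), (cycle3 b), (map (@cycle3 R) t).
by split=> //; [rewrite -[RHS]h1|rewrite -[RHS]h2]; rewrite !mxE.
Qed.

(** The legs of a corner leave out one axis, which a cyclic permutation turns into
    the last one. *)
Lemma corner_in_first_plane (R : realType) (s : seq 'rV[R]_3) :
  stick_list s -> exists s', [/\ stick_list s',
    ambient_isotopic (carrier s) (carrier s'), size s' = size s &
    corner_plane 2 s'].
Proof.
move=> sl; have [emb _ _ _] := sl.
have [a [v [b [t sE]]]] : exists a v b t, s = a :: v :: b :: t.
  by case: emb => s2 _; case: s s2 {sl} => [|a [|v [|b t]]] // _; exists a, v, b, t.
have [k [ak vk]] : exists k, dir (a, v) 0 k = 0 /\ dir (v, b) 0 k = 0.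
  have [_ _ ax tu] := sl.
  have edgE : edges s = (a, v) :: (v, b) :: walk b (rcons t a).
    by rewrite sE; exact: (edges_cat a b [:: v]).
  have /existsP[i /eqP iE] : axial (a, v) by apply: ax; rewrite edgE mem_head.
  have /existsP[j /eqP jE] : axial (v, b) by apply: ax; rewrite edgE !inE eqxx orbT.
  have [k ki kj] : exists2 k : 'I_3, k != i & k != j.
    case: (ord3 i) => ->; case: (ord3 j) => ->;
      by [exists 0|exists 1|exists 2].
  by exists k; rewrite iE jE !part_coord (negbTE ki) (negbTE kj).
have cor : corner_plane k s by exists a, v, b, t.
have [sl1 iso1] := stick_list_cycle3 sl.
have [sl2 iso2] := stick_list_cycle3 sl1.
case: (ord3 k) cor => -> cor.
- exists (map (@cycle3 R) s); split; rewrite ?size_map //.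
  by apply: corner_plane_cycle3; rewrite (_ : 2 + 1 = 0) //; exact: val_inj.
- exists (map (@cycle3 R) (map (@cycle3 R) s)); split; rewrite ?size_map //.
    exact: ambient_isotopic_trans iso2.
  apply: corner_plane_cycle3; rewrite (_ : 2 + 1 = 0); last exact: val_inj.
  by apply: corner_plane_cycle3; rewrite (_ : 0 + 1 = 1) //; exact: val_inj.
- by exists s; split=> //; exact: ambient_isotopic_refl.
Qed.

(** The unit interval with one end at z, on the side of a, starts here. *)
Definition leg_start (R : realType) (z a : R) : R := if z < a then z else z - 1.

Lemma stretch1_int (R : realType) (c L x : R) :
  c \in Num.int -> x \in Num.int ->
  (x <= c /\ stretch1 c L x = x) \/ (c + 1 <= x /\ stretch1 c L x = x + L).
Proof.
move=> ci xi; have [xc|cx] := leP x c; first by left; rewrite stretch1_left.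
right; have h : c + 1 <= x.
  have [m mE] := intrP ci; have [n nE] := intrP xi.
  by move: cx; rewrite mE nE ltr_int -intrD1 ler_int => h; rewrite lezD1.
by rewrite stretch1_right.
Qed.

(** Integers lie on either side of the dilated unit interval, hence move by 0 or
    by L.  So the leg from z to a gains the length L, and next to z a strip of
    width 1 + L contains the image of no integer; the second claim is normalised
    by the length of the leg. *)
Lemma stretch1_leg (R : realType) (z a L : R) :
  z \in Num.int -> a \in Num.int -> z != a -> 0 <= L ->
  let st := stretch1 (leg_start z a) L in
  `|st a - st z| = `|a - z| + L /\
  forall y, y \in Num.int ->
    ~ 0 < (st y - st z) * (st a - st z)^-1 < (1 + L) / (`|a - z| + L).
Proof.
move=> zi ai za L0 st.
have ci : leg_start z a \in Num.int.
  by rewrite /leg_start; case: ifP => _; rewrite ?rpredB ?rpred1.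
have S0 : 0 < `|a - z| + L by rewrite ltr_wpDr // normr_gt0 subr_eq0 eq_sym.
have stP y : y \in Num.int -> (y <= leg_start z a /\ st y = y) \/
    (leg_start z a + 1 <= y /\ st y = y + L) by exact: stretch1_int.
move: S0 stP; rewrite /leg_start; have [lt|le] := ltP z a => S0 stP.
  have stz : st z = z by have [[_ ->]//|[h _]] := stP z zi; lra.
  have sta : st a = a + L by have [[h _]|[_ ->]//] := stP a ai; lra.
  have S0' : 0 < a - z + L by lra.
  have nE : `|a - z| = a - z by rewrite gtr0_norm // subr_gt0.
  rewrite stz sta nE; have -> : a + L - z = a - z + L by ring.
  split=> [|y yi]; first by rewrite gtr0_norm.
  rewrite ltr_pM2r ?invr_gt0 // pmulr_lgt0 ?invr_gt0 // => /andP[h1 h2].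
  by have [[h e]|[h e]] := stP y yi; move: h1 h2; rewrite e; lra.
have lt : a < z by rewrite lt_neqAle le eq_sym za.
have stz : st z = z + L by have [[h _]|[_ ->]//] := stP z zi; lra.
have az : a <= z - 1.
  have [[h _]//|[h _]] := stP a ai; lra.
have sta : st a = a by have [[_ ->]//|[h _]] := stP a ai; lra.
have nE : `|a - z| = z - a by rewrite distrC gtr0_norm // subr_gt0.
rewrite nE in S0 *; rewrite stz sta; have -> : a - (z + L) = - (z - a + L) by ring.
split=> [|y yi]; first by rewrite normrN gtr0_norm.
rewrite invrN mulrN -mulNr ltr_pM2r ?invr_gt0 // pmulr_lgt0 ?invr_gt0 // => /andP[h1 h2].
have [[h e]|[h e]] := stP y yi; move: h1 h2; rewrite e; lra.
Qed.

Lemma part_eq0 (R : realType) (d : 'rV[R]_3) i m : d = part d i -> m != i -> d 0 m = 0.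
Proof. by move=> -> mi; rewrite part_coord (negbTE mi). Qed.

Lemma axes_not_multiple (R : realType) (d d' : 'rV[R]_3) i j c :
  d = part d i -> d' = part d' j -> i != j -> d' != 0 -> d' <> c *: d.
Proof.
move=> dE dE' ij d'0 h; move/eqP: d'0; apply.
rewrite dE' /part h mxE (part_eq0 dE) ?mulr0 ?scale0r //.
by rewrite eq_sym.
Qed.

(** Each leg is lengthened by the length of the other one.  If p and q are the
    lengths, then both become S = p + q, and the vertex-free strips beside the
    corner get the widths 1 + q and 1 + p, whose sum exceeds S. *)
Lemma cut_stick_list (R : realType) (s : seq 'rV[R]_3) :
  stick_list s -> corner_plane 2 s ->
  exists s' a b t m, [/\ s' = a :: b :: t /\ size s = (size s').+1,
    embedded s' /\ integral s', ambient_isotopic (carrier s) (carrier s'),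
    (forall e, e \in walk b (rcons t a) -> axial e) /\ turning s' &
    exists2 eps : R, eps = 1 \/ eps = -1 & [/\ m != 0, dir (a, b) 0 0 = m%:~R,
      dir (a, b) 0 1 = eps * m%:~R & dir (a, b) 0 2 = 0]].
Proof.
move=> [emb ints ax tu] [a [v [b [t [sE a2 b2]]]]].
have edgE : edges s = (a, v) :: (v, b) :: walk b (rcons t a).
  by rewrite sE; exact: (edges_cat a b [:: v]).
have es1 : (a, v) \in edges s by rewrite edgE mem_head.
have es2 : (v, b) \in edges s by rewrite edgE !inE eqxx orbT.
have /existsP[i /eqP iE] := ax _ es1.
have /existsP[j /eqP jE] := ax _ es2.
have ij : i != j.
  apply: (turning_axes emb tu _ iE jE).
  by rewrite edgE edges_cons /walk /= mem_head.
have pn0 : dir (a, v) 0 i != 0.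
  by apply: contraNneq (edge_dir_neq0 emb es1) => h; rewrite iE /part h scale0r.
have qn0 : dir (v, b) 0 j != 0.
  by apply: contraNneq (edge_dir_neq0 emb es2) => h; rewrite jE /part h scale0r.
have i2 : i != 2 by apply: contraNneq pn0 => ->; rewrite a2.
have j2 : j != 2 by apply: contraNneq qn0 => ->; rewrite b2.
have Az m : m != i -> dir (a, v) 0 m = 0 by exact: part_eq0.
have Bz m : m != j -> dir (v, b) 0 m = 0 by exact: part_eq0.
have ji : j != i by rewrite eq_sym.
have t0 : (0 < size t)%N.
  rewrite lt0n; apply/eqP => /size0nil tnil.
  have /existsP[k /eqP kE] : axial (b, a).
    by apply: ax; rewrite edgE tnil !inE eqxx !orbT.
  have dba m : dir (b, a) 0 m = - (dir (a, v) 0 m + dir (v, b) 0 m).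
    by rewrite !mxE /=; ring.
  have hi : dir (b, a) 0 i != 0 by rewrite dba oppr_eq0 (Bz _ ij) addr0.
  have hj : dir (b, a) 0 j != 0 by rewrite dba oppr_eq0 (Az _ ji) add0r.
  have ki : i = k by apply/eqP; apply: contraNT hi => h; rewrite (part_eq0 kE h).
  have kj : j = k by apply/eqP; apply: contraNT hj => h; rewrite (part_eq0 kE h).
  by rewrite ki kj eqxx in ij.
pose c m := if m == i then leg_start (v 0 i) (a 0 i) else
            if m == j then leg_start (v 0 j) (b 0 j) else 0.
pose L m := if m == i then `|dir (v, b) 0 j| else
            if m == j then `|dir (a, v) 0 i| else 0.
pose S := `|dir (a, v) 0 i| + `|dir (v, b) 0 j|.
have L0 m : 0 <= L m by rewrite /L; do 2?case: ifP.
pose f := stretch c L.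
have [emb1 iso1] := isotopic_stretch c L0 emb ax.
have fE x m : f x 0 m = stretch1 (c m) (L m) (x 0 m) by rewrite mxE.
have as' : a \in s by rewrite sE mem_head.
have vs : v \in s by rewrite sE !inE eqxx orbT.
have bs : b \in s by rewrite sE !inE eqxx !orbT.
have nz m (x y : 'rV[R]_3) : dir (x, y) 0 m != 0 -> y 0 m != x 0 m.
  by rewrite !mxE subr_eq0.
have nz' m (x y : 'rV[R]_3) : dir (x, y) 0 m != 0 -> x 0 m != y 0 m.
  by move=> /nz; rewrite eq_sym.
have ci : c i = leg_start (v 0 i) (a 0 i) by rewrite /c eqxx.
have Li : L i = `|dir (v, b) 0 j| by rewrite /L eqxx.
have cj : c j = leg_start (v 0 j) (b 0 j) by rewrite /c (negbTE ji) eqxx.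
have Lj : L j = `|dir (a, v) 0 i| by rewrite /L (negbTE ji) eqxx.
have cint m : c m \in Num.int.
  rewrite /c /leg_start.
  by do 4?case: ifP => _; rewrite ?rpred0 ?rpredB ?rpred1 ?(ints _ _ vs).
have Lint m : L m \in Num.int.
  rewrite /L; do 2?case: ifP => _; rewrite ?rpred0 //.
    by case: ger0P => _; rewrite ?rpredN (dir_integral _ ints).
  by case: ger0P => _; rewrite ?rpredN (dir_integral _ ints).
have [len1 gap1] := stretch1_leg (ints v i vs) (ints a i as') (nz _ _ _ pn0) (L0 i).
have [len2 gap2] := stretch1_leg (ints v j vs) (ints b j bs) (nz' _ _ _ qn0) (L0 j).
rewrite -ci -!fE in len1 gap1; rewrite -cj -!fE in len2 gap2.
have va : `|a 0 i - v 0 i| = `|dir (a, v) 0 i| by rewrite !mxE distrC.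
have vb : `|b 0 j - v 0 j| = `|dir (v, b) 0 j| by rewrite !mxE.
rewrite va Li in len1 gap1; rewrite vb Lj (addrC `|dir (v, b) 0 j|) in len2 gap2.
have S0 : 0 < S by rewrite addr_gt0 // normr_gt0.
have dfE e m : dir (f e.1, f e.2) 0 m = f e.2 0 m - f e.1 0 m by rewrite !mxE.
have f_axis e k : dir e = part (dir e) k ->
    dir (f e.1, f e.2) = part (dir (f e.1, f e.2)) k.
  move=> eE; apply/rowP => m; rewrite part_coord; case: eqVneq => [->//|mk].
  by rewrite dfE !fE (axial_coord eE mk) subrr.
have ax1 e : e \in edges (map f s) -> axial e.
  rewrite edges_map => /mapP[g /ax /existsP[k /eqP gE] ->].
  by apply/existsP; exists k; apply/eqP/f_axis.
have int1 : integral (map f s).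
  move=> x m /mapP[y ys ->]; rewrite fE.
  by have [[_ ->]|[_ ->]] := stretch1_int (L m) (cint m) (ints y m ys); rewrite ?rpredD ?ints.
have tu1 : turning (map f s).
  move=> p k; rewrite !edges_map => /mapP[[e g] ps ->] /=.
  have [/= es gs] := mem_edges ps.
  have /existsP[m /eqP mE] := ax _ es.
  have /existsP[n /eqP nE] := ax _ gs.
  apply: (axes_not_multiple (f_axis e m mE) (f_axis g n nE)).
    exact: turning_axes emb tu ps mE nE.
  apply: (edge_dir_neq0 emb1); rewrite edges_map.
  by apply/mapP; exists g.
have sE1 : map f s = f a :: f v :: f b :: map f t by rewrite sE.
have edgE1 : edges (map f s) = (f a, f v) :: (f v, f b) :: walk (f b) (rcons (map f t) (f a)).
  by rewrite sE1; exact: (edges_cat (f a) (f b) [:: f v]).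
rewrite sE1 in emb1 iso1.
have [|||||||emb2 iso2] := @cut_right_angle _ (f a) (f v) (f b) (map f t) i j
  ((1 + `|dir (v, b) 0 j|) / S) ((1 + `|dir (a, v) 0 i|) / S) emb1 _ ij.
- by rewrite size_map.
- exact: f_axis (a, v) i iE.
- exact: f_axis (v, b) j jE.
- rewrite -mulrDl ltr_pdivlMr // mul1r /S; lra.
- move=> x; rewrite -sE1 => /mapP[y ys ->].
  by rewrite (dfE (a, v)) /= -invrN opprB (fE y) Li; exact: gap1 (ints y i ys).
- move=> x; rewrite -sE1 => /mapP[y ys ->].
  by rewrite (dfE (v, b)) /= (fE y) Lj; exact: gap2 (ints y j ys).
- by move=> e eE; apply: ax1; rewrite edgE1 !inE eE !orbT.
have D0 k : dir (f a, f b) 0 k = dir (f a, f v) 0 k + dir (f v, f b) 0 k.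
  by rewrite !mxE /=; ring.
have fAz m : m != i -> dir (f a, f v) 0 m = 0 by exact: part_eq0 (f_axis (a, v) i iE).
have fBz m : m != j -> dir (f v, f b) 0 m = 0 by exact: part_eq0 (f_axis (v, b) j jE).
have Di : `|dir (f a, f b) 0 i| = S.
  by rewrite D0 (fBz _ ij) addr0 (dfE (a, v)) /= distrC len1.
have Dj : `|dir (f a, f b) 0 j| = S.
  by rewrite D0 (fAz _ ji) add0r (dfE (v, b)) /= len2.
have [m mE] : exists m : int, dir (f a, f b) 0 0 = m%:~R.
  apply/intrP; rewrite (dfE (a, b)) rpredB // int1 //; apply/mapP;
    by [exists b|exists a].
have [DS0 DS1] : `|dir (f a, f b) 0 0| = S /\ `|dir (f a, f b) 0 1| = S.
  by move: Di Dj ij i2 j2; case: (ord3 i) => ->; case: (ord3 j) => ->.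
have D0n : dir (f a, f b) 0 0 != 0 by rewrite -normr_gt0 DS0.
have D1n : dir (f a, f b) 0 1 != 0 by rewrite -normr_gt0 DS1.
have [eps eps1 epsE] : exists2 eps : R, eps = 1 \/ eps = -1 &
    dir (f a, f b) 0 1 = eps * dir (f a, f b) 0 0.
  have := etrans DS0 (esym DS1).
  by case: (ger0P (dir _ 0 0)) => _; case: (ger0P (dir _ 0 1)) => _ h;
    [exists 1; [left|rewrite mul1r]|exists (-1); [right|rewrite mulN1r h opprK]
    |exists (-1); [right|rewrite mulN1r]|exists 1; [left|rewrite mul1r; apply: oppr_inj]].
have axial01 (e : 'rV[R]_3 * 'rV[R]_3) : axial e -> dir e 0 0 = 0 \/ dir e 0 1 = 0.
  move=> /existsP[k /eqP kE]; case: (eqVneq k 0) => [k0|k0].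
    by right; apply: (part_eq0 kE); rewrite k0.
  by left; apply: (part_eq0 kE); rewrite eq_sym.
exists (map f (a :: b :: t)), (f a), (f b), (map f t), m; split.
- by rewrite sE /= size_map.
- split=> // x k /mapP[y ys ->]; apply: int1; apply/mapP; exists y => //.
  by rewrite sE; move: ys; rewrite !inE => /or3P[]->; rewrite ?orbT.
- exact: ambient_isotopic_trans iso2.
- split; first by move=> e eE; apply: ax1; rewrite edgE1 !inE eE !orbT.
  have [e [E' EE]] : exists e E', walk (f b) (rcons (map f t) (f a)) = e :: E'.
    case: (map f t) => [|x u]; first by exists (f b, f a), [::].
    by exists (f b, x), (walk x (rcons u (f a))).
  have inE' g : g \in e :: E' -> axial g /\ dir g != 0.
    move=> gE; have gs : g \in edges (map f s).
      by rewrite edgE1 EE !inE -in_cons gE !orbT.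
    by split; [exact: ax1|apply: (edge_dir_neq0 emb1); rewrite -sE1].
  have edgE2 : edges (map f (a :: b :: t)) = (f a, f b) :: e :: E'.
    by rewrite -EE; exact: (edges_cat (f a) (f b) [::]).
  move=> p k; rewrite edgE2 edges_cons /walk /= -/(walk _ _) walk_rcons inE mem_rcons inE.
  case/or3P => [/eqP ->|/eqP ->|pE] /= h.
  + have [ax_e e0] := inE' e (mem_head _ _).
    have k0 : k = 0.
      have coordZ (x : 'rV[R]_3) l : (k *: x) 0 l = k * x 0 l by rewrite mxE.
      by have [] := axial01 e ax_e; rewrite h coordZ => /eqP; rewrite mulf_eq0
        ?(negbTE D0n) ?(negbTE D1n) orbF => /eqP.
    by rewrite h k0 scale0r eqxx in e0.
  + have [ax_e _] := inE' _ (mem_last e E').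
    have coordZ (x : 'rV[R]_3) l : (k *: x) 0 l = k * x 0 l by rewrite mxE.
    have [z|z] := axial01 _ ax_e.
      by move: D0n; rewrite h coordZ z mulr0 eqxx.
    by move: D1n; rewrite h coordZ z mulr0 eqxx.
  + apply: (tu1 p k) => //; rewrite edgE1 EE edges_cons /walk /= -/(walk _ _) walk_rcons.
    by rewrite !inE mem_rcons inE pE !orbT.
exists eps => //; split.
- by apply: contraNneq D0n => m0; rewrite mE m0.
- exact: mE.
- by rewrite epsE mE.
- by rewrite D0 fAz 1?eq_sym // fBz 1?eq_sym // addr0.
Qed.

(** * From the cubic lattice to the sh-lattice *)

(** The linear map sending the cubic basis to x, to (eta/2, sqrt 3/2, 0), which is
    y or z according to the sign eta, and to w. *)
Definition shear (R : realType) (eta : R) (x : 'rV[R]_3) : 'rV[R]_3 :=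
  vec3 (x 0 0 + eta / 2 * x 0 1) (Num.sqrt 3 / 2 * x 0 1) (x 0 2).

Lemma sqrt3_gt0 (R : realType) : 0 < Num.sqrt 3 / 2 :> R.
Proof. by rewrite divr_gt0 // sqrtr_gt0. Qed.

Lemma shear_affine (R : realType) (eta : R) : affine_map (shear eta).
Proof.
move=> a b t; apply: row3P; rewrite segpt_coord /shear ?vec3_0 ?vec3_1 ?vec3_2;
  rewrite !segpt_coord; ring.
Qed.

(** The matrix of (1 - r) id + r (shear eta) is triangular with a positive
    diagonal. *)
Lemma shear_inj (R : realType) (eta r : R) :
  0 <= r <= 1 -> injective (fun x => segpt x (shear eta x) r).
Proof.
move=> /andP[r0 r1] x y /rowP e.
have e0 := e 0; have e1 := e 1; have e2 := e 2.
rewrite !segpt_coord /shear !vec3_0 in e0.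
rewrite !segpt_coord /shear !vec3_1 in e1.
rewrite !segpt_coord /shear !vec3_2 in e2.
have x1 : x 0 1 = y 0 1.
  have c0 : 1 - r + r * (Num.sqrt 3 / 2) != 0 :> R.
    have s0 := sqrt3_gt0 R; have [->|rn] := eqVneq r 0.
      by rewrite subr0 mul0r addr0 oner_neq0.
    have h : 0 < r * (Num.sqrt 3 / 2) by rewrite mulr_gt0 // lt_neqAle eq_sym rn.
    by apply: lt0r_neq0; lra.
  by apply: (mulfI c0); lra.
apply: row3P => //; last by lra.
by rewrite x1 in e0; lra.
Qed.

Lemma shear_dir (R : realType) (eta : R) e :
  dir (shear eta e.1, shear eta e.2) = shear eta (dir e).
Proof.
rewrite /dir /=; apply: row3P; rewrite !mxE /=; ring.
Qed.

Lemma shear_decomp (R : realType) (eta : R) x :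
  shear eta x = x 0 0 *: vec3 1 0 0 + x 0 1 *: vec3 (eta / 2) (Num.sqrt 3 / 2) 0 +
    x 0 2 *: vec3 0 0 1.
Proof. by apply: row3P; rewrite !mxE /=; ring. Qed.

Lemma int_span3D (R : realType) (u v w p q : 'rV[R]_3) :
  int_span3 u v w p -> int_span3 u v w q -> int_span3 u v w (p + q).
Proof.
move=> [a [b [c ->]]] [a' [b' [c' ->]]]; exists (a + a'), (b + b'), (c + c').
by rewrite !mulrzDr; apply/rowP => k; rewrite !mxE; ring.
Qed.

Lemma int_span3N (R : realType) (u v w p : 'rV[R]_3) :
  int_span3 u v w p -> int_span3 u v w (- p).
Proof.
move=> [a [b [c ->]]]; exists (- a), (- b), (- c).
by rewrite !mulrNz !opprD.
Qed.

Lemma sh_direction_point (R : realType) f :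
  f \in lattice_directions (sh_lattice R) -> lattice_point (sh_lattice R) f.
Proof.
rewrite /= !inE => /or4P[]/eqP ->.
- by exists 1, 0, 0; rewrite mulr1z !mulr0z !addr0.
- by exists 0, 1, 0; rewrite mulr1z !mulr0z addr0 add0r.
- by exists (-1), 1, 0; rewrite mulrN1z mulr1z !mulr0z addr0 addrC.
- by exists 0, 0, 1; rewrite mulr1z !mulr0z !add0r.
Qed.

Definition sh_vec (R : realType) (eta : R) (i : 'I_3) : 'rV[R]_3 :=
  if i == 0 then vec3 1 0 0 else
  if i == 1 then vec3 (eta / 2) (Num.sqrt 3 / 2) 0 else vec3 0 0 1.

Lemma sh_vec_direction (R : realType) (eta : R) i :
  eta = 1 \/ eta = -1 -> sh_vec eta i \in lattice_directions (sh_lattice R).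
Proof.
have zE : vec3 (1 / 2) (Num.sqrt 3 / 2) 0 - vec3 1 0 0 =
    vec3 (- 1 / 2) (Num.sqrt 3 / 2) 0 :> 'rV[R]_3.
  by apply: row3P; rewrite !mxE /=; field.
by rewrite /sh_vec => -[] ->; case: (ord3 i) => -> /=; rewrite !inE ?zE ?eqxx ?orbT.
Qed.

Lemma shear_sum (R : realType) (eta : R) x : shear eta x = \sum_i x 0 i *: sh_vec eta i.
Proof.
rewrite !big_ord_recl big_ord0 addr0 shear_decomp addrA /sh_vec /=.
by congr (_ *: _ + _ *: _ + _ *: _); congr (x 0 _); exact: val_inj.
Qed.

Lemma sh_directions_neq0 (R : realType) d :
  d \in lattice_directions (sh_lattice R) -> d != 0.
Proof.
have s0 := sqrt3_gt0 R.
rewrite /= !inE => /or4P[]/eqP ->; apply/eqP => /rowP h.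
- by have /eqP := h 0; rewrite !mxE /= oner_eq0.
- by have /eqP := h 1; rewrite !mxE /= gt_eqF.
- by have /eqP := h 1; rewrite !mxE /= subr0 gt_eqF.
- by have /eqP := h 2; rewrite !mxE /= oner_eq0.
Qed.

Lemma cubic_directions_neq0 (R : realType) d :
  d \in lattice_directions (cubic_lattice R) -> d != 0.
Proof.
move=> /cubic_directionP[i ->]; apply/eqP => /rowP /(_ i) /eqP.
by rewrite !mxE !eqxx oner_eq0.
Qed.

Lemma lattice_multiple_along (R : realType) (L : lattice R) e :
  lattice_multiple L e -> exists d r, d \in lattice_directions L /\ dir e = r *: d.
Proof.
move=> [f [n [[fL|fL] eE]]]; first by exists f, n.+1%:R.
by exists (- f), (- n.+1%:R); rewrite scalerN scaleNr opprK.
Qed.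

Lemma turning_shear (R : realType) (eta : R) s :
  turning s -> turning (map (shear eta) s).
Proof.
apply: turning_map => e g c; rewrite !shear_dir => h.
have one : 0 <= (1 : R) <= 1 by rewrite ler01 lexx.
apply: (shear_inj (eta := eta) one); rewrite !segpt1 h.
by apply: row3P; rewrite !mxE /=; ring.
Qed.

Lemma sh_vec_sum (R : realType) :
  sh_vec (-1) 0 + sh_vec (-1) 1 = vec3 (1 / 2) (Num.sqrt 3 / 2) 0 :> 'rV[R]_3.
Proof. by apply: row3P; rewrite /sh_vec /= !mxE /=; field. Qed.

Lemma sh_vec_diff (R : realType) :
  sh_vec 1 0 - sh_vec 1 1 = - (vec3 (1 / 2) (Num.sqrt 3 / 2) 0 - vec3 1 0 0) :> 'rV[R]_3.
Proof. by apply: row3P; rewrite /sh_vec /= !mxE /=; field. Qed.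

(** The sign eta = - eps is chosen so that the two legs, as vectors, are sent to
    multiples of two lattice directions at 120 degrees; their sum, which is the
    image of the new edge, is then a multiple of the third horizontal direction. *)
Lemma sh_polygon_of_cut (R : realType) (a b : 'rV[R]_3) t (m : int) (eps : R) :
  embedded (a :: b :: t) -> integral (a :: b :: t) -> turning (a :: b :: t) ->
  (forall e, e \in walk b (rcons t a) -> axial e) ->
  eps = 1 \/ eps = -1 -> m != 0 -> dir (a, b) 0 0 = m%:~R ->
  dir (a, b) 0 1 = eps * m%:~R -> dir (a, b) 0 2 = 0 ->
  exists P, [/\ lattice_polygon (sh_lattice R) P, has_sticks (sh_lattice R) P (size t).+2 &
    ambient_isotopic (carrier (a :: b :: t)) P].
Proof.
set s := a :: b :: t => emb ints tu ax eps1 m0 d0 d1 d2.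
pose eta := - eps.
have eta1 : eta = 1 \/ eta = -1.
  by rewrite /eta; case: eps1 => ->; [right|left; rewrite opprK].
have [emb' iso] := isotopic_affine_map (@shear_affine _ eta)
  (fun r r01 => shear_inj (eta := eta) r01) emb.
have edgE : edges s = (a, b) :: walk b (rcons t a) by exact: (edges_cat a b [::]).
have mult e : e \in edges (map (shear eta) s) -> lattice_multiple (sh_lattice R) e.
  rewrite edges_map => /mapP[g gs ->].
  move: (gs); rewrite edgE inE => /orP[/eqP gE|gE].
    have DE : dir (shear eta g.1, shear eta g.2) =
        m%:~R *: (sh_vec eta 0 + eps *: sh_vec eta 1).
      rewrite shear_dir gE shear_decomp d0 d1 d2 scale0r addr0 scalerDr scalerA.
      by rewrite mulrC /sh_vec /= (mulrC _ eps).
    case: eps1 => epsE.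
      apply: (@lattice_multiple_int _ _ (vec3 (1 / 2) (Num.sqrt 3 / 2) 0) _ m) => //.
        by rewrite /= !inE eqxx orbT.
      by rewrite DE /eta epsE scale1r sh_vec_sum.
    apply: (@lattice_multiple_int _ _ (vec3 (1 / 2) (Num.sqrt 3 / 2) 0 - vec3 1 0 0) _ (- m)).
    - by rewrite /= !inE eqxx !orbT.
    - by rewrite oppr_eq0.
    by rewrite DE /eta epsE opprK scaleN1r sh_vec_diff intrN scaleNr scalerN.
  have /existsP[i /eqP iE] := ax _ gE.
  have [k kE] := intrP (dir_integral i ints gs).
  apply: (@lattice_multiple_int _ _ (sh_vec eta i) _ k).
  - exact: sh_vec_direction.
  - apply: contraTneq (edge_dir_neq0 emb gs) => k0.
    by rewrite iE /part kE k0 scale0r eqxx.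
  - rewrite shear_dir shear_sum (bigD1 i) //= kE big1 ?addr0 // => l li.
    by rewrite (part_eq0 iE li) scale0r.
exists (carrier (map (shear eta) s)); split=> //.
  apply: lattice_polygon_of_multiples => //.
    move=> x f fL Lx; have Lf := sh_direction_point fL.
    by split; [exact: int_span3D|apply: int_span3D => //; exact: int_span3N].
  move=> x /mapP[y ys ->]; rewrite shear_sum.
  have term i : lattice_point (sh_lattice R) (y 0 i *: sh_vec eta i).
    have [k ->] := intrP (ints y i ys).
    have [p [q [r ->]]] := sh_direction_point (sh_vec_direction i eta1).
    exists (p * k), (q * k), (r * k).
    by rewrite scaler_int !mulrzDl !mulrzA.
  by rewrite !big_ord_recl big_ord0 addr0; do 2?apply: int_span3D; exact: term.
have := @has_sticks_turning _ (sh_lattice R) (map (shear eta) s) (@sh_directions_neq0 R) emb'.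
rewrite size_map; apply; first exact: turning_shear.
by move=> e es; apply: lattice_multiple_along; exact: mult.
Qed.

(** * Comparison of the stick numbers *)

Lemma exists_minimum (A : set nat) :
  A !=set0 -> exists m, A m /\ forall k, A k -> (m <= k)%N.
Proof.
move=> [n An]; have exA : exists n, `[< A n >] by exists n; apply/asboolP.
exists (ex_minn exA); case: ex_minnP => m /asboolP Am min.
by split=> // k Ak; apply: min; apply/asboolP.
Qed.

Lemma tame_knot_cubic (R : realType) (K : set 'rV[R]_3) :
  tame_knot K -> exists s, ambient_isotopic K (carrier s) /\ stick_list s.
Proof.
move=> [P [n [v [n2 nsi ->]]] KP].
have emb : embedded (codom v).
  by split; [rewrite size_codom card_ord|apply/nsi_simple].
have [s1 [emb1 iso1 int1 ax1]] := isotopic_integral emb.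
have [s2 [emb2 car2 int2 ax2 tu2]] := merge_collinear emb1 int1 ax1.
exists s2; split=> //; rewrite car2.
by apply: ambient_isotopic_trans iso1; rewrite /carrier -path_carrier_cover.
Qed.

Lemma stick_list_count (R : realType) (s : seq 'rV[R]_3) :
  stick_list s ->
  lattice_polygon (cubic_lattice R) (carrier s) /\
  has_sticks (cubic_lattice R) (carrier s) (size s).
Proof.
move=> [emb ints ax tu]; split; first exact: cubic_polygon_of_axial.
apply: has_sticks_turning => //; first exact: cubic_directions_neq0.
by move=> e es; apply: lattice_multiple_along; exact: cubic_multiple emb ints es (ax e es).
Qed.

Lemma stick_list_of_cubic (R : realType) (P : set 'rV[R]_3) :
  lattice_polygon (cubic_lattice R) P -> exists2 s, stick_list s & P = carrier s.
Proof.
move=> /lattice_polygonP[s [emb -> le]].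
have ints : integral s.
  move=> x i xs; have [[y xy] _] := edges_neighbours xs.
  have [Lx _ _] := le _ xy; exact: (iffLR (cubic_pointP _) Lx).
have ax e : e \in edges s -> axial e.
  move=> es; have [_ _ [d /cubic_directionP[i dE] eE]] := le e es.
  apply/existsP; exists i; apply/eqP/rowP => j; rewrite part_coord.
  rewrite /dir; case: eE => ->; rewrite dE !mxE !eqxx /=; by case: (j == i); rewrite ?oppr0.
have [s' [emb' car' int' ax' tu']] := merge_collinear emb ints ax.
by exists s'.
Qed.

(** Cutting a corner trades two sticks for one. *)
Lemma sh_polygon_of_stick_list (R : realType) (s : seq 'rV[R]_3) :
  stick_list s -> exists P k, [/\ lattice_polygon (sh_lattice R) P,
    has_sticks (sh_lattice R) P k, (k < size s)%N & ambient_isotopic (carrier s) P].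
Proof.
move=> sl; have [s1 [sl1 iso1 size1 corner]] := corner_in_first_plane sl.
have [s2 [a [b [t [m [[sE size2] [emb2 int2] iso2 [ax2 tu2] [eps eps1 [m0 d0 d1 d2]]]]]]]] :=
  cut_stick_list sl1 corner.
subst s2.
have [P [lat sticksP iso3]] := sh_polygon_of_cut emb2 int2 tu2 ax2 eps1 m0 d0 d1 d2.
exists P, (size t).+2; split=> //; first by rewrite -size1 size2.
by apply: ambient_isotopic_trans iso3; exact: ambient_isotopic_trans iso2.
Qed.

Theorem theorem4p5 (R : realType) (K : set 'rV[R]_3) (tameK : tame_knot K) :
  exists s_L s_sh : nat,
    [/\ is_stick_number (cubic_lattice R) (knot_type K) s_L,
        is_stick_number (sh_lattice R) (knot_type K) s_sh
      & (s_sh < s_L)%N].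
Proof.
have [s [Ks sl]] := tame_knot_cubic tameK.
have [lat cnt] := stick_list_count sl.
have [|k [[P [latP KP Pk]] kmin]] :=
    @exists_minimum (stick_counts (cubic_lattice R) (knot_type K)).
  by exists (size s), (carrier s).
have [s' sl' PE] := stick_list_of_cubic latP.
have [_ cnt'] := stick_list_count sl'.
have ksize : k = size s' by apply: has_sticks_unique cnt'; rewrite -PE.
have [Q [j [latQ Qj jk iso]]] := sh_polygon_of_stick_list sl'.
have KQ : knot_type K Q by apply: ambient_isotopic_trans iso; rewrite -PE.
have shj : stick_counts (sh_lattice R) (knot_type K) j by exists Q.
have [|l [shl lmin]] := @exists_minimum (stick_counts (sh_lattice R) (knot_type K)).
  by exists j.
exists k, l; split=> //.
- by split=> //; exists P.
- by rewrite ksize; apply: leq_ltn_trans jk; exact: lmin.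
Qed.
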